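(* Consider clock states as in the context, and for $n,m\ge1$ let $F_{\rm CL}(n,m)$ (respectively $F_{\rm PM}(n,m)$) denote the supremum of the optimal probabilistic-cloning fidelity $F^\Pi_{\rm CL}$ (respectively the optimal probabilistic-metrology fidelity $F^\Pi_{\rm PM}$) over all filters $\Pi=\sum_{E\in\mathsf{Sp}_n}\pi_E|E,n\rangle\langle E,n|$ with $0\le\pi_E\le1$ and arbitrary success probability $P_{\rm succ}>0$. Then, in the limit $m\to\infty$ with $n/\sqrt m\to0$ (that is, along every sequence of pairs $(n,m)$ of positive integers with these properties), both $F_{\rm CL}(n,m)$ and $F_{\rm PM}(n,m)$ are asymptotically equal (ratio tending to $1$) to $$\left[(2\pi)^r\det\widetilde{\mathbf\Sigma}\right]^{-1/2}\,|\widetilde{\mathscr P}_n|\,\Delta V^*,$$ where $\widetilde{\mathbf\Sigma}=\mathbf K\mathbf\Sigma\mathbf K^t$ (with $\mathbf\Sigma$ depending on $m$), $\Delta V^*=\gcd\{[\mathbf K]_r\}$ is the greatest common divisor of all $r\times r$ minors of $\mathbf K$, and $|\widetilde{\mathscr P}_n|$ is the number of elements of $\widetilde{\mathscr P}_n=\{\mathbf K\mathbf n:\mathbf n\in\mathscr P_n\}$.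
   Context: Clock states. $\mathcal H$ is a Hilbert space of finite dimension $d\ge2$ with orthonormal basis $|0\rangle,\dots,|d-1\rangle$; $H|j\rangle=e_j|j\rangle$ with real, pairwise distinct $e_j$ and $e_0=0$; $|\psi_0\rangle=\sum_{j=0}^{d-1}\sqrt{p_j}|j\rangle$ with all $p_j>0$, $\sum_jp_j=1$; $|\psi_t\rangle=e^{-itH}|\psi_0\rangle$, $t\in\mathbb R$; $|\Psi^n_t\rangle=|\psi_t\rangle^{\otimes n}$. Energies. $\mathscr P_n$ is the set of $\mathbf n=(n_1,\dots,n_{d-1})^t\in\mathbb Z^{d-1}$ with $n_j\ge0$ and $\sum_{j=1}^{d-1}n_j\le n$; put $n_0=n-\sum_{j\ge1}n_j$ and $E_{\mathbf n}=\sum_{j=1}^{d-1}e_jn_j$. $\mathsf{Sp}_n=\{E_{\mathbf n}:\mathbf n\in\mathscr P_n\}$ is the set of distinct total energies of $n$ clocks. $p_{\mathbf n,n}=n!\prod_{j=0}^{d-1}p_j^{n_j}/n_j!$ and $p_{E,n}=\sum_{\mathbf n\in\mathscr P_n:\,E_{\mathbf n}=E}p_{\mathbf n,n}$. $|E,n\rangle$ is the unit vector proportional to the projection of $|\psi_0\rangle^{\otimes n}$ onto the eigenspace of the total Hamiltonian (the sum of $n$ copies of $H$) with eigenvalue $E$, so that $|\Psi^n_t\rangle=\sum_{E\in\mathsf{Sp}_n}e^{-iEt}\sqrt{p_{E,n}}\,|E,n\rangle$. Rationally independent units. Let $r$ be the minimal number of real numbers $\varepsilon_1,\dots,\varepsilon_r$,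 linearly independent over $\mathbb Q$, such that $e_j=\sum_{l=1}^r\varepsilon_lk_{lj}$ with $k_{lj}\in\mathbb Z$ for all $j=1,\dots,d-1$. Fix such units; $\mathbf K$ is the $r\times(d-1)$ integer matrix with entries $k_{lj}$. For given $m$, $\mathbf\Sigma$ is the $(d-1)\times(d-1)$ matrix with $\Sigma_{jj}=mp_j(1-p_j)$ and $\Sigma_{jl}=-mp_jp_l$ for $j\ne l$ ($1\le j,l\le d-1$). Filtered state. For a filter $\Pi$, $P_{\rm succ}=\langle\Psi^n_t|\Pi|\Psi^n_t\rangle=\sum_{E\in\mathsf{Sp}_n}\pi_Ep_{E,n}$ (independent of $t$) and $|\Psi^{n,\Pi}_t\rangle=\Pi^{1/2}|\Psi^n_t\rangle/\sqrt{P_{\rm succ}}$. Probabilistic metrology fidelity. $F^\Pi_{\rm PM}$ (for $m$ output copies) is the supremum, over all POVMs $M$ on $\mathbb R$ acting on $\mathcal H^{\otimes n}$ and all probability distributions $(\hat p_{E,m})_{E\in\mathsf{Sp}_m}$, of $$\inf_{t\in\mathbb R}\int_{\mathbb R}\langle\Psi^{n,\Pi}_t|M(d\hat t)|\Psi^{n,\Pi}_t\rangle\,\left|\langle\hat\Psi^m_{\hat t}|\Psi^m_t\rangle\right|^2,\qquad |\hat\Psi^m_{\hat t}\rangle=\sum_{E\in\mathsf{Sp}_m}e^{-iE\hat t}\sqrt{\hat p_{E,m}}\,|E,m\rangle .$$ Probabilistic cloning fidelity. $F^\Pi_{\rm CL}$ (for $m$ output copies) is the supremum, over all completely positive trace-preserving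 maps $\mathscr D$ from operators on $\mathcal H^{\otimes n}$ to operators on $\mathcal H^{\otimes m}$, of $\inf_{t\in\mathbb R}\langle\Psi^m_t|\mathscr D\big(|\Psi^{n,\Pi}_t\rangle\langle\Psi^{n,\Pi}_t|\big)|\Psi^m_t\rangle$. *)

(* Defs.v *)
(* MathComp-Analysis, with R[i] from real-closed as the field of complex
   numbers. *)
From HB Require Import structures.
From mathcomp Require Import all_boot all_order all_algebra finmap.
From mathcomp Require Import spectral sesquilinear complex.
From mathcomp Require Import all_classical all_reals all_analysis.

Set Implicit Arguments.
Unset Strict Implicit.
Unset Printing Implicit Defensive.

Import Order.TTheory GRing.Theory Num.Theory.
Import numFieldNormedType.Exports.

Local Open Scope classical_set_scope.
Local Open Scope ring_scope.
Local Open Scope complex_scope.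
Local Open Scope sesquilinear_scope.

(* Kets are column vectors, bras are their conjugate transposes. *)

Definition inner (R : realType) (N : nat) (u v : 'cV[R[i]]_N) : R[i] :=
  (u ^t* *m v) 0 0.

Definition ketbra (R : realType) (N : nat) (v : 'cV[R[i]]_N) : 'M[R[i]]_N :=
  v *m v ^t*.

(* <v|A|v>; it is only used for Hermitian A, for which it is real. *)
Definition expect (R : realType) (N : nat) (v : 'cV[R[i]]_N)
  (A : 'M[R[i]]_N) : R := complex.Re (inner v (A *m v)).

Definition normalize (R : realType) (N : nat) (v : 'cV[R[i]]_N) :
  'cV[R[i]]_N := (Num.sqrt (complex.Re (inner v v)))^-1%:C *: v.

(* In R[i], 0 <= z means that z is real and nonnegative, so A is Hermitian. *)
Definition psd (R : realType) (N : nat) (A : 'M[R[i]]_N) : Prop :=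
  forall v : 'cV[R[i]]_N, 0 <= inner v (A *m v).

Definition completely_positive (R : realType) (N N' : nat)
  (D : 'M[R[i]]_N -> 'M[R[i]]_N') : Prop :=
  forall (k : nat) (X : 'I_k -> 'I_k -> 'M[R[i]]_N),
    psd (\mxblock_(i < k, j < k) X i j) ->
    psd (\mxblock_(i < k, j < k) D (X i j)).

Definition trace_preserving (R : realType) (N N' : nat)
  (D : 'M[R[i]]_N -> 'M[R[i]]_N') : Prop := forall X, \tr (D X) = \tr X.

(* The values on sets that are not Borel are constrained only by positivity,
   as for the measures of the library. *)
Record povm (R : realType) (N : nat) := Povm {
  povm_op :> set (measurableTypeR R) -> 'M[R[i]]_N ;
  povm_psd : forall A, psd (povm_op A) ;
  povm_set0 : povm_op set0 = 0 ;
  povm_setT : povm_op setT = 1%:M ;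
  povm_sigma_additive : forall v : 'cV[R[i]]_N,
    semi_sigma_additive (fun A => (expect v (povm_op A))%:E) }.

Definition povm_law (R : realType) (N : nat) (M : povm R N)
  (v : 'cV[R[i]]_N) (A : set (measurableTypeR R)) : \bar R :=
  (expect v (M A))%:E.

Section PovmLaw.
Context (R : realType) (N : nat) (M : povm R N) (v : 'cV[R[i]]_N).

Let law0 : povm_law M v set0 = 0%E.
Proof. by rewrite /povm_law povm_set0 /expect /inner mul0mx mulmx0 mxE. Qed.

Let law_ge0 A : (0 <= povm_law M v A)%E.
Proof. by have := povm_psd M A v; rewrite lecE lee_fin => /andP[]. Qed.

HB.instance Definition _ := isMeasure.Build _ (measurableTypeR R) R
  (povm_law M v) law0 law_ge0 (@povm_sigma_additive R N M v).

End PovmLaw.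

(* The orthogonal projector onto {w : A w = a w}. The transposes are there
   because eigenspace and proj_ortho act on row vectors. *)
Definition eigenproj (R : realType) (N : nat) (A : 'M[R[i]]_N) (a : R[i]) :
  'M[R[i]]_N := (proj_ortho (eigenspace A^T a))^T.

(* The single-clock space is C^(q+1). The basis of its n-th tensor power is
   indexed by the words in {ffun 'I_n -> 'I_q.+1}, through word. *)

Definition tdim (q n : nat) : nat := #|{ffun 'I_n -> 'I_q.+1}|.

Definition word (q n : nat) (a : 'I_(tdim q n)) : {ffun 'I_n -> 'I_q.+1} :=
  enum_val a.

Definition tket (R : realType) (q n : nat) (v : 'cV[R[i]]_q.+1) :
  'cV[R[i]]_(tdim q n) := \col_a \prod_(l < n) v (word a l) 0.

Definition tensop (R : realType) (q n : nat) (A : 'I_n -> 'M[R[i]]_q.+1) :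
  'M[R[i]]_(tdim q n) :=
  \matrix_(a, b) \prod_(l < n) A l (word a l) (word b l).

Definition expi (R : realType) (x : R) : R[i] := cos x +i* sin x.

Section Clocks.
Context (R : realType) (q : nat) (e p : 'I_q.+1 -> R).

Definition ham : 'M[R[i]]_q.+1 := diag_mx (\row_j (e j)%:C).

(* e^(-itH); H is diagonal. *)
Definition evol (t : R) : 'M[R[i]]_q.+1 :=
  diag_mx (\row_j expi (- (t * e j))).

Definition psi0 : 'cV[R[i]]_q.+1 := \col_j (Num.sqrt (p j))%:C.

Definition psi (t : R) : 'cV[R[i]]_q.+1 := evol t *m psi0.

Definition Psi (n : nat) (t : R) : 'cV[R[i]]_(tdim q n) := tket n (psi t).

Definition total_ham (n : nat) : 'M[R[i]]_(tdim q n) :=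
  \sum_(k < n) tensop (fun l : 'I_n => if l == k then ham else 1%:M).

(* The multi-index (n_1, ..., n_q); bounding each entry by n is no
   restriction since their sum is at most n. *)
Definition occupations (n : nat) : {fset {ffun 'I_q -> 'I_n.+1}} :=
  [fset nn | nn : {ffun 'I_q -> 'I_n.+1} & (\sum_j nn j <= n)%N]%fset.

Definition energy (n : nat) (nn : {ffun 'I_q -> 'I_n.+1}) : R :=
  \sum_(j < q) e (lift ord0 j) * (nn j)%:R.

Definition spectrum (n : nat) : {fset R} :=
  [fset energy nn | nn in occupations n]%fset.

Definition eket (n : nat) (E : R) : 'cV[R[i]]_(tdim q n) :=
  normalize (eigenproj (total_ham n) E%:C *m tket n psi0).

(* pi_ is the family of the pi_E; only its values on the spectrum matter. *)
Definition filter_op (n : nat) (pi_ : R -> R) : 'M[R[i]]_(tdim q n) :=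
  \sum_(E <- spectrum n) (pi_ E)%:C *: ketbra (eket n E).

(* The square root of filter_op n pi_, the |E,n> being orthonormal. *)
Definition sqrt_filter_op (n : nat) (pi_ : R -> R) : 'M[R[i]]_(tdim q n) :=
  filter_op n (fun E => Num.sqrt (pi_ E)).

Definition psucc (n : nat) (pi_ : R -> R) (t : R) : R :=
  expect (Psi n t) (filter_op n pi_).

Definition filtered (n : nat) (pi_ : R -> R) (t : R) :
  'cV[R[i]]_(tdim q n) :=
  (Num.sqrt (psucc n pi_ t))^-1%:C *: (sqrt_filter_op n pi_ *m Psi n t).

(* psucc does not depend on t. *)
Definition is_filter (n : nat) (pi_ : R -> R) : Prop :=
  (forall E, E \in spectrum n -> 0 <= pi_ E <= 1) /\
  (forall t, 0 < psucc n pi_ t).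

Definition is_spectral_distribution (m : nat) (phat : R -> R) : Prop :=
  (forall E, E \in spectrum m -> 0 <= phat E) /\
  \sum_(E <- spectrum m) phat E = 1.

Definition estimate (m : nat) (phat : R -> R) (s : R) :
  'cV[R[i]]_(tdim q m) :=
  \sum_(E <- spectrum m)
    (expi (- (E * s)) * (Num.sqrt (phat E))%:C) *: eket m E.

Definition metrology_score (n m : nat) (pi_ : R -> R)
  (M : povm R (tdim q n)) (phat : R -> R) : \bar R :=
  ereal_inf (range (fun t : R =>
    \int[povm_law M (filtered n pi_ t)]_(s in setT)
      (complex.Re (`|inner (estimate m phat s) (Psi m t)| ^+ 2))%:E))%E.

Definition metrology_fidelity_at (n m : nat) (pi_ : R -> R) : \bar R :=
  ereal_sup [set F | exists (M : povm R (tdim q n)) phat,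
    is_spectral_distribution m phat /\ F = metrology_score (n := n) m pi_ M phat].

Definition cloning_score (n m : nat) (pi_ : R -> R)
  (D : 'M[R[i]]_(tdim q n) -> 'M[R[i]]_(tdim q m)) : \bar R :=
  ereal_inf (range (fun t : R =>
    (expect (Psi m t) (D (ketbra (filtered n pi_ t))))%:E)).

Definition cloning_fidelity_at (n m : nat) (pi_ : R -> R) : \bar R :=
  ereal_sup [set F | exists
    D : {linear 'M[R[i]]_(tdim q n) -> 'M[R[i]]_(tdim q m)},
    [/\ completely_positive D, trace_preserving D & F = cloning_score (n := n) (m := m) pi_ D]].

Definition metrology_fidelity (n m : nat) : \bar R :=
  ereal_sup [set metrology_fidelity_at n m pi_ | pi_ in is_filter n].

Definition cloning_fidelity (n m : nat) : \bar R :=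
  ereal_sup [set cloning_fidelity_at n m pi_ | pi_ in is_filter n].

Definition rat_indep (r : nat) (eps : 'I_r -> R) : Prop :=
  forall c : 'I_r -> rat,
    \sum_(l < r) ratr (c l) * eps l = 0 -> forall l, c l = 0.

Definition energy_units (r : nat) (eps : 'I_r -> R) (K : 'M[int]_(r, q)) :
  Prop :=
  rat_indep eps /\
  forall j : 'I_q, e (lift ord0 j) = \sum_(l < r) eps l * (K l j)%:~R.

Definition minimal_energy_units (r : nat) (eps : 'I_r -> R)
  (K : 'M[int]_(r, q)) : Prop :=
  energy_units eps K /\
  forall (r' : nat) (eps' : 'I_r' -> R) (K' : 'M[int]_(r', q)),
    energy_units eps' K' -> (r <= r')%N.

Definition Sigma (m : nat) : 'M[R]_q :=
  \matrix_(j, l)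
    (let pj := p (lift ord0 j) in let pl := p (lift ord0 l) in
     if j == l then m%:R * pj * (1 - pj) else - (m%:R * pj * pl)).

Definition reduced_Sigma (r : nat) (K : 'M[int]_(r, q)) (m : nat) : 'M[R]_r :=
  let KR := map_mx (fun z : int => z%:~R : R) K in KR *m Sigma m *m KR^T.

End Clocks.

Definition occupation_vector (q n : nat) (nn : {ffun 'I_q -> 'I_n.+1}) :
  'cV[int]_q := \col_j (nn j)%:Z.

Definition reduced_occupations (q r : nat) (K : 'M[int]_(r, q)) (n : nat) :
  {fset 'cV[int]_r} :=
  [fset K *m occupation_vector nn | nn in occupations q n]%fset.

(* A maximal minor is given by an increasing choice of r columns. *)
Definition gcd_maximal_minors (q r : nat) (K : 'M[int]_(r, q)) : nat :=
  \big[gcdn/0%N]_(f : {ffun 'I_r -> 'I_q} |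
      [forall i : 'I_r, forall j : 'I_r, (i < j)%N ==> (f i < f j)%N])
    `|\det (colsub f K)|%N.

Definition asymptotic_fidelity (R : realType) (q : nat) (p : 'I_q.+1 -> R)
  (r : nat) (K : 'M[int]_(r, q)) (n m : nat) : R :=
  ((2 * pi) ^+ r * \det (reduced_Sigma p K m)) `^ (- 2^-1)
  * #|` reduced_occupations K n|%:R * (gcd_maximal_minors K)%:R.

(* Main.v *)
(** A filter can give the N = |Sp_n| energy states of the input any weights.
    Averaging over t annihilates the coherences between distinct
    energies of the output, so no strategy exceeds N times the largest
    probability p_{E,m}. Conversely, filter the input to amplitudes that are
    flat on Sp_n, measure it in Fourier states at a long sequence of equidistant
    times, and prepare estimate states with flat amplitudes on a window of side
    l ~ rho sqrt m around the mean energy: up to boundary terms of order n/l this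
    attains N times the smallest p_{E,m} in the window. A measurement followed by
    a preparation is also a channel, so the same strategy serves cloning.

    The p_{E,m} are the point probabilities of a random walk on Z^r: by the
    Smith normal form K = B K' with K' surjective over Z, minimality of r makes
    B nonsingular, so energies correspond to walk positions and |det B| is the
    gcd of the maximal minors of K. The walk obeys a local limit theorem, by
    Fourier inversion on a finite grid of angles; the Gaussian integral enters
    only through Riemann sums, evaluated by completing squares. *)

(* The filtered input varies with the same [t] as the target, so averaging over [t] does not act on
   the target alone. The upper bounds therefore remove the input first: the rank-one operator of a
   unit combination of N orthonormal kets is dominated by the projector onto their span, which is
   independent of [t] and has trace N. Only then are times averaged. All averages run over finite
   arithmetic progressions with an error [d * L]; some time does no worse than the average, and this
   bounds the infimum over [t].

   In the lower bound the finite progression has a price: the Fourier effects add up only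
   approximately to a multiple of the projector, so they are scaled down slightly and completed by a
   remainder effect. The score is the mean square of a trigonometric sum with frequencies E + F, for
   an input energy E and an output energy F, so it counts coincidences E + F = E' + F'. For every
   pair E, E' almost the whole window contributes, because E - E' shifts it by O(n) lattice steps
   while its side is of order sqrt m: this is where n / sqrt m -> 0 enters. *)
Require Import Defs.
From HB Require Import structures.
From mathcomp Require Import all_boot all_order all_algebra all_fingroup finmap.
From mathcomp Require Import spectral sesquilinear complex.
From mathcomp Require Import all_classical all_reals all_analysis.
From mathcomp Require Import measurable_realfun.
From mathcomp Require Import ring lra zify.

Set Implicit Arguments.
Unset Strict Implicit.
Unset Printing Implicit Defensive.

Import Order.TTheory GRing.Theory Num.Theory.
Import numFieldNormedType.Exports.

Local Open Scope classical_set_scope.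
Local Open Scope ring_scope.
Local Open Scope complex_scope.
Local Open Scope sesquilinear_scope.

(** * Gaussian Riemann sums *)

Section GaussianSums.
Context {R : realType}.
Implicit Types (x y s h c d : R).

Let g := @gauss_fun R.
Let mu := @lebesgue_measure R.
Let G x := (\int[mu]_(t in `]-oo, x]) g t)%R.

Let gint (A : set R) : measurable A -> mu.-integrable A (EFin \o g).
Proof.
move=> mA; apply: (integrableS measurableT) => //.
exact: integrableT_gauss.
Qed.

Let G_derive x : is_derive x 1 G (g x).
Proof.
have xx1 : x < x + 1 by rewrite ltrDl.
have gi : mu.-integrable `]-oo, (x + 1)%R] (EFin \o g) by exact: gint.
have H := @continuous_FTC1 R g -oo%O x (x + 1) xx1 gi.
have [d1 d2] : derivable G x 1 /\ derive1 G x = g x.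
  apply: H => //.
  - by rewrite ltNyr.
  - exact: continuous_gauss_fun.
by apply: DeriveDef => //; rewrite -derive1E.
Qed.

Let G_continuous : continuous G.
Proof. by move=> x; apply/differentiable_continuous/derivable1_diffP; case: (G_derive x). Qed.

Let G_mvt x y : x <= y -> exists2 z, x <= z <= y & G y - G x = g z * (y - x).
Proof.
move=> xy; have [|z + ->] := MVT_segment xy (fun z _ => G_derive z).
  exact: continuous_subspaceT.
by rewrite in_itv/= => ?; exists z.
Qed.

Let G_mono : {homo G : x y / x <= y}.
Proof.
move=> x y xy; have [z _] := G_mvt xy; rewrite -subr_ge0 => ->.
by rewrite mulr_ge0 ?subr_ge0// gauss_fun_ge0.
Qed.

Let GE x y : x <= y -> G y - G x = (\int[mu]_(t in `]x, y]) g t)%R.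
Proof. by move=> xy; rewrite Rintegral_itvB//= ?bnd_simp//; exact: gint. Qed.

Let GEE x y : x <= y -> (G y - G x)%:E = (\int[mu]_(t in `]x, y]) (g t)%:E)%E.
Proof.
move=> xy; rewrite GE// /Rintegral fineK//.
by apply: (@integrable_fin_num _ _ _ mu _ _ (EFin \o g)) => //; exact: gint.
Qed.

Let G_le x y : G y - G x <= Num.sqrt pi.
Proof.
have [xy|/ltW yx] := leP x y; last first.
  by rewrite (le_trans _ (sqrtr_ge0 _))// subr_le0 G_mono.
rewrite -lee_fin GEE// -integralT_gauss.
apply: ge0_subset_integral => //=.
- apply/measurable_EFinP; exact: measurable_gauss_fun.
- by move=> z _; rewrite lee_fin gauss_fun_ge0.
Qed.

(** The intervals []-k, k]] exhaust the line, so monotone convergence brings their masses up to the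
    full Gaussian integral. *)
Let G_cvg d : 0 < d -> exists2 A, 0 <= A & Num.sqrt pi - d <= G A - G (- A).
Proof.
move=> d0.
have := @ge0_nondecreasing_set_cvg_integral _ (measurableTypeR R) R
  (fun n => `](- n%:R : R), n%:R]%classic) (EFin \o g) (@lebesgue_measure R).
have -> : \bigcup_i `](- i%:R : R), i%:R]%classic = [set: R].
  apply/seteqP; split => // x _.
  have [k xk] : exists k : nat, `|x| < k%:R.
    by exists (Num.bound `|x|); rewrite archi_boundP.
  exists k => //=; rewrite in_itv/=.
  by move: xk; rewrite ltr_norml => /andP[-> /ltW ->].
rewrite integralT_gauss => H.
have {}H : (fun n : nat => (G n%:R - G (- n%:R))%:E) @ \oo --> (Num.sqrt pi)%:E.
  apply: cvg_trans (H _ _ _ _).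
  - apply: near_eq_cvg; near=> n; rewrite GEE//.
    by rewrite (@le_trans _ _ 0)// oppr_le0.
  - apply/nondecreasing_seqP => k; apply/subsetPset => x /=.
    rewrite !in_itv/= => /andP[kx xk]; apply/andP; split.
      by rewrite (le_lt_trans _ kx)// lerN2 ler_nat.
    by rewrite (le_trans xk)// ler_nat.
  - by move=> i.
  - move=> i; apply: measurable_funTS.
    by apply/measurable_EFinP; exact: measurable_gauss_fun.
  - by move=> i x _; rewrite lee_fin gauss_fun_ge0.
have {}H : (fun n : nat => G n%:R - G (- n%:R)) @ \oo --> Num.sqrt pi.
  by have /fine_cvgP[] := H.
have /cvgrPdist_le /(_ d d0) [k _ /(_ k (leqnn k))] /= := H.
rewrite ler_distlC => /andP[kd _]; exists k%:R => //.
Unshelve. all: by end_near. Qed.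

(* Total variation of the Gaussian on ]-oo, x]. *)
Let V x := if x <= 0 then g x else 2 - g x.

Let g_le1 x : g x <= 1. Proof. exact: gauss_fun_le1. Qed.
Let g_ge0 x : 0 <= g x. Proof. exact: gauss_fun_ge0. Qed.

Let g_mono x y : `|x| <= `|y| -> g y <= g x.
Proof.
by move=> xy; rewrite /g /gauss_fun ler_expR lerN2 -(real_normK (num_real x))
  -(real_normK (num_real y)) lerXn2r// nnegrE.
Qed.

Let V_le x y : V y - V x <= 2.
Proof.
rewrite /V; have := g_le1 x; have := g_le1 y; have := g_ge0 x; have := g_ge0 y.
by do 2 case: ifP => _; lra.
Qed.

Let V_osc x y : x <= y -> `|g y - g x| <= V y - V x.
Proof.
move=> xy; rewrite /V; case: (leP x 0) => x0; case: (leP y 0) => y0.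
- by rewrite ger0_norm// subr_ge0 g_mono// !ler0_norm// lerN2.
- rewrite ler_norml; have := g_le1 x; have := g_le1 y.
  by have := g_ge0 x; have := g_ge0 y; lra.
- by move: x0; rewrite ltNge (le_trans xy).
- have gyx : g y <= g x by rewrite g_mono// !gtr0_norm.
  by rewrite ler0_norm ?subr_le0//; lra.
Qed.

Let V_mono x y : x <= y -> 0 <= V y - V x.
Proof. by move=> /V_osc; apply: le_trans. Qed.

(** By the mean value theorem the integral over one step is [h * g z] with [z] in the step, so the
    error is at most [h] times the variation of [g] there. In [sum_diff] these errors telescope to
    at most [2 * h], whatever the start and the length of the grid. *)
Let step_diff h x : 0 <= h ->
  `|h * g x - (G (x + h) - G x)| <= h * (V (x + h) - V x).
Proof.
move=> h0; have [|z /andP[xz zxh] ->] := @G_mvt x (x + h); first by rewrite lerDl.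
rewrite (addrC x h) addrK [g z * h]mulrC -mulrBr normrM ger0_norm// ler_wpM2l//.
rewrite distrC (le_trans (V_osc xz))//.
have := V_mono zxh; rewrite (addrC x h); lra.
Qed.

Let sum_diff h c L : 0 <= h ->
  `|h * (\sum_(k < L) g (c + h * k%:R)) - (G (c + h * L%:R) - G c)| <= 2 * h.
Proof.
move=> h0.
suff H : `|h * (\sum_(k < L) g (c + h * k%:R)) - (G (c + h * L%:R) - G c)| <=
    h * (V (c + h * L%:R) - V c).
  by rewrite (le_trans H)// mulrC ler_wpM2r// V_le.
elim: L => [|L IH]; first by rewrite big_ord0 !mulr0 !addr0 !subrr normr0 mulr0.
rewrite big_ord_recr/=.
have := step_diff (c + h * L%:R) h0.
rewrite -(natr1 L) (mulrDr h L%:R) mulr1 addrA => S.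
move: IH S; set A := \sum_(_ < _) _.
move=> IH S; apply: (le_trans _ (le_trans (lerD IH S) _)).
  apply: le_trans (ler_normD _ _); rewrite le_eqVlt; apply/orP; left; apply/eqP.
  congr (`| _ |); ring.
by rewrite le_eqVlt; apply/orP; left; apply/eqP; ring.
Qed.

Let scaled s h c L : 0 < s ->
  h * (\sum_(k < L) expR (- (s * (c + h * k%:R) ^+ 2))) =
  (Num.sqrt s)^-1 * (Num.sqrt s * h *
     \sum_(k < L) g (Num.sqrt s * c + Num.sqrt s * h * k%:R)).
Proof.
move=> s0; rewrite [RHS]mulrA mulKf ?gt_eqF ?sqrtr_gt0//; congr (_ * _).
apply: eq_bigr => k _; rewrite /g /gauss_fun; congr (expR (- _)).
by rewrite -mulrA -mulrDr exprMn sqr_sqrtr// ltW.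
Qed.

Lemma gauss_sum_le s h c L : 0 < s -> 0 <= h ->
  h * (\sum_(k < L) expR (- (s * (c + h * k%:R) ^+ 2))) <=
  Num.sqrt (pi / s) + 2 * h.
Proof.
move=> s0 h0; rewrite scaled//.
have s1 : 0 < Num.sqrt s by rewrite sqrtr_gt0.
rewrite mulrC ler_pdivrMr// mulrDl -sqrtrM ?(divr_ge0 (pi_ge0 R) (ltW s0))//.
rewrite divfK ?gt_eqF// -mulrA (mulrC h).
have := sum_diff (Num.sqrt s * c) L (mulr_ge0 (ltW s1) h0).
rewrite ler_norml => /andP[_].
have := G_le (Num.sqrt s * c) (Num.sqrt s * c + Num.sqrt s * h * L%:R).
lra.
Qed.

Lemma gauss_sum_ge s d : 0 < s -> 0 < d -> exists2 A, 0 <= A &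
  forall h c L, 0 <= h -> c <= - A -> A <= c + h * L%:R ->
  Num.sqrt (pi / s) - d - 2 * h <=
  h * (\sum_(k < L) expR (- (s * (c + h * k%:R) ^+ 2))).
Proof.
move=> s0 d0; have s1 : 0 < Num.sqrt s by rewrite sqrtr_gt0.
(* The factor [Num.sqrt s] undoes the rescaling of the variable in [scaled]. *)
have [A A0 HA] := G_cvg (mulr_gt0 d0 s1).
exists (A / Num.sqrt s); first by rewrite divr_ge0// ltW.
move=> h c L h0 cA Ac; rewrite scaled// [leRHS]mulrC.
rewrite ler_pdivlMr// !mulrBl -sqrtrM ?(divr_ge0 (pi_ge0 R) (ltW s0))//.
rewrite divfK ?gt_eqF// -mulrA (mulrC h).
have := sum_diff (Num.sqrt s * c) L (mulr_ge0 (ltW s1) h0).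
rewrite ler_norml => /andP[+ _].
have : G (Num.sqrt s * c) <= G (- A).
  by apply: G_mono; rewrite mulrC -ler_pdivlMr// mulNr.
have : G A <= G (Num.sqrt s * c + Num.sqrt s * h * L%:R).
  by apply: G_mono; rewrite -mulrA -mulrDr [X in _ <= X]mulrC -ler_pdivrMr.
lra.
Qed.

End GaussianSums.

(** * Sums over finite grids in several dimensions *)

Section GridSums.
Context {R : realType}.
Variables (g : nat -> R) (L : nat).

(** Recursive, rather than a sum over functions, so that the first coordinate is summed innermost:
    it is the one that completing the square splits off. *)
Fixpoint gridsum (V : zmodType) (r : nat) : ('rV[R]_r -> V) -> V :=
  match r with
  | 0 => fun F => F 0
  | r'.+1 => fun F =>
      gridsum (fun v : 'rV_r' => \sum_(k < L) F (row_mx (g k)%:M v : 'rV_(1 + r')))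
  end.

Lemma eq_gridsum (V : zmodType) r (F G : 'rV[R]_r -> V) :
  F =1 G -> gridsum F = gridsum G.
Proof. by move=> /funext ->. Qed.

Lemma gridsum_sum (V : zmodType) r (I : finType) (P : pred I)
    (F : I -> 'rV[R]_r -> V) :
  gridsum (fun v => \sum_(i | P i) F i v) = \sum_(i | P i) gridsum (F i).
Proof.
elim: r F => [//|r IH] F /=; rewrite -IH; apply: eq_gridsum => v.
exact: exchange_big.
Qed.

Lemma gridsumZ (V : pzRingType) r a (F : 'rV[R]_r -> V) :
  gridsum (fun v => a * F v) = a * gridsum F.
Proof.
elim: r F => [//|r IH] F /=; rewrite -IH; apply: eq_gridsum => v.
by rewrite mulr_sumr.
Qed.

Lemma gridsumD (V : zmodType) r (F G : 'rV[R]_r -> V) :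
  gridsum (fun v => F v + G v) = gridsum F + gridsum G.
Proof.
elim: r F G => [//|r IH] F G /=; rewrite -IH; apply: eq_gridsum => v.
exact: big_split.
Qed.

Definition on_grid r (v : 'rV[R]_r) := forall i, exists2 k, (k < L)%N & v 0 i = g k.

Lemma ler_gridsum r (F G : 'rV[R]_r -> R) :
  (forall v, on_grid v -> F v <= G v) -> gridsum F <= gridsum G.
Proof.
elim: r F G => [|r IH] F G FG /=; first by apply: FG => -[].
apply: IH => v gv; apply: ler_sum => k _; apply: FG => i.
case: (@split_ordP 1 r i) => j ->.
  by rewrite (row_mxEl (g k)%:M v) ord1 mxE eqxx mulr1n; exists k.
by rewrite (row_mxEr (g k)%:M v).
Qed.

Lemma gridsum0 (V : zmodType) r : gridsum (fun _ : 'rV[R]_r => 0 : V) = 0.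
Proof.
elim: r => [//|r IH] /=; rewrite -[RHS]IH; apply: eq_gridsum => v.
by rewrite big1.
Qed.

Lemma gridsum_ge0 r (F : 'rV[R]_r -> R) :
  (forall v, on_grid v -> 0 <= F v) -> 0 <= gridsum F.
Proof.
move=> F0; rewrite -(gridsum0 R r); exact: ler_gridsum.
Qed.

Lemma gridsum_prod (V : comPzRingType) r (f : 'I_r -> R -> V) :
  gridsum (fun v => \prod_i f i (v 0 i)) = \prod_i \sum_(k < L) f i (g k).
Proof.
elim: r f => [|r IH] f /=; first by rewrite !big_ord0.
rewrite big_ord_recl -(IH (fun i => f (lift ord0 i))) -gridsumZ.
apply: eq_gridsum => v.
rewrite mulr_suml; apply: eq_bigr => k _; rewrite big_ord_recl; congr (f _ _ * _).
  have E := row_mxEl (g k)%:M v 0 0; rewrite [RHS]mxE mulr1n in E.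
  by rewrite -[RHS]E; congr (fun_of_matrix _ _ _); apply/val_inj.
apply: eq_bigr => i _; congr (f _ _).
rewrite -[RHS](row_mxEr (g k)%:M v 0 i).
by congr (fun_of_matrix _ _ _); apply/val_inj.
Qed.

End GridSums.

(** * Gaussian sums in several dimensions through Schur complements *)

Section GaussianGrid.
Context {R : realType}.

Definition qform r (S : 'M[R]_r) (v : 'rV[R]_r) : R := (v *m S *m v^T) 0 0.

Definition posdef r (S : 'M[R]_r) :=
  S^T = S /\ forall v : 'rV_r, v != 0 -> 0 < qform S v.

Section Schur.
Context (r : nat) (S : 'M[R]_(1 + r)).
Hypothesis Spos : posdef S.

Let s := S 0 0.
Let b : 'cV_r := dlsubmx S.
Definition schur : 'M[R]_r := drsubmx S - s^-1 *: (b *m b^T).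
Definition schur_shift (v : 'rV[R]_r) : R := (v *m b) 0 0 / s.

Let Sblock : S = block_mx s%:M b^T b (drsubmx S).
Proof.
have [St _] := Spos.
rewrite -{1}(submxK S); congr (block_mx _ _ _ _).
  rewrite (mx11_scalar (ulsubmx S)); congr (_%:M).
  by rewrite !mxE /s; congr (S _ _); apply/val_inj.
by rewrite /b -{1}St trmx_dlsub.
Qed.

Lemma schur_pivot_gt0 : 0 < s.
Proof.
have [_ Sp] := Spos.
have : (row_mx 1%:M 0 : 'rV[R]_(1 + r)) != 0.
  apply/eqP => /matrixP/(_ 0 (lshift r 0)); rewrite row_mxEl !mxE => /eqP.
  by rewrite oner_eq0.
move=> /Sp; rewrite /qform {1}Sblock mul_row_block !mul1mx !mul0mx !addr0.
by rewrite tr_row_mx mul_row_col trmx0 mulmx0 addr0 trmx1 mulmx1 mxE mulr1n.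
Qed.

(** Completing the square in the first coordinate. The remaining coordinates merely translate it,
    and the one-dimensional bounds hold for every translate of the grid. *)
Lemma qform_schur (w : R) (v : 'rV[R]_r) :
  qform S (row_mx w%:M v) = s * (w + schur_shift v) ^+ 2 + qform schur v.
Proof.
have s0 := schur_pivot_gt0.
rewrite /qform {1}Sblock mul_row_block tr_row_mx mul_row_col.
rewrite /schur /schur_shift mulmxBr mulmxBl -scalemxAr -scalemxAl.
have -> : w%:M *m b^T = (w *: b)^T by rewrite mul_scalar_mx linearZ.
rewrite !mulmxDl -trmx_mul -scalemxAr [v *m (b *m _)]mulmxA.
rewrite -[v *m b *m b^T *m v^T]mulmxA -trmx_mul.
rewrite (mx11_scalar (v *m b)); set be := (v *m b) 0 0.
rewrite scale_scalar_mx !tr_scalar_mx -!scalar_mxM scale_scalar_mx.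
rewrite !mxE !mulr1n; field; exact: lt0r_neq0.
Qed.

Lemma schur_posdef : posdef schur.
Proof.
have [St Sp] := Spos; split.
  rewrite /schur linearB/= linearZ/= trmx_mul trmxK; congr (_ - _).
  by rewrite -{2}St trmx_drsub.
move=> v v0; have := Sp (row_mx (- schur_shift v)%:M v).
rewrite qform_schur addNr expr0n mulr0 add0r; apply.
apply: contra v0 => /eqP; rewrite -[0](@row_mx0 _ _ 1 r) => /eq_row_mx[_ ->].
by [].
Qed.

(** One step of block Gaussian elimination, read as a factorization into two block triangular
    matrices. *)
Lemma det_schur : \det S = s * \det schur.
Proof.
have s0 := schur_pivot_gt0.
have -> : S = block_mx 1%:M 0 (s^-1 *: b) 1%:M *m block_mx s%:M b^T 0 schur.
  rewrite mulmx_block !mul1mx !mul0mx !addr0 {1}Sblock.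
  congr (block_mx _ _ _ _).
    by rewrite mul_mx_scalar scalerA mulfV ?gt_eqF// scale1r.
  by rewrite /schur -scalemxAl addrC subrK.
by rewrite det_mulmx det_lblock det_ublock !det1 !mul1r det_scalar1.
Qed.

End Schur.
End GaussianGrid.

Section GaussianGridLimit.
Context {R : realType}.

Lemma posdef_det_gt0 r (S : 'M[R]_r) : posdef S -> 0 < \det S.
Proof.
elim: r S => [|r IH] S Sp; first by rewrite det_mx00.
by rewrite (det_schur (Sp : posdef (S : 'M[R]_(1 + r)))) mulr_gt0 ?schur_pivot_gt0// IH//;
  exact: schur_posdef.
Qed.

(** The closed form of the integral of [expR (- qform S v)] over the whole space; the integral
    itself is never formed. *)
Definition gauss_mass r (S : 'M[R]_r) : R := Num.sqrt (pi ^+ r / \det S).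

Lemma gauss_mass_ge0 r (S : 'M[R]_r) : 0 <= gauss_mass S.
Proof. exact: sqrtr_ge0. Qed.

Lemma gauss_mass_schur r (S : 'M[R]_(1 + r)) : posdef S ->
  gauss_mass S = Num.sqrt (pi / S 0 0) * gauss_mass (schur S).
Proof.
move=> Sp; rewrite /gauss_mass det_schur// exprS invfM mulrACA sqrtrM//.
by rewrite divr_ge0 ?pi_ge0// ltW// schur_pivot_gt0.
Qed.

(** Since [e <= 1], replacing [a * b] by [(a + e) * (b + e)] or by [(a - e) * (b - e)] costs at most
    [e * (a + b + 1)]. *)
Let split_eps (a b d : R) : 0 <= a -> 0 <= b -> 0 < d ->
  exists2 e, 0 < e & e * (a + b + 1) <= d /\ e <= 1.
Proof.
move=> a0 b0 d0; exists (Num.min 1 (d / (a + b + 1))).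
  by rewrite lt_min ltr01 divr_gt0//; lra.
split; last by rewrite ge_min lexx.
by rewrite -ler_pdivlMr ?ge_min ?lexx ?orbT//; lra.
Qed.

Lemma gauss_grid_le r (S : 'M[R]_r) (d : R) : posdef S -> 0 < d ->
  exists2 h0, 0 < h0 & forall h c L, 0 <= h <= h0 ->
    h ^+ r * gridsum (fun k => c + h * k%:R) L (fun v => expR (- qform S v)) <=
    gauss_mass S + d.
Proof.
elim: r S d => [|r IH] S d Sp d0.
  exists 1 => // h c L _ /=; rewrite expr0 mul1r /qform mul0mx mul0mx mxE oppr0.
  by rewrite expR0 /gauss_mass det_mx00 expr0 divr1 sqrtr1; lra.
have s0 := schur_pivot_gt0 (Sp : posdef (S : 'M[R]_(1 + r))).
have S'p := schur_posdef (Sp : posdef (S : 'M[R]_(1 + r))).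
rewrite (gauss_mass_schur (Sp : posdef (S : 'M[R]_(1 + r)))).
set s := (_ 0 0) in s0 *; set a := Num.sqrt _; set b := gauss_mass _.
have a0 : 0 <= a by exact: sqrtr_ge0.
have b0 : 0 <= b by exact: sqrtr_ge0.
have [e e0 [ed e1]] := split_eps a0 b0 d0.
have [h1 h10 H1] := IH _ _ S'p e0.
(* The one-dimensional sum errs by [2 * h], which must stay below [e]. *)
exists (Num.min h1 (e / 2)); first by rewrite lt_min h10; lra.
move=> h c L /andP[hge0]; rewrite le_min => /andP[hh1 he] /=.
under eq_gridsum.
  move=> v; under eq_bigr do rewrite (qform_schur (Sp : posdef (S : 'M[R]_(1 + r))))
    opprD expRD mulrC addrAC.
  rewrite -mulr_sumr; over.
rewrite exprS -mulrA mulrCA -gridsumZ.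
apply: (@le_trans _ _ (h ^+ r * ((a + e) *
    gridsum (fun k => c + h * k%:R) L (fun v => expR (- qform (schur S) v))))).
  rewrite ler_wpM2l ?exprn_ge0// -gridsumZ; apply: ler_gridsum => v _.
  rewrite mulrCA mulrC ler_wpM2r ?expR_ge0//.
  apply: le_trans (gauss_sum_le _ _ s0 hge0) _.
  by rewrite lerD2l; lra.
rewrite mulrCA (@le_trans _ _ ((a + e) * (b + e)))//.
  by rewrite ler_wpM2l ?H1 ?hge0//; lra.
have ee : e * e <= e by rewrite ler_piMr// ltW.
lra.
Qed.

Let small_tail (K d : R) : 0 <= K -> 0 < d ->
  exists2 x, 0 < x & forall y, x <= y -> expR (- y) * K <= d.
Proof.
move=> K0 d0; exists (K / d + 1); first by rewrite ltr_wpDl// divr_ge0// ltW.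
move=> y xy; rewrite expRN mulrC ler_pdivrMr ?expR_gt0// mulrC -ler_pdivrMr//.
have := expR_ge1Dx y; lra.
Qed.

(** A lower bound uniform in the centre needs the centre bounded, for otherwise the grid could miss
    the bulk of the Gaussian. In the induction on the dimension the centre is a linear function of
    the other coordinates; restricting all of them to a box bounds it. *)
Lemma gauss_sum_cut_ge (s d B : R) : 0 < s -> 0 < d -> 0 <= B -> exists2 A, 0 <= A &
  forall h c a L, 0 <= h <= 1 -> `|a| <= B -> c <= - A -> A <= c + h * L%:R ->
  Num.sqrt (pi / s) - d - 2 * h <=
  h * (\sum_(k < L) (`|c + h * k%:R| <= A)%R%:R *
     expR (- (s * (c + h * k%:R + a) ^+ 2))).
Proof.
move=> s0 d0 B0.
have d20 : 0 < d / 2 by lra.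
have [A1 A10 H1] := gauss_sum_ge s0 d20.
have s20 : 0 < s / 2 by lra.
have K0 : 0 <= Num.sqrt (pi / (s / 2)) + 2 by rewrite addr_ge0 ?sqrtr_ge0.
have [x x0 Hx] := small_tail K0 d20.
pose t := Num.sqrt (x / (s / 2)).
have t0 : 0 <= t by exact: sqrtr_ge0.
have tE : s / 2 * t ^+ 2 = x.
  by rewrite sqr_sqrtr ?(ltW (divr_gt0 x0 s20))// mulrC divfK ?gt_eqF.
(* [A1] covers the bulk of the Gaussian, [B] its displacement, and [t] makes the discarded tail
   small. *)
exists (A1 + B + t); first by rewrite !addr_ge0.
move=> h c a L /andP[h0 h1] aB cA Ac.
set A := A1 + B + t in cA Ac *.
have /andP[aB1 aB2] : - B <= a <= B by rewrite -ler_norml.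
have {}H1 := H1 h (c + a) L h0.
have {}H1 : Num.sqrt (pi / s) - d / 2 - 2 * h <=
    h * \sum_(k < L) expR (- (s * (c + a + h * k%:R) ^+ 2)).
  by apply: H1; rewrite /A in cA Ac; lra.
(* Beyond the cutoff the argument exceeds [t] in absolute value: half of the exponent gives the
   factor [expR (- x)], and the other half still has a bounded sum. *)
have tail : h * (\sum_(k < L) (~~ (`|c + h * k%:R| <= A)%R)%:R *
     expR (- (s * (c + h * k%:R + a) ^+ 2))) <= d / 2.
  apply: (le_trans _ (Hx x (lexx x))).
  apply: (@le_trans _ _ (expR (- x) *
      (h * (\sum_(k < L) expR (- (s / 2 * (c + a + h * k%:R) ^+ 2)))))); last first.
    rewrite ler_wpM2l ?expR_ge0//.
    apply: le_trans (gauss_sum_le _ _ s20 h0) _; rewrite lerD2l; lra.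
  rewrite mulrCA ler_wpM2l// mulr_sumr; apply: ler_sum => k _.
  rewrite -expRD.
  have [_|wA] := leP `|c + h * k%:R| A; first by rewrite mul0r expR_ge0.
  rewrite mul1r ler_expR addrAC.
  suff : t ^+ 2 <= (c + h * k%:R + a) ^+ 2.
    rewrite -(ler_pM2l s20) tE; lra.
  rewrite -[leRHS](real_normK (num_real _)) lerXn2r ?nnegrE//.
  have := lerB_dist (c + h * k%:R) (- a); rewrite normrN opprK.
  rewrite /A in wA; lra.
have split_sum : \sum_(k < L) expR (- (s * (c + a + h * k%:R) ^+ 2)) =
   \sum_(k < L) (`|c + h * k%:R| <= A)%R%:R *
     expR (- (s * (c + h * k%:R + a) ^+ 2)) +
   \sum_(k < L) (~~ (`|c + h * k%:R| <= A)%R)%:R *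
     expR (- (s * (c + h * k%:R + a) ^+ 2)).
  rewrite -big_split; apply: eq_bigr => k _ /=; rewrite -mulrDl addrAC.
  by case: (_ <= A); rewrite ?addr0 ?add0r mul1r.
move: H1 tail; rewrite split_sum mulrDr; lra.
Qed.

Definition in_box r (A : R) (v : 'rV[R]_r) := [forall i, `|v 0 i| <= A].

Lemma gauss_grid_cut_ge r (S : 'M[R]_r) (d : R) : posdef S -> 0 < d ->
  exists A, exists2 h0, 0 < h0 & forall h c L, 0 <= h <= h0 ->
    c <= - A -> A <= c + h * L%:R ->
    gauss_mass S - d <=
    h ^+ r * gridsum (fun k => c + h * k%:R) L
      (fun v => (in_box A v)%:R * expR (- qform S v)).
Proof.
elim: r S d => [|r IH] S d Sp d0.
  exists 0, 1 => // h c L _ _ _ /=; rewrite expr0 mul1r /qform mul0mx mul0mx mxE oppr0.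
  have -> : in_box 0 (0 : 'rV[R]_0) by apply/forallP => -[].
  by rewrite mul1r expR0 /gauss_mass det_mx00 expr0 divr1 sqrtr1; lra.
have s0 := schur_pivot_gt0 (Sp : posdef (S : 'M[R]_(1 + r))).
have S'p := schur_posdef (Sp : posdef (S : 'M[R]_(1 + r))).
rewrite (gauss_mass_schur (Sp : posdef (S : 'M[R]_(1 + r)))).
set s := (_ 0 0) in s0 *; set a := Num.sqrt _; set b := gauss_mass _.
have a0 : 0 <= a by exact: sqrtr_ge0.
have b0 : 0 <= b by exact: sqrtr_ge0.
have [e e0 [ed e1]] := split_eps a0 b0 d0.
have [A' [h1 h10 H1]] := IH _ _ S'p e0.
(* This bounds [schur_shift] on the box of the remaining coordinates. *)
pose B := (\sum_i `|A'| * `|dlsubmx (S : 'M[R]_(1 + r)) i 0|) / s.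
have B0 : 0 <= B by rewrite divr_ge0 ?(ltW s0)// sumr_ge0// => i _; rewrite mulr_ge0.
have e20 : 0 < e / 2 by lra.
have [A1 A10 H2] := gauss_sum_cut_ge s0 e20 B0.
exists (Num.max A' A1), (Num.min h1 (e / 4)); first by rewrite lt_min h10; lra.
move=> h c L /andP[hge0]; rewrite le_min => /andP[hh1 he] + + /=.
rewrite lerNr ge_max => /andP[cA' cA1]; rewrite ge_max => /andP[A'c A1c].
(* Truncating [a - e] at 0 treats the case [a < e] without an upper bound on the grid sum. *)
apply: (@le_trans _ _ (h ^+ r * gridsum (fun k => c + h * k%:R) L
   (fun v => (Num.max (a - e) 0) * ((in_box A' v)%:R * expR (- qform (schur S) v))))).
  rewrite gridsumZ mulrCA.
  set X := h ^+ r * _.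
  have X0 : 0 <= X.
    by rewrite mulr_ge0 ?exprn_ge0// gridsum_ge0// => v _; rewrite mulr_ge0 ?expR_ge0.
  have XX : b - e <= X by apply: H1; rewrite ?hge0//; lra.
  case: (leP (a - e) 0) => ae.
    by rewrite mul0r; have := mulr_ge0 (ltW e0) a0; have := ler_wpM2r b0 ae; lra.
  have := ler_wpM2l (ltW ae) XX; have := mulr_ge0 (ltW e0) (ltW e0); lra.
rewrite exprS -mulrA mulrCA ler_wpM2l ?exprn_ge0// -gridsumZ.
apply: ler_gridsum => v _.
have [vA'|] := boolP (in_box A' v); last first.
  move=> _; rewrite mul0r mulr0 mulr_ge0// sumr_ge0//.
have vB : `|schur_shift (S : 'M[R]_(1 + r)) v| <= B.
  rewrite /schur_shift /B normrM (ger0_norm (_ : 0 <= s^-1)) ?invr_ge0 ?(ltW s0)//.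
  rewrite ler_wpM2r ?invr_ge0 ?(ltW s0)// mxE (le_trans (ler_norm_sum _ _ _))//.
  apply: ler_sum => i _; rewrite normrM ler_wpM2r//.
  by rewrite (le_trans _ (ler_norm _))//; move/forallP: vA'.
rewrite mul1r.
have {}H2 : a - e <= h * \sum_(k < L) (`|c + h * k%:R| <= A1)%R%:R *
   expR (- (s * (c + h * k%:R + schur_shift (S : 'M[R]_(1 + r)) v) ^+ 2)).
  have h01 : 0 <= h <= 1 by rewrite hge0 /=; lra.
  have cA1' : c <= - A1 by lra.
  by apply: le_trans (H2 h c _ L h01 vB cA1' A1c); rewrite -/a; lra.
apply: (@le_trans _ _ ((h * \sum_(k < L) (`|c + h * k%:R| <= A1)%R%:R *
   expR (- (s * (c + h * k%:R + schur_shift (S : 'M[R]_(1 + r)) v) ^+ 2))) *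
   expR (- qform (schur S) v))).
  rewrite ler_wpM2r ?expR_ge0// ge_max H2 mulr_ge0// sumr_ge0//.
rewrite -mulrA ler_wpM2l// mulr_suml; apply: ler_sum => k _.
rewrite (qform_schur (Sp : posdef (S : 'M[R]_(1 + r)))) opprD expRD mulrA.
rewrite !ler_wpM2r ?expR_ge0//.
have [wA1|_] := boolP (_ <= A1); last by [].
rewrite (_ : in_box _ _ = true)//; apply/forallP => i.
case: (@split_ordP 1 r i) => j ->.
  by rewrite (row_mxEl (c + h * k%:R)%:M v) ord1 mxE eqxx mulr1n le_max wA1 orbT.
by rewrite (row_mxEr (c + h * k%:R)%:M v) le_max (forallP vA').
Qed.

Lemma gauss_grid_ge r (S : 'M[R]_r) (d : R) : posdef S -> 0 < d ->
  exists A, exists2 h0, 0 < h0 & forall h c L, 0 <= h <= h0 ->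
    c <= - A -> A <= c + h * L%:R ->
    gauss_mass S - d <=
    h ^+ r * gridsum (fun k => c + h * k%:R) L (fun v => expR (- qform S v)).
Proof.
move=> Sp d0; have [A [h0 h00 H]] := gauss_grid_cut_ge Sp d0.
exists A, h0 => // h c L hh cA Ac; apply: (le_trans (H h c L hh cA Ac)).
rewrite ler_wpM2l ?exprn_ge0//; first by case/andP: hh.
by apply: ler_gridsum => v _; rewrite ler_piMl ?expR_ge0// lern1 leq_b1.
Qed.

End GaussianGridLimit.

(** * A local limit theorem for lattice walks *)

Section Trigonometry.
Context {R : realType}.
Implicit Types (x y z B : R).

Lemma mvt_abs (f df : R -> R) x B : (forall z, is_derive z 1 f (df z)) ->
  (forall z, `|z| <= `|x| -> `|df z| <= B) -> `|f x - f 0| <= B * `|x|.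
Proof.
move=> fdf dfB.
have fc a b : {within `[a, b], continuous f}.
  apply: continuous_subspaceT => z.
  by apply/differentiable_continuous/derivable1_diffP; case: (fdf z).
have [x0|/ltW x0] := leP 0 x.
  have [c + ->] := MVT_segment x0 (fun z _ => fdf z) (fc _ _).
  rewrite in_itv/= => /andP[c0 cx]; rewrite subr0 normrM ler_wpM2r//.
  by rewrite dfB// !ger0_norm.
have [c + E] := MVT_segment x0 (fun z _ => fdf z) (fc _ _).
rewrite in_itv/= => /andP[xc c0].
rewrite distrC E sub0r normrM normrN ler_wpM2r//.
by rewrite dfB// !ler0_norm// lerN2.
Qed.

Lemma abs_sin_le x : `|sin x| <= `|x|.
Proof.
have := @mvt_abs sin cos x 1 _ _; rewrite sin0 subr0 mul1r; apply.
by move=> z _; exact: cos_max.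
Qed.

Lemma abs_cos_sub1_le1 x : `|cos x - 1| <= `|x|.
Proof.
have := @mvt_abs cos (fun z => - sin z) x 1 _ _; rewrite cos0 mul1r; apply.
by move=> z _; rewrite normrN; exact: sin_max.
Qed.

Lemma abs_cos_sub1_le2 x : `|cos x - 1| <= `|x| * `|x|.
Proof.
have := @mvt_abs cos (fun z => - sin z) x `|x| _ _; rewrite cos0; apply.
by move=> z zx; rewrite normrN (le_trans (abs_sin_le _)).
Qed.

Let sin_sub_derive z : is_derive z 1 (fun x => sin x - x) (cos z - 1).
Proof. by apply: is_deriveB. Qed.

Lemma abs_sin_sub_le2 x : `|sin x - x| <= `|x| * `|x|.
Proof.
have := @mvt_abs (fun x => sin x - x) (fun z => cos z - 1) x `|x| _ _.
rewrite sin0 !subr0; apply => // z zx.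
by rewrite (le_trans (abs_cos_sub1_le1 _)).
Qed.

Lemma abs_sin_sub_le3 x : `|sin x - x| <= `|x| ^+ 3.
Proof.
have := @mvt_abs (fun x => sin x - x) (fun z => cos z - 1) x (`|x| * `|x|) _ _.
rewrite sin0 !subr0 exprSr expr2; apply => // z zx.
by rewrite (le_trans (abs_cos_sub1_le2 _))// ler_pM.
Qed.

Let cos_sub_derive z :
  is_derive z 1 (fun x => cos x - 1 + x ^+ 2 / 2) (z - sin z).
Proof.
have -> : z - sin z = - sin z - 0 + 2^-1 *: (z *+ 2).
  by rewrite /GRing.scale/= -mulr_natr; field.
apply: is_deriveD.
rewrite (_ : (fun x : R => x ^+ 2 / 2) = 2^-1 \*: ((@id R) ^+ 2)); last first.
  by apply/funext => y; rewrite /= [LHS]mulrC.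
apply: is_deriveZ.
have := @is_deriveX R R id 2 z 1 1 _.
rewrite /GRing.scale/= mulr1 expr1 mulr_natl; exact.
Qed.

Lemma abs_cos_sub_le3 x : `|cos x - 1 + x ^+ 2 / 2| <= `|x| ^+ 3.
Proof.
have := @mvt_abs (fun x => cos x - 1 + x ^+ 2 / 2) (fun z => z - sin z) x
  (`|x| * `|x|) _ _.
rewrite cos0 expr0n/= mul0r addr0 subrr subr0 (exprSr `|x| 2) (expr2 `|x|); apply.
- move=> z.
  exact: cos_sub_derive.
- move=> z zx; rewrite distrC (le_trans (abs_sin_sub_le2 _))// ler_pM//.
Qed.

Lemma abs_expRN_sub_le x : 0 <= x -> `|expR (- x) - 1 + x| <= x ^+ 2.
Proof.
move=> x0; rewrite ger0_norm; last by have := expR_ge1Dx (- x); lra.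
have x1 : 0 < 1 + x by lra.
have H : expR (- x) <= (1 + x)^-1.
  by rewrite expRN lef_pV2 ?posrE ?expR_gt0// expR_ge1Dx.
suff : (1 + x)^-1 <= 1 - x + x ^+ 2 by lra.
rewrite -[leLHS]mul1r ler_pdivrMr//.
have : 0 <= x ^+ 3 by rewrite exprn_ge0.
have -> : (1 - x + x ^+ 2) * (1 + x) = 1 + x ^+ 3 by ring.
lra.
Qed.

(** On [[0, 1/2]] the cubic remainder leaves [3/4 * x]. Beyond, monotonicity gives at least
    [sin (1/2) >= 3/8], and [x < 2]. *)
Lemma sin_ge x : 0 <= x <= pi / 2 -> 3 / 16 * x <= sin x.
Proof.
move=> /andP[x0 xpi].
have small y : 0 <= y <= 1 / 2 -> 3 / 4 * y <= sin y.
  move=> /andP[y0 y1]; have := abs_sin_sub_le3 y.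
  rewrite ler_norml (ger0_norm y0) => /andP[+ _].
  have : y ^+ 3 <= y / 4.
    rewrite exprS ler_wpM2l// expr2.
    have : y * y <= 1 / 2 * (1 / 2) by rewrite ler_pM.
    lra.
  lra.
have [x1|x1] := leP x (1 / 2).
  by apply: le_trans (small x _); rewrite ?x0//; lra.
have p2 := @pihalf_lt2 R; have p1 := @pihalf_ge1 R.
have : sin (1 / 2) < sin x by rewrite ltr_sin ?in_itv//=; lra.
have := small (1 / 2); lra.
Qed.

Lemma abs_sin_half_ge x : `|x| <= pi -> 3 / 32 * `|x| <= `|sin (x / 2)|.
Proof.
move=> xpi.
have -> : `|sin (x / 2)| = `|sin (`|x| / 2)|.
  have [//|_] := ger0P x; by rewrite mulNr sinN normrN.
apply: (le_trans _ (ler_norm _)).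
have := @sin_ge (`|x| / 2); have := normr_ge0 x; lra.
Qed.

Lemma abs_sinD x y : `|sin (x + y)| <= `|sin x| + `|sin y|.
Proof.
rewrite sinD (le_trans (ler_normD _ _))// !normrM lerD//.
  by rewrite ler_piMr// cos_max.
by rewrite ler_piMl// cos_max.
Qed.

Lemma abs_sin_intmul (n : int) x : `|sin (n%:~R * x)| <= `|n|%:~R * `|sin x|.
Proof.
have nat_case k : `|sin (k%:R * x)| <= k%:R * `|sin x|.
  elim: k => [|k IH]; first by rewrite !mul0r sin0 normr0.
  rewrite -natr1 mulrDl mul1r (le_trans (abs_sinD _ _))//.
  by rewrite mulrDl mul1r lerD.
case: n => k; first by rewrite /= -pmulrn.
rewrite NegzE normrN -!pmulrn mulrNz mulNr sinN normrN.
exact: nat_case.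
Qed.

(** A triangle inequality insensitive to multiples of pi: it carries integer combinations of angles
    over to their sines, as the global decay of the characteristic function requires. *)
Lemma abs_sin_sum (I : finType) (n : I -> int) (a : I -> R) :
  `|sin (\sum_i (n i)%:~R * a i)| <= \sum_i `|n i|%:~R * `|sin (a i)|.
Proof.
elim/big_ind2 : _ => [|u1 u2 v1 v2 H1 H2|i _].
- by rewrite sin0 normr0.
- by rewrite (le_trans (abs_sinD _ _))// lerD.
- exact: abs_sin_intmul.
Qed.

Lemma cos_sin_half x : 1 - cos x = 2 * sin (x / 2) ^+ 2.
Proof.
have -> : cos x = cos ((x / 2) *+ 2) by congr cos; rewrite -mulr_natr; field.
by rewrite cos_mulr2n sin2cos2; ring.
Qed.

Lemma sqr_sum_le (I : finType) (s : I -> R) :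
  (\sum_i s i) ^+ 2 <= #|I|%:R * \sum_i s i ^+ 2.
Proof.
rewrite expr2 big_distrlr/=.
apply: (@le_trans _ _ (\sum_i \sum_j (s i ^+ 2 / 2 + s j ^+ 2 / 2))).
  apply: ler_sum => i _; apply: ler_sum => j _.
  by have := sqr_ge0 (s i - s j); rewrite sqrrB; lra.
pose X := \sum_i s i ^+ 2.
have E i : \sum_j (s i ^+ 2 / 2 + s j ^+ 2 / 2) = #|I|%:R * (s i ^+ 2 / 2) + X / 2.
  by rewrite big_split/= sumr_const -mulr_suml mulr_natl.
rewrite (eq_bigr _ (fun i _ => E i)) big_split/= -mulr_sumr sumr_const.
rewrite -mulr_suml -/X -mulr_natl le_eqVlt; apply/orP; left; apply/eqP; by field.
Qed.

End Trigonometry.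

Section Expi.
Context {R : realType}.
Implicit Types (x y z : R).

Local Notation nc := (@Normc.normc R).

Lemma expiD x y : expi (x + y) = expi x * expi y.
Proof.
rewrite /expi cosD sinD; apply/eqP; rewrite eq_complex/=; apply/andP; split=> //.
by rewrite addrC.
Qed.

Lemma expi0 : expi (0 : R) = 1.
Proof. by rewrite /expi cos0 sin0. Qed.

Lemma expi_sum (I : Type) (s : seq I) (P : pred I) (f : I -> R) :
  expi (\sum_(i <- s | P i) f i) = \prod_(i <- s | P i) expi (f i).
Proof.
by elim/big_rec2 : _ => [|i y1 y2 _ <-]; rewrite ?expi0// expiD.
Qed.

Lemma expiN x : expi (- x) = (expi x)^*.
Proof. by rewrite /expi cosN sinN. Qed.

Lemma expi_mulrn x n : expi (n%:R * x) = expi x ^+ n.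
Proof.
elim: n => [|n IH]; first by rewrite mul0r expi0 expr0.
by rewrite -natr1 mulrDl mul1r expiD IH exprSr.
Qed.

Lemma normc_expi x : nc (expi x) = 1.
Proof. by rewrite /expi /= cos2Dsin2 sqrtr1. Qed.

Lemma normcX (a : R[i]) n : nc (a ^+ n) = nc a ^+ n.
Proof.
elim: n => [|n IH]; first by rewrite !expr0 Normc.normc1.
by rewrite !exprS Normc.normcM IH.
Qed.

Lemma normc_real x : nc x%:C = `|x|.
Proof. by rewrite /= expr0n/= addr0 sqrtr_sqr. Qed.

Lemma normc_ge0 (a : R[i]) : 0 <= nc a.
Proof. by case: a => a b; exact: sqrtr_ge0. Qed.

Lemma normc_le_ReIm (a : R[i]) : nc a <= `|complex.Re a| + `|complex.Im a|.
Proof.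
case: a => a b /=.
have ab0 : 0 <= `|a| + `|b| by rewrite addr_ge0.
rewrite -[leRHS](ger0_norm ab0) -[leRHS]sqrtr_sqr ler_sqrt ?sqr_ge0//.
rewrite sqrrD !real_normK ?num_real// -addrA lerD2l lerDr.
by rewrite mulrn_wge0// mulr_ge0.
Qed.

Lemma abs_Re_le_normc (a : R[i]) : `|complex.Re a| <= nc a.
Proof.
case: a => a b /=; rewrite -sqrtr_sqr ler_sqrt ?addr_ge0 ?sqr_ge0//.
by rewrite lerDl sqr_ge0.
Qed.

(** Telescoping of the powers. Keeping [B ^+ n], with [B] a common Gaussian bound on both bases,
    preserves the decay in the angle. *)
Lemma normc_subX_le (a b : R[i]) (B : R) n : nc a <= B -> nc b <= B ->
  nc (a ^+ n.+1 - b ^+ n.+1) <= n.+1%:R * nc (a - b) * B ^+ n.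
Proof.
move=> aB bB; have B0 : 0 <= B by exact: le_trans (normc_ge0 a) aB.
elim: n => [|n IH]; first by rewrite !expr1 expr0 mul1r mulr1.
rewrite [_ ^+ n.+2]exprS [b ^+ _]exprS.
have -> : a * a ^+ n.+1 - b * b ^+ n.+1 =
   a * (a ^+ n.+1 - b ^+ n.+1) + (a - b) * b ^+ n.+1 by ring.
apply: le_trans (le_normcD _ _) _; rewrite !Normc.normcM.
have -> : n.+2%:R * nc (a - b) * B ^+ n.+1 =
  B * (n.+1%:R * nc (a - b) * B ^+ n) + nc (a - b) * B ^+ n.+1.
  by rewrite -[n.+2%:R]natr1 exprS; ring.
rewrite lerD//.
  by rewrite ler_pM ?normc_ge0.
rewrite ler_wpM2l ?normc_ge0// normcX.
by rewrite lerXn2r ?nnegrE// ?normc_ge0.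
Qed.

End Expi.

(** * The characteristic function of one step *)

Section CharacteristicFunction.
Context {R : realType} (q r : nat) (p : 'I_q.+1 -> R) (kv : 'I_q.+1 -> 'rV[int]_r).
Context (c : 'I_r -> 'I_q.+1 -> int).
Hypothesis p_gt0 : forall j, 0 < p j.
Hypothesis p_sum : \sum_j p j = 1.
Hypothesis kv0 : kv ord0 = 0.
Hypothesis kv_gen : forall i l, \sum_j c i j * kv j 0 l = (i == l)%:R.

Local Notation nc := (@Normc.normc R).

Definition dot (th : 'rV[R]_r) (x : 'rV[int]_r) : R :=
  \sum_i th 0 i * (x 0 i)%:~R.

Definition norm1 (th : 'rV[R]_r) : R := \sum_i `|th 0 i|.

Definition charfun (th : 'rV[R]_r) : R[i] :=
  \sum_j (p j)%:C * expi (dot th (kv j)).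

Definition mean_dot (th : 'rV[R]_r) : R := \sum_j p j * dot th (kv j).

Definition var_dot (th : 'rV[R]_r) : R :=
  \sum_j p j * (dot th (kv j) - mean_dot th) ^+ 2.

Implicit Types (th : 'rV[R]_r).

Lemma norm1_ge0 th : 0 <= norm1 th. Proof. exact: sumr_ge0. Qed.

Let pm := (\sum_j (p j)^-1)^-1.

Let pm_gt0 : 0 < pm.
Proof.
rewrite invr_gt0 (bigD1 ord0)//= ltr_pwDl ?invr_gt0// sumr_ge0// => j _.
by rewrite invr_ge0 ltW.
Qed.

Let pm_le j : pm <= p j.
Proof.
rewrite -[leRHS]invrK lef_pV2 ?posrE ?invr_gt0//; last first.
  by move: pm_gt0; rewrite invr_gt0.
rewrite (bigD1 j)//= lerDl sumr_ge0// => i _.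
by rewrite invr_ge0 ltW.
Qed.

Let Cm : R := \sum_i \sum_j `|c i j|%:~R.

Let Cm_ge0 : 0 <= Cm.
Proof. by do 2 (apply: sumr_ge0 => ? _); rewrite ler0z. Qed.

(** The rate delivered by [generation]: a lower bound [pm] on the probabilities over the constants
    of Cauchy-Schwarz and of the coefficients [c]. The [+ 1] keeps the denominator positive, for
    instance when [r = 0]. *)
Let k0 := pm / ((r%:R * Cm) ^+ 2 * q.+1%:R + 1).

Let k0_gt0 : 0 < k0.
Proof. by rewrite divr_gt0// ltr_wpDl// mulr_ge0 ?sqr_ge0. Qed.

(** The quantitative form of [kv_gen], stated abstractly because it is used twice: with the angles
    themselves for the variance, and with sines of half angles for the characteristic function. *)
Let generation (t : 'I_r -> R) (s : 'I_q.+1 -> R) :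
  (forall i, 0 <= t i) -> (forall j, 0 <= s j) ->
  (forall i, t i <= \sum_j `|c i j|%:~R * s j) ->
  k0 * (\sum_i t i) ^+ 2 <= \sum_j p j * s j ^+ 2.
Proof.
move=> t0 s0 ts; pose s1 := \sum_j s j.
have s10 : 0 <= s1 by exact: sumr_ge0.
have t1 : \sum_i t i <= r%:R * Cm * s1.
  apply: (@le_trans _ _ (\sum_(i < r) Cm * s1)); last first.
    by rewrite sumr_const card_ord -(mulr_natl (Cm * s1)) mulrA.
  apply: ler_sum => i _; apply: le_trans (ts i) _.
  rewrite mulr_sumr; apply: ler_sum => j _; rewrite ler_wpM2r//.
  rewrite /Cm (bigD1 i)//= (bigD1 j)//= -addrA lerDl addr_ge0 ?sumr_ge0//.
  by move=> ? _; apply: sumr_ge0 => ? _; rewrite ler0z.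
have t2 : (\sum_i t i) ^+ 2 <= (r%:R * Cm) ^+ 2 * (q.+1%:R * \sum_j s j ^+ 2).
  apply: (@le_trans _ _ ((r%:R * Cm * s1) ^+ 2)).
    by rewrite lerXn2r ?nnegrE ?sumr_ge0// !mulr_ge0.
  rewrite exprMn ler_wpM2l ?sqr_ge0//.
  by have := sqr_sum_le s; rewrite card_ord.
have s2 : pm * \sum_j s j ^+ 2 <= \sum_j p j * s j ^+ 2.
  by rewrite mulr_sumr; apply: ler_sum => j _; rewrite ler_wpM2r ?sqr_ge0.
apply: le_trans s2; rewrite /k0 -mulrA ler_wpM2l ?(ltW pm_gt0)//.
rewrite mulrC ler_pdivrMr; last by rewrite ltr_wpDl// mulr_ge0 ?sqr_ge0.
apply: le_trans t2 _; rewrite mulrDr mulr1 mulrA mulrC lerDl.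
by rewrite sumr_ge0// => j _; exact: sqr_ge0.
Qed.

Lemma coord_dot th i : th 0 i = \sum_j (c i j)%:~R * dot th (kv j).
Proof.
under eq_bigr do rewrite /dot mulr_sumr.
rewrite exchange_big/= (bigD1 i)//= [X in _ + X]big1 ?addr0.
  have := kv_gen i i; rewrite eqxx => E.
  rewrite -[LHS]mulr1 -[X in _ * X](_ : (\sum_j c i j * kv j 0 i)%:~R = 1 :> R).
    rewrite rmorph_sum mulr_sumr; apply: eq_bigr => j _.
    by rewrite rmorphM/= mulrCA.
  by rewrite E.
move=> l li; transitivity (th 0 l * (\sum_j c i j * kv j 0 l)%:~R).
  rewrite rmorph_sum mulr_sumr; apply: eq_bigr => j _.
  by rewrite rmorphM/= mulrCA.
by rewrite kv_gen eq_sym (negPf li) mulr0.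
Qed.

Lemma dotx0 th : dot th 0 = 0.
Proof. by rewrite /dot big1// => i _; rewrite mxE mulr0. Qed.

(** A step of length 0 has probability [p ord0], so the variance dominates [p ord0] times the
    squared mean, hence also the second moment up to the factor [2 + 2 / p ord0]. The second moment
    is controlled by [generation]. *)
Lemma var_dot_ge : exists2 k, 0 < k & forall th, k * norm1 th ^+ 2 <= var_dot th.
Proof.
have p0 := p_gt0 ord0.
have d0 : 0 < 2 + 2 / p ord0 by rewrite ltr_wpDr// divr_ge0// ltW.
exists (k0 / (2 + 2 / p ord0)); first by rewrite divr_gt0.
move=> th; rewrite mulrAC ler_pdivrMr//.
apply: le_trans (@generation (fun i => `|th 0 i|) (fun j => `|dot th (kv j)|) _ _ _) _ => //.
  move=> i; rewrite (coord_dot th i) (le_trans (ler_norm_sum _ _ _))//.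
  by apply: ler_sum => j _; rewrite normrM intr_norm.
pose mu := mean_dot th.
have m2 : p ord0 * mu ^+ 2 <= var_dot th.
  rewrite /var_dot (bigD1 ord0)//= kv0 dotx0 sub0r sqrrN lerDl sumr_ge0// => j _.
  by rewrite mulr_ge0 ?sqr_ge0// ltW.
apply: (@le_trans _ _ (\sum_j (2 * (p j * (dot th (kv j) - mu) ^+ 2) + 2 * mu ^+ 2 * p j))).
  apply: ler_sum => j _; rewrite real_normK ?num_real//.
  have := mulr_ge0 (ltW (p_gt0 j)) (sqr_ge0 (dot th (kv j) - 2 * mu)); nra.
rewrite big_split/= -mulr_sumr -mulr_sumr p_sum mulr1 -/(var_dot th).
have m3 : mu ^+ 2 <= var_dot th / p ord0 by rewrite ler_pdivlMr// mulrC.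
have -> : var_dot th * (2 + 2 / p ord0) = 2 * var_dot th + 2 * (var_dot th / p ord0) by ring.
lra.
Qed.

(** Decay on the whole torus, not merely near 0; this is aperiodicity of the walk. In
    [1 - |charfun|^2], a sum of nonnegative terms [p j * p l * (1 - cos (a j - a l))], only the
    terms with [l = ord0] are kept; there [a ord0 = 0], and half-angle sines appear. *)
Lemma charfun_le : exists2 k, 0 < k & forall th, (forall i, `|th 0 i| <= pi) ->
  nc (charfun th) <= expR (- (k * norm1 th ^+ 2)).
Proof.
have p0 := p_gt0 ord0.
exists (p ord0 * k0 * (3 / 32) ^+ 2); first by apply: mulr_gt0; [exact: mulr_gt0|apply: exprn_gt0; lra].
move=> th thpi; set k := p ord0 * k0 * _.
pose a j := dot th (kv j); pose s j := `|sin (a j / 2)|.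
have G : k0 * ((3 / 32) * norm1 th) ^+ 2 <= \sum_j p j * s j ^+ 2.
  rewrite /norm1 mulr_sumr; apply: generation.
  - by move=> i; rewrite mulr_ge0.
  - by move=> j; rewrite normr_ge0.
  move=> i; apply: le_trans (abs_sin_half_ge (thpi i)) _.
  rewrite coord_dot mulr_suml.
  under eq_bigr do rewrite -mulrA.
  exact: abs_sin_sum.
have E : nc (charfun th) ^+ 2 = \sum_j \sum_l p j * p l * cos (a j - a l).
  have -> : charfun th = (\sum_j p j * cos (a j)) +i* (\sum_j p j * sin (a j)).
    rewrite /charfun; elim/big_rec3 : _ => [//|j x y z _ ->].
    by rewrite /expi -/(a j); apply/eqP; rewrite eq_complex/= !mul0r subr0 addr0 !eqxx.
  rewrite /= sqr_sqrtr ?addr_ge0 ?sqr_ge0// !expr2 !big_distrlr/= -big_split/=.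
  apply: eq_bigr => j _; rewrite -big_split/=; apply: eq_bigr => l _.
  by rewrite cosB; ring.
have H : nc (charfun th) ^+ 2 <= 1 - 2 * (k * norm1 th ^+ 2).
  rewrite E; apply: (@le_trans _ _ (1 - p ord0 * (2 * \sum_j p j * s j ^+ 2))); last first.
    by rewrite lerD2l lerN2 /k; have := ler_wpM2l (ltW p0) G; rewrite exprMn; lra.
  rewrite -subr_ge0.
  have -> : 1 - p ord0 * (2 * (\sum_j p j * s j ^+ 2)) -
    (\sum_j \sum_l p j * p l * cos (a j - a l)) =
    \sum_j \sum_(l < q.+1 | l != ord0) p j * p l * (1 - cos (a j - a l)).
    have one : 1 = \sum_j \sum_l p j * p l :> R.
      by rewrite -big_distrlr/= p_sum mulr1.
    rewrite addrAC [X in X - _ - _]one -sumrB.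
    have -> : p ord0 * (2 * (\sum_j p j * s j ^+ 2)) =
      \sum_j p j * p ord0 * (1 - cos (a j - a ord0)).
      rewrite mulrA mulr_sumr; apply: eq_bigr => j _.
      by rewrite /a kv0 dotx0 subr0 cos_sin_half real_normK ?num_real//; ring.
    rewrite -sumrB; apply: eq_bigr => j _.
    rewrite -sumrB (bigD1 ord0)//= addrAC mulrBr mulr1 subrr add0r.
    by apply: eq_bigr => l _; rewrite mulrBr mulr1.
  apply: sumr_ge0 => j _; apply: sumr_ge0 => l _.
  by rewrite !mulr_ge0 ?(ltW (p_gt0 _))// subr_ge0 cos_le1.
rewrite -ler_sqr ?nnegrE ?normc_ge0 ?expR_ge0//.
apply: le_trans H _; rewrite -expRM_natl mulrN.
exact: expR_ge1Dx.
Qed.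

Lemma dot_le th x : `|dot th x| <= (\sum_i `|(x 0 i)%:~R|) * norm1 th.
Proof.
rewrite mulr_suml (le_trans (ler_norm_sum _ _ _))//; apply: ler_sum => i _.
rewrite normrM mulrC ler_wpM2l// /norm1 (bigD1 i)//= lerDl.
exact: sumr_ge0.
Qed.

(** Removing the mean makes the first-order terms cancel, so the Taylor remainders of sine and
    cosine are cubic. The exponential has a quartic error, made cubic by [norm1 th <= r * pi]; these
    three errors add up to the constant. *)
Lemma charfun_approx : exists2 C, 0 <= C & forall th, (forall i, `|th 0 i| <= pi) ->
  nc (charfun th * expi (- mean_dot th) - (expR (- (var_dot th / 2)))%:C)
    <= C * norm1 th ^+ 3.
Proof.
pose A : R := \sum_j \sum_i `|(kv j 0 i)%:~R|.
have A0 : 0 <= A by do 2 (apply: sumr_ge0 => ? _).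
have kvA th j : `|dot th (kv j)| <= A * norm1 th.
  apply: le_trans (dot_le _ _) _; rewrite ler_wpM2r ?norm1_ge0//.
  rewrite /A (bigD1 j)//= lerDl; do 2 (apply: sumr_ge0 => ? _); exact: normr_ge0.
have muA th : `|mean_dot th| <= A * norm1 th.
  apply: le_trans (ler_norm_sum _ _ _) _.
  apply: (@le_trans _ _ (\sum_j p j * (A * norm1 th))).
    by apply: ler_sum => j _; rewrite normrM (gtr0_norm (p_gt0 j)) ler_wpM2l ?(ltW (p_gt0 j))//.
  by rewrite -mulr_suml p_sum mul1r.
pose B := 2 * A.
have B0 : 0 <= B by rewrite mulr_ge0.
exists (2 * B ^+ 3 + B ^+ 4 * (r%:R * pi)).
  by rewrite addr_ge0// ?mulr_ge0 ?exprn_ge0// pi_ge0.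
move=> th thpi.
pose y j := dot th (kv j) - mean_dot th.
have n0 := norm1_ge0 th.
have yB j : `|y j| <= B * norm1 th.
  apply: le_trans (ler_normB _ _) _.
  have := kvA th j; have := muA th; rewrite /B; lra.
have ysum : \sum_j p j * y j = 0.
  under eq_bigr do rewrite mulrBr.
  by rewrite sumrB -mulr_suml p_sum mul1r subrr.
have -> : charfun th * expi (- mean_dot th) =
    (\sum_j p j * cos (y j)) +i* (\sum_j p j * sin (y j)).
  rewrite /charfun mulr_suml.
  under eq_bigr do rewrite -mulrA -expiD -/(y _).
  elim/big_rec3 : _ => [//|j x1 y1 z1 _ ->].
  by rewrite /expi; apply/eqP; rewrite eq_complex/= !mul0r subr0 addr0 !eqxx.
apply: le_trans (normc_le_ReIm _) _; rewrite /= oppr0 addr0.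
have sin_part : `|\sum_j p j * sin (y j)| <= (B * norm1 th) ^+ 3.
  have -> : \sum_j p j * sin (y j) = \sum_j p j * (sin (y j) - y j).
    by under [RHS]eq_bigr do rewrite mulrBr; rewrite sumrB ysum subr0.
  apply: le_trans (ler_norm_sum _ _ _) _.
  apply: (@le_trans _ _ (\sum_j p j * (B * norm1 th) ^+ 3)); last first.
    by rewrite -mulr_suml p_sum mul1r.
  apply: ler_sum => j _; rewrite normrM (gtr0_norm (p_gt0 j)) ler_wpM2l ?(ltW (p_gt0 j))//.
  apply: le_trans (abs_sin_sub_le3 _) _.
  by rewrite lerXn2r ?nnegrE// (le_trans _ (yB j)).
have cos_part : `|\sum_j p j * cos (y j) - 1 + var_dot th / 2| <= (B * norm1 th) ^+ 3.
  have -> : \sum_j p j * cos (y j) - 1 + var_dot th / 2 =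
     \sum_j p j * (cos (y j) - 1 + y j ^+ 2 / 2).
    rewrite -[X in _ - X + _]p_sum /var_dot mulr_suml -sumrB -big_split/=; apply: eq_bigr => j _.
    by rewrite /y; ring.
  apply: le_trans (ler_norm_sum _ _ _) _.
  apply: (@le_trans _ _ (\sum_j p j * (B * norm1 th) ^+ 3)); last first.
    by rewrite -mulr_suml p_sum mul1r.
  apply: ler_sum => j _; rewrite normrM (gtr0_norm (p_gt0 j)) ler_wpM2l ?(ltW (p_gt0 j))//.
  apply: le_trans (abs_cos_sub_le3 _) _.
  by rewrite lerXn2r ?nnegrE// (le_trans _ (yB j)).
have v0 : 0 <= var_dot th.
  by apply: sumr_ge0 => j _; rewrite mulr_ge0 ?sqr_ge0// ltW.
have v1 : var_dot th <= (B * norm1 th) ^+ 2.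
  apply: (@le_trans _ _ (\sum_j p j * (B * norm1 th) ^+ 2)); last first.
    by rewrite -mulr_suml p_sum mul1r.
  apply: ler_sum => j _; rewrite ler_wpM2l ?(ltW (p_gt0 j))// -/(y j).
  rewrite -[leLHS](real_normK (num_real _)).
  by rewrite lerXn2r ?nnegrE// (le_trans _ (yB j)).
have npi : norm1 th <= r%:R * pi.
  rewrite -[r in r%:R]card_ord mulr_natl -sumr_const; apply: ler_sum => i _.
  exact: thpi.
have exp_part : `|expR (- (var_dot th / 2)) - 1 + var_dot th / 2| <=
    B ^+ 4 * (r%:R * pi) * norm1 th ^+ 3.
  apply: le_trans (abs_expRN_sub_le _) _; first by rewrite divr_ge0.
  apply: (@le_trans _ _ (((B * norm1 th) ^+ 2) ^+ 2)).
    by rewrite lerXn2r ?nnegrE ?divr_ge0 ?sqr_ge0//; lra.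
  rewrite -exprM exprMn -mulrA ler_wpM2l ?exprn_ge0//.
  by rewrite (exprS _ 3) ler_wpM2r ?exprn_ge0 ?norm1_ge0.
rewrite mulrDl -mulrA -exprMn.
have := ler_normB (\sum_j p j * cos (y j) - 1 + var_dot th / 2)
  (expR (- (var_dot th / 2)) - 1 + var_dot th / 2).
have -> : (\sum_j p j * cos (y j) - 1 + var_dot th / 2) -
  (expR (- (var_dot th / 2)) - 1 + var_dot th / 2) =
  \sum_j p j * cos (y j) - expR (- (var_dot th / 2)) by ring.
move: sin_part cos_part exp_part; lra.
Qed.

End CharacteristicFunction.

(** * Orthogonality of characters on a finite grid *)

Section Orthogonality.
Context {R : realType}.

Lemma expi_intmul (d : int) (y : R) : expi y = 1 -> expi (y * d%:~R) = 1.
Proof.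
move=> y1; case: d => n.
  by rewrite -pmulrn mulrC expi_mulrn y1 expr1n.
by rewrite NegzE mulrNz -pmulrn mulrN expiN mulrC expi_mulrn y1 expr1n conjc1.
Qed.

Lemma expi_eq1 (x : R) : expi x = 1 -> sin (x / 2) = 0.
Proof.
move=> [c1 _]; have := cos_sin_half x; rewrite c1 subrr => /esym/eqP.
by rewrite mulf_eq0 pnatr_eq0/= sqrf_eq0 => /eqP.
Qed.

Lemma sum_expi_grid (L : nat) (d : int) : (`|d| < L)%N ->
  \sum_(k < L) expi ((- pi + 2 * pi / L%:R * k%:R) * d%:~R) =
  (if d == 0 then L%:R else 0) :> R[i].
Proof.
move=> dL; have L0 : (0 < L)%N by exact: leq_ltn_trans dL.
have LR : L%:R != 0 :> R by rewrite pnatr_eq0 -lt0n.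
case: eqVneq => [->|d0].
  under eq_bigr do rewrite mulr0 expi0.
  by rewrite sumr_const card_ord.
pose z := expi (2 * pi / L%:R * d%:~R : R).
have -> : \sum_(k < L) expi ((- pi + 2 * pi / L%:R * k%:R) * d%:~R) =
    expi (- pi * d%:~R : R) * \sum_(k < L) z ^+ k.
  rewrite mulr_sumr; apply: eq_bigr => k _.
  by rewrite -expi_mulrn -expiD; congr expi; ring.
have zL : z ^+ L = 1.
  rewrite -expi_mulrn.
  have -> : L%:R * (2 * pi / L%:R * d%:~R) = (pi *+ 2) * d%:~R :> R.
    by rewrite -mulr_natr; field.
  by apply: expi_intmul; rewrite /expi cos2pi sin2pi.
(* [0 < |d| < L] makes [z] a nontrivial root of unity: otherwise [sin (pi * d / L)] would vanish. *)
have z1 : z - 1 != 0.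
  rewrite subr_eq0; apply/eqP => /expi_eq1.
  have -> : 2 * pi / L%:R * d%:~R / 2 = pi * (d%:~R / L%:R) :> R by field.
  have pos (n : nat) : (0 < n < L)%N -> 0 < sin (pi * (n%:R / L%:R) : R).
    move=> /andP[n0 nL]; apply: sin_gt0_pi.
    have L0' : 0 < L%:R :> R by rewrite ltr0n.
    rewrite mulr_gt0 ?pi_gt0 ?divr_gt0 ?ltr0n//=.
    by rewrite -[ltRHS]mulr1 ltr_pM2l ?pi_gt0// ltr_pdivrMr// mul1r ltr_nat.
  case: d d0 dL {zL z} => n /= d0 dL; first last.
    rewrite NegzE mulrNz -pmulrn mulNr mulrN sinN => /eqP.
    by rewrite oppr_eq0 gt_eqF// pos.
  by rewrite -pmulrn => /eqP; rewrite gt_eqF// pos// dL andbT lt0n.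
have := subrX1 z L; rewrite zL subrr => /esym/eqP.
by rewrite mulf_eq0 (negPf z1)/= => /eqP ->; rewrite mulr0.
Qed.

Lemma gridsum_scale (V : zmodType) (g : nat -> R) L r a (F : 'rV[R]_r -> V) :
  gridsum (fun k => a * g k) L F = gridsum g L (fun v => F (a *: v)).
Proof.
elim: r F => [|r IH] F /=; first by rewrite scaler0.
rewrite IH; apply: eq_gridsum => v; apply: eq_bigr => k _; congr F.
by rewrite -scale_scalar_mx; symmetry; exact: (scale_row_mx a (g k)%:M v).
Qed.

End Orthogonality.

Section Walk.
Context {R : realType} (q r : nat) (p : 'I_q.+1 -> R) (kv : 'I_q.+1 -> 'rV[int]_r).

Definition walk m (w : {ffun 'I_m -> 'I_q.+1}) : 'rV[int]_r := \sum_l kv (w l).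

Definition word_prob m (w : {ffun 'I_m -> 'I_q.+1}) : R := \prod_l p (w l).

Definition walk_prob m (x : 'rV[int]_r) : R := \sum_(w | walk w == x) @word_prob m w.

Lemma dotD (th : 'rV[R]_r) x y : dot th (x + y) = dot th x + dot th y.
Proof.
by rewrite /dot -big_split/=; apply: eq_bigr => i _; rewrite mxE rmorphD mulrDr.
Qed.

Lemma dotN (th : 'rV[R]_r) x : dot th (- x) = - dot th x.
Proof. by rewrite /dot -sumrN; apply: eq_bigr => i _; rewrite mxE rmorphN mulrN. Qed.

Lemma dot_sum (th : 'rV[R]_r) (I : finType) (f : I -> 'rV[int]_r) :
  dot th (\sum_i f i) = \sum_i dot th (f i).
Proof.
apply: (big_morph (dot th)) => [x y|]; first exact: dotD.
by rewrite /dot big1// => i _; rewrite mxE mulr0.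
Qed.

Lemma charfunX (th : 'rV[R]_r) m :
  charfun p kv th ^+ m =
  \sum_(w : {ffun 'I_m -> 'I_q.+1}) (word_prob w)%:C * expi (dot th (walk w)).
Proof.
rewrite -[m in LHS]card_ord -prodr_const bigA_distr_bigA/=.
apply: eq_bigr => w _; rewrite big_split/= /walk dot_sum expi_sum.
by rewrite /word_prob rmorph_prod.
Qed.

(** The inversion is exact because words of length [m] reach finitely many positions: once [L]
    exceeds every displacement from [x], no aliasing occurs. *)
Lemma fourier_inversion m (x : 'rV[int]_r) (L : nat) :
  (forall (w : {ffun 'I_m -> 'I_q.+1}) i, (`|(walk w 0 i - x 0 i)%R| < L)%N) ->
  gridsum (fun k => - pi + 2 * pi / L%:R * k%:R) L
    (fun th => charfun p kv th ^+ m * expi (- dot th x)) =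
  (L%:R ^+ r * walk_prob m x)%:C.
Proof.
move=> wL.
under eq_gridsum.
  move=> th; rewrite charfunX mulr_suml.
  under eq_bigr => w _ do rewrite -mulrA -expiD -dotN -dotD /dot expi_sum.
  over.
rewrite gridsum_sum /walk_prob [RHS]rmorphM [RHS]mulrC [X in _ = X * _]rmorph_sum [RHS]mulr_suml.
rewrite [LHS]big_mkcond/=.
rewrite [RHS]big_mkcond/=; apply: eq_bigr => w _.
rewrite gridsumZ (gridsum_prod _ _ (fun i y => expi (y * ((walk w - x) 0 i)%:~R))).
have -> : \prod_i \sum_(k < L)
   expi ((- pi + 2 * pi / L%:R * k%:R : R) * ((walk w - x) 0 i)%:~R) =
   \prod_i (if (walk w - x) 0 i == 0 then L%:R else 0).
  by apply: eq_bigr => i _; rewrite sum_expi_grid// !mxE.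
case: eqVneq => [->|wx].
  under eq_bigr do rewrite subrr mxE eqxx.
  by rewrite prodr_const card_ord rmorphXn rmorph_nat.
have [i wxi] : exists i, (walk w - x) 0 i != 0.
  apply/existsP; rewrite -negb_forall; apply: contra wx => /forallP H.
  rewrite -subr_eq0; apply/eqP/matrixP => a i; rewrite ord1 [RHS]mxE.
  exact/eqP/H.
by rewrite (bigD1 i)//= (negPf wxi) mul0r mulr0.
Qed.

End Walk.

Section QuadraticForms.
Context {R : realType}.

Lemma sqrtr_nat_large (b : R) : exists m0 : nat, forall m, (m0 <= m)%N ->
  b <= Num.sqrt m%:R.
Proof.
exists (Num.bound (b ^+ 2)) => m m0m.
have [b0|b0] := leP b 0; first by rewrite (le_trans b0) ?sqrtr_ge0.
rewrite -[leLHS](ger0_norm (ltW b0)) -sqrtr_sqr ler_sqrt ?ler0n//.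
rewrite (le_trans (ltW (archi_boundP (sqr_ge0 b))))// ler_nat.
exact: m0m.
Qed.

Lemma qformE r (S : 'M[R]_r) v :
  qform S v = \sum_i \sum_l v 0 i * S i l * v 0 l.
Proof.
rewrite /qform mxE exchange_big/=; apply: eq_bigr => l _.
by rewrite !mxE mulr_suml.
Qed.

Lemma qformZ r (S : 'M[R]_r) v a : qform (a *: S) v = a * qform S v.
Proof. by rewrite /qform -scalemxAr -scalemxAl mxE. Qed.

Lemma qform_scalev r (S : 'M[R]_r) v a : qform S (a *: v) = a ^+ 2 * qform S v.
Proof.
by rewrite /qform linearZ/= -!scalemxAl -scalemxAr scalerA mxE expr2.
Qed.

Lemma qform_scalar r (a : R) (v : 'rV_r) : qform a%:M v = a * \sum_i v 0 i ^+ 2.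
Proof.
rewrite /qform mul_mx_scalar -scalemxAl mxE; congr (_ * _); rewrite mxE.
by apply: eq_bigr => i _; rewrite mxE expr2.
Qed.

Lemma posdef_scalar r (a : R) : 0 < a -> posdef (a%:M : 'M[R]_r).
Proof.
move=> a0; split; first by rewrite tr_scalar_mx.
move=> v v0; rewrite qform_scalar mulr_gt0//.
rewrite lt0r sumr_ge0 ?andbT; last by move=> i _; exact: sqr_ge0.
apply: contra v0; rewrite psumr_eq0; last by move=> i _; exact: sqr_ge0.
move=> /allP H; apply/eqP/matrixP => i j; rewrite ord1 mxE.
by have := H j (mem_index_enum _); rewrite /= sqrf_eq0 => /eqP.
Qed.

Lemma sqr_sum_ge (I : finType) (s : I -> R) : (forall i, 0 <= s i) ->
  \sum_i s i ^+ 2 <= (\sum_i s i) ^+ 2.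
Proof.
move=> s0; rewrite expr2 mulr_suml; apply: ler_sum => i _.
by rewrite expr2 ler_wpM2l// (bigD1 i)//= lerDl sumr_ge0.
Qed.

(* Polynomial factors are absorbed by halving the Gaussian rate. *)
Lemma poly_exp_le (a : R) : 0 < a -> exists2 C, 0 <= C & forall t, 0 <= t ->
  t * expR (- (a * t ^+ 2)) <= C /\ t ^+ 3 * expR (- (a * t ^+ 2)) <= C.
Proof.
move=> a0; exists (1 + a^-1 + 2 / a ^+ 2).
  by rewrite !addr_ge0 ?invr_ge0 ?divr_ge0 ?exprn_ge0 ?(ltW a0).
move=> t t0; have at0 : 0 <= a * t ^+ 2 by rewrite mulr_ge0 ?sqr_ge0 ?(ltW a0).
have E1 : 1 <= expR (a * t ^+ 2) by rewrite -expR0 ler_expR.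
have a1 : 0 <= a^-1 by rewrite invr_ge0 ltW.
have a2 : 0 <= 2 / a ^+ 2 by rewrite divr_ge0 ?exprn_ge0 ?(ltW a0).
rewrite expRN !ler_pdivrMr ?expR_gt0//; set E := expR _ in E1 *.
have t2 : t ^+ 2 <= a^-1 * E.
  rewrite mulrC ler_pdivlMr// mulrC.
  by have := expR_ge1Dx (a * t ^+ 2); rewrite -/E; lra.
have t4 : t ^+ 4 <= 2 / a ^+ 2 * E.
  rewrite mulrAC ler_pdivlMr ?exprn_gt0//.
  have := expR_ge1Dxn 1 at0; rewrite -/E exprMn -exprM.
  rewrite (_ : (2`!)%:R = 2 :> R)//; lra.
split.
- have : t <= 1 + t ^+ 2 by have := sqr_ge0 (t - 1); rewrite sqrrB; nra.
  rewrite !mulrDl mul1r; have : 0 <= 2 / a ^+ 2 * E by rewrite mulr_ge0// expR_ge0.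
  lra.
- have : t ^+ 3 <= 1 + t ^+ 4.
    have [t1|t1] := leP t 1.
      have : t ^+ 3 <= 1 by rewrite exprn_ile1.
      have : 0 <= t ^+ 4 by rewrite exprn_ge0. lra.
    have : t ^+ 3 <= t ^+ 4 by rewrite [leRHS]exprS ler_peMl ?exprn_ge0// ltW.
    lra.
  rewrite !mulrDl mul1r; have : 0 <= a^-1 * E by rewrite mulr_ge0// expR_ge0.
  lra.
Qed.

Lemma ReD (a b : R[i]) : complex.Re (a + b) = complex.Re a + complex.Re b.
Proof. by case: a; case: b. Qed.

Lemma gridsum_Re (g : nat -> R) L r (F : 'rV[R]_r -> R[i]) :
  complex.Re (gridsum g L F) = gridsum g L (fun v => complex.Re (F v)).
Proof.
elim: r F => [//|r IH] F /=; rewrite IH; apply: eq_gridsum => v.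
exact: (big_morph _ ReD).
Qed.

End QuadraticForms.

(** * The local limit theorem *)

Section LocalLimit.
Context {R : realType} (q r : nat) (p : 'I_q.+1 -> R) (kv : 'I_q.+1 -> 'rV[int]_r).
Context (c : 'I_r -> 'I_q.+1 -> int).
Hypothesis p_gt0 : forall j, 0 < p j.
Hypothesis p_sum : \sum_j p j = 1.
Hypothesis kv0 : kv ord0 = 0.
Hypothesis kv_gen : forall i l, \sum_j c i j * kv j 0 l = (i == l)%:R.

Local Notation nc := (@Normc.normc R).
Implicit Types (th u v : 'rV[R]_r) (x : 'rV[int]_r).

Definition walk_mean (i : 'I_r) : R := \sum_j p j * (kv j 0 i)%:~R.

Definition walk_cov : 'M[R]_r := \matrix_(i, l)
  \sum_j p j * ((kv j 0 i)%:~R - walk_mean i) * ((kv j 0 l)%:~R - walk_mean l).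

Lemma mean_dotE th : mean_dot p kv th = \sum_i th 0 i * walk_mean i.
Proof.
rewrite /mean_dot /dot; under eq_bigr do rewrite mulr_sumr.
rewrite exchange_big/=; apply: eq_bigr => i _; rewrite mulr_sumr.
by apply: eq_bigr => j _; rewrite mulrCA.
Qed.

Lemma qform_walk_cov th : qform walk_cov th = var_dot p kv th.
Proof.
rewrite qformE /var_dot; under eq_bigr => i _ do under eq_bigr => l _ do
  rewrite mxE mulr_sumr mulr_suml.
under eq_bigr do rewrite exchange_big/=.
rewrite exchange_big/=; apply: eq_bigr => j _.
rewrite mean_dotE /dot -sumrB expr2 big_distrlr/= mulr_sumr; apply: eq_bigr => i _.
by rewrite mulr_sumr; apply: eq_bigr => l _; ring.
Qed.

Lemma walk_cov_posdef : posdef walk_cov.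
Proof.
split.
  by apply/matrixP => i l; rewrite !mxE; apply: eq_bigr => j _; ring.
move=> v v0; rewrite qform_walk_cov.
have [k k0 H] := var_dot_ge p_gt0 p_sum kv0 kv_gen.
apply: lt_le_trans (H v); rewrite mulr_gt0// exprn_gt0// lt0r norm1_ge0 andbT.
apply: contra v0; rewrite psumr_eq0// => /allP {}H.
apply/eqP/matrixP => i j; rewrite ord1 mxE.
by have := H j (mem_index_enum _); rewrite /= normr_eq0 => /eqP.
Qed.

Let S := 2^-1 *: walk_cov.

Let S_posdef : posdef S.
Proof.
have [St Sp] := walk_cov_posdef; split; first by rewrite linearZ/= St.
by move=> v v0; rewrite qformZ mulr_gt0// Sp.
Qed.

Let qform_S th : qform S th = var_dot p kv th / 2.
Proof. by rewrite qformZ qform_walk_cov mulrC. Qed.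

(** The integrand of the inversion formula in the angle [u = sqrt m * th], for which the limiting
    Gaussian has a fixed width. *)
Let integrand m x u : R := complex.Re
  (charfun p kv ((Num.sqrt m%:R)^-1 *: u) ^+ m *
   expi (- dot ((Num.sqrt m%:R)^-1 *: u) x)).

Let norm1Z (a : R) th : norm1 (a *: th) = `|a| * norm1 th.
Proof. by rewrite /norm1 mulr_sumr; apply: eq_bigr => i _; rewrite mxE normrM. Qed.

Let norm1_sqr_ge th : \sum_i th 0 i ^+ 2 <= norm1 th ^+ 2.
Proof.
apply: le_trans (sqr_sum_ge _); last by move=> i; exact: normr_ge0.
by apply: ler_sum => i _; rewrite real_normK ?num_real.
Qed.

(** Telescoping turns [m] cubic errors in [th] into [|u|^3 / sqrt m], and the remaining [m - 1]
    factors keep at least half of the Gaussian rate because [1 < m]. Half of what is left absorbs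
    the polynomial factor. The second bound absorbs the factor [norm1 u] produced by a phase. *)
Let charfunX_approx : exists2 k, 0 < k & exists2 C, 0 <= C &
  forall m u, (1 < m)%N -> (forall i, `|u 0 i| <= pi * Num.sqrt m%:R) ->
  let th := (Num.sqrt m%:R)^-1 *: u in
  nc ((charfun p kv th * expi (- mean_dot p kv th)) ^+ m -
      (expR (- qform S u))%:C) <=
    C / Num.sqrt m%:R * expR (- (k * norm1 u ^+ 2)) /\
  expR (- qform S u) * norm1 u <= C * expR (- (k * norm1 u ^+ 2)).
Proof.
have [k1 k10 H1] := charfun_le p_gt0 p_sum kv0 kv_gen.
have [k2 k20 H2] := var_dot_ge p_gt0 p_sum kv0 kv_gen.
have [C C0 H3] := charfun_approx kv p_gt0 p_sum.
pose k := Num.min k1 (k2 / 2).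
have k0 : 0 < k by rewrite lt_min k10 divr_gt0.
have kk1 : k <= k1 by rewrite ge_min lexx.
have kk2 : k <= k2 / 2 by rewrite ge_min lexx orbT.
have k4 : 0 < k / 4 by rewrite divr_gt0.
have [D D0 HD] := poly_exp_le k4.
exists (k / 4) => //; exists (C * D + D); first by rewrite addr_ge0// mulr_ge0.
move=> m u m1 upi th.
have m0 : (0 < m)%N by exact: ltnW.
set sm := Num.sqrt m%:R in upi th *.
have sm0 : 0 < sm by rewrite sqrtr_gt0 ltr0n.
have sm2 : sm ^+ 2 = m%:R by rewrite sqr_sqrtr// ler0n.
have n0 := norm1_ge0 u.
have [HD1 HD3] := HD _ n0.
have nth : norm1 th = norm1 u / sm.
  by rewrite norm1Z ger0_norm ?invr_ge0 ?(ltW sm0)// mulrC.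
have qS : expR (- qform S u) <= expR (- (k * norm1 u ^+ 2)).
  rewrite ler_expR lerN2 qform_S.
  have := H2 u; have := ler_wpM2r (sqr_ge0 (norm1 u)) kk2; lra.
split; last first.
  apply: (@le_trans _ _ (expR (- (k / 4 * norm1 u ^+ 2)) * norm1 u *
     expR (- (k / 4 * norm1 u ^+ 2)))).
    rewrite mulrAC ler_wpM2r// -expRD; apply: le_trans qS _; rewrite ler_expR.
    have := mulr_ge0 (ltW k4) (sqr_ge0 (norm1 u)); lra.
  rewrite ler_wpM2r ?expR_ge0// mulrC (le_trans HD1)// lerDr mulr_ge0//.
have thpi i : `|th 0 i| <= pi.
  rewrite mxE normrM (ger0_norm (_ : 0 <= sm^-1)) ?invr_ge0 ?(ltW sm0)//.
  by rewrite mulrC ler_pdivrMr.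
have eE : (expR (- qform S u))%:C = (expR (- (var_dot p kv th / 2)))%:C ^+ m.
  rewrite -rmorphXn -expRM_natl; congr ((expR _)%:C).
  rewrite -qform_S qform_scalev -sm2; field; exact: lt0r_neq0.
rewrite eE; pose B := expR (- (k * norm1 th ^+ 2)).
have aB : nc (charfun p kv th * expi (- mean_dot p kv th)) <= B.
  rewrite Normc.normcM normc_expi mulr1; apply: le_trans (H1 _ thpi) _.
  by rewrite ler_expR lerN2 ler_wpM2r ?sqr_ge0.
have bB : nc (expR (- (var_dot p kv th / 2)))%:C <= B.
  rewrite normc_real ger0_norm ?expR_ge0// ler_expR lerN2.
  have := H2 th; have := ler_wpM2r (sqr_ge0 (norm1 th)) kk2; lra.
have := normc_subX_le m.-1 aB bB; rewrite prednK// => H; apply: (le_trans H) => {H}.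
apply: (@le_trans _ _ (m%:R * (C * norm1 th ^+ 3) * B ^+ m.-1)).
  by rewrite ler_wpM2r ?exprn_ge0 ?expR_ge0// ler_wpM2l// H3.
have -> : m%:R * (C * norm1 th ^+ 3) = C / sm * norm1 u ^+ 3.
  rewrite nth -sm2; field; exact: lt0r_neq0.
have BE : B ^+ m.-1 <= expR (- (k / 4 * norm1 u ^+ 2)) * expR (- (k / 4 * norm1 u ^+ 2)).
  rewrite /B -expRM_natl -expRD ler_expR.
  suff : k / 2 * norm1 u ^+ 2 <= m.-1%:R * (k * norm1 th ^+ 2) by lra.
  rewrite nth expr_div_n sm2.
  have -> : m.-1%:R * (k * (norm1 u ^+ 2 / m%:R)) =
    k * norm1 u ^+ 2 * (m.-1%:R / m%:R) by ring.
  rewrite mulrAC ler_wpM2l ?mulr_ge0 ?sqr_ge0 ?(ltW k0)//.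
  rewrite ler_pdivlMr ?ltr0n// mulrC ler_pdivrMr// -natrM ler_nat.
  by move: m1; clear; lia.
apply: (@le_trans _ _ (C / sm * norm1 u ^+ 3 *
  (expR (- (k / 4 * norm1 u ^+ 2)) * expR (- (k / 4 * norm1 u ^+ 2))))).
  by rewrite ler_wpM2l// mulr_ge0 ?exprn_ge0// divr_ge0// ltW.
rewrite mulrA ler_wpM2r ?expR_ge0//.
apply: (@le_trans _ _ (C / sm * D)).
  by rewrite -[leLHS]mulrA ler_wpM2l// divr_ge0// ltW.
by rewrite mulrAC ler_wpM2r ?invr_ge0 ?(ltW sm0)// lerDl.
Qed.

(** The position [x] enters only through a phase [y]. From above [cos y <= 1] holds for every [x];
    from below, [x] near the mean makes [|y| <= rho * norm1 u]. The error is expressed by the form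
    [k%:M], so that the Gaussian grid bounds apply to it as well. *)
Let integrand_approx : exists2 k, 0 < k & exists2 C, 0 <= C &
  forall m x u, (1 < m)%N -> (forall i, `|u 0 i| <= pi * Num.sqrt m%:R) ->
  let E := expR (- qform k%:M u) in
  integrand m x u <= expR (- qform S u) + C / Num.sqrt m%:R * E /\
  forall rho, 0 <= rho ->
    (forall i, `|(x 0 i)%:~R - m%:R * walk_mean i| <= rho * Num.sqrt m%:R) ->
    expR (- qform S u) - (C * rho + C / Num.sqrt m%:R) * E <= integrand m x u.
Proof.
have [k k0 [C C0 H]] := charfunX_approx.
exists k => //; exists C => // m x u m1 upi E.
have [] := H m u m1 upi.
set sm := Num.sqrt m%:R in upi *; set th := sm^-1 *: u => H1 H2.
have sm0 : 0 < sm by rewrite sqrtr_gt0 ltr0n ltnW.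
have EE : expR (- (k * norm1 u ^+ 2)) <= E.
  by rewrite ler_expR lerN2 qform_scalar ler_wpM2l ?norm1_sqr_ge// ltW.
pose y := m%:R * mean_dot p kv th - dot th x.
pose D := (charfun p kv th * expi (- mean_dot p kv th)) ^+ m -
      (expR (- qform S u))%:C.
have iE : integrand m x u = expR (- qform S u) * cos y + complex.Re (D * expi y).
  have -> : expR (- qform S u) * cos y =
      complex.Re ((expR (- qform S u))%:C * expi y) by rewrite /= mul0r subr0.
  rewrite -ReD -mulrDl addrC subrK /integrand -/sm -/th; congr complex.Re.
  rewrite exprMn -mulrA; congr (_ * _); rewrite -expi_mulrn -expiD; congr expi.
  by rewrite /y; ring.
have DE : `|complex.Re (D * expi y)| <= C / sm * E.
  apply: le_trans (abs_Re_le_normc _) _.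
  rewrite Normc.normcM normc_expi mulr1 (le_trans H1)// ler_wpM2l//.
  by rewrite divr_ge0// ltW.
move: DE; rewrite ler_norml => /andP[D1 D2].
have e0 : 0 <= expR (- qform S u) by exact: expR_ge0.
split.
  rewrite iE; have := ler_wpM2l e0 (cos_le1 y); lra.
move=> rho rho0 xrho.
have yrho : `|y| <= rho * norm1 u.
  have -> : y = \sum_i u 0 i * ((m%:R * walk_mean i - (x 0 i)%:~R) / sm).
    rewrite /y mean_dotE /dot mulr_sumr -sumrB; apply: eq_bigr => i _.
    by rewrite mxE; ring.
  apply: le_trans (ler_norm_sum _ _ _) _; rewrite /norm1 mulr_sumr.
  apply: ler_sum => i _; rewrite normrM mulrC ler_wpM2r// normrM.
  rewrite (ger0_norm (_ : 0 <= sm^-1)) ?invr_ge0 ?(ltW sm0)//.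
  by rewrite ler_pdivrMr// distrC.
have c1 : 1 - rho * norm1 u <= cos y.
  have := abs_cos_sub1_le1 y; rewrite ler_norml => /andP[+ _]; lra.
rewrite iE.
have := ler_wpM2l e0 c1; have := ler_wpM2l rho0 H2.
have := ler_wpM2l rho0 (ler_wpM2l C0 EE); nra.
Qed.

(** The same identity as a Riemann sum of mesh [h]. As [L] may be any large number, the mesh can be
    made as fine as desired with [m] fixed. *)
Let walk_probE m x (L : nat) : (0 < m)%N -> (0 < L)%N ->
  (forall (w : {ffun 'I_m -> 'I_q.+1}) i, (`|(walk kv w 0 i - x 0 i)%R| < L)%N) ->
  let sm := Num.sqrt m%:R in
  let h := sm * (2 * pi / L%:R) in
  walk_prob p kv m x * sm ^+ r = ((2 * pi) ^+ r)^-1 *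
    (h ^+ r * gridsum (fun k => - (pi * sm) + h * k%:R) L (integrand m x)).
Proof.
move=> m0 L0 wL sm h.
have sm0 : 0 < sm by rewrite sqrtr_gt0 ltr0n.
have pi0 : 0 < 2 * pi :> R by rewrite mulr_gt0 ?pi_gt0.
have LR0 : 0 < L%:R :> R by rewrite ltr0n.
have -> : (fun k : nat => - (pi * sm) + h * k%:R) =
    (fun k => sm * (- pi + 2 * pi / L%:R * k%:R)).
  by apply/funext => k; rewrite /h; ring.
rewrite gridsum_scale.
have -> : gridsum (fun k => - pi + 2 * pi / L%:R * k%:R) L
   (fun v => integrand m x (sm *: v)) = L%:R ^+ r * walk_prob p kv m x.
  have := congr1 (@complex.Re R) (fourier_inversion p wL).
  rewrite gridsum_Re /= => <-; apply: eq_gridsum => v.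
  by rewrite /integrand -/sm scalerA mulVf ?gt_eqF// scale1r.
have -> : h ^+ r = sm ^+ r * ((2 * pi) ^+ r / L%:R ^+ r).
  by rewrite /h exprMn expr_div_n.
have : (2 * pi) ^+ r != 0 :> R by rewrite expf_neq0// gt_eqF.
have : L%:R ^+ r != 0 :> R by rewrite expf_neq0// gt_eqF.
move: (sm ^+ r) ((2 * pi) ^+ r) (L%:R ^+ r) => a b l l0 b0; field.
by rewrite l0 b0.
Qed.

(** The density at its centre of the normal law with covariance [walk_cov]; [llt_constE] gives the
    usual form. *)
Definition llt_const : R := ((2 * pi) ^+ r)^-1 * gauss_mass S.

Theorem local_limit (d : R) : 0 < d -> exists2 rho, 0 < rho &
  exists m0, forall m, (m0 <= m)%N ->
    (forall x, walk_prob p kv m x * Num.sqrt m%:R ^+ r <= llt_const + d) /\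
    (forall x,
      (forall i, `|(x 0 i)%:~R - m%:R * walk_mean i| <= rho * Num.sqrt m%:R) ->
      llt_const - d <= walk_prob p kv m x * Num.sqrt m%:R ^+ r).
Proof.
move=> d0.
have pi0 : 0 < 2 * pi :> R by rewrite mulr_gt0 ?pi_gt0.
have pir0 : 0 < (2 * pi) ^+ r :> R by rewrite exprn_gt0.
have [k k0 [C C0 H]] := integrand_approx.
(* At most three errors of size [D] add up: from the grid sum, from the distance to the mean, and
   from the [1 / sqrt m] term. *)
pose D := (2 * pi) ^+ r * d / 4.
have D0 : 0 < D by rewrite divr_gt0// mulr_gt0.
have DE : D * 4 = (2 * pi) ^+ r * d by rewrite /D; field.
have [h1 h10 H1] := gauss_grid_le S_posdef D0.
have [h2 h20 H2] := gauss_grid_le (@posdef_scalar R r k k0) ltr01.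
have [A [h3 h30 H3]] := gauss_grid_ge S_posdef D0.
set M := gauss_mass S in H1 H3; set N := gauss_mass _ + 1 in H2.
have N0 : 0 <= N by rewrite addr_ge0 ?gauss_mass_ge0.
have CN0 : 0 <= C * N by rewrite mulr_ge0.
(* Chosen so that the phase costs at most [D]; the [+ 1] allows [C * N = 0]. *)
pose rho := D / (C * N + 1).
have CN1 : 0 < C * N + 1 by lra.
have rho0 : 0 < rho by rewrite divr_gt0.
have rhoD : C * N * rho <= D.
  by rewrite /rho mulrA ler_pdivrMr// mulrC ler_wpM2l ?(ltW D0)//; lra.
clearbody rho D N.
have [m1 Hm1] := sqrtr_nat_large (C * N / D).
have [m2 Hm2] := sqrtr_nat_large (A / pi).
exists rho => //; exists (maxn 2 (maxn m1 m2)) => m.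
rewrite !geq_max => /and3P[m_gt1 mm1 mm2].
have m_gt0 : (0 < m)%N by exact: ltnW.
set sm := Num.sqrt m%:R.
have sm0 : 0 < sm by rewrite sqrtr_gt0 ltr0n.
have smA : A <= pi * sm by rewrite [leRHS]mulrC -ler_pdivrMr ?pi_gt0// Hm2.
have smD : C * N / sm <= D.
  by rewrite ler_pdivrMr// [leRHS]mulrC -ler_pdivrMr// Hm1.
(* [L] is taken beyond all displacements, against aliasing, and large enough for the mesh to meet
   all three grid bounds. *)
have large_L x : exists2 L, (0 < L)%N & (forall (w : {ffun 'I_m -> 'I_q.+1}) i,
    (`|(walk kv w 0 i - x 0 i)%R| < L)%N) /\
    sm * (2 * pi / L%:R) <= Num.min h1 (Num.min h2 h3).
  set h := Num.min h1 _.
  have h0 : 0 < h by rewrite !lt_min h10 h20 h30.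
  pose L1 := Num.bound (sm * (2 * pi) / h).
  exists (L1 + \sum_(w : {ffun 'I_m -> 'I_q.+1}) \sum_i `|(walk kv w 0 i - x 0 i)%R|).+1%N.
    by [].
  split.
    move=> w i; rewrite ltnS (bigD1 w)//= (bigD1 i)//=.
    by rewrite -!addnA addnCA leq_addr.
  rewrite mulrA ler_pdivrMr ?ltr0n// [leRHS]mulrC -ler_pdivrMr//.
  rewrite (le_trans (ltW (archi_boundP _)))//.
    by rewrite divr_ge0 ?(ltW h0)// mulr_ge0 ?(ltW sm0) ?(ltW pi0).
  by rewrite ler_nat -/L1 -addnS leq_addr.
have on_gridP (L : nat) v : (0 < L)%N ->
    on_grid (fun k => - (pi * sm) + sm * (2 * pi / L%:R) * k%:R) L v ->
    forall i, `|v 0 i| <= pi * sm.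
  move=> L0 gv i; have [l lL ->] := gv i.
  have LR0 : 0 < L%:R :> R by rewrite ltr0n.
  rewrite ler_norml; apply/andP; split.
    rewrite lerDl mulr_ge0// mulr_ge0 ?(ltW sm0)// divr_ge0 ?(ltW pi0)//.
  have -> : sm * (2 * pi / L%:R) * l%:R = (sm * (2 * pi)) * (l%:R / L%:R) by ring.
  have : l%:R / L%:R <= 1 :> R by rewrite ler_pdivrMr// mul1r ler_nat ltnW.
  have : 0 <= sm * (2 * pi) by rewrite mulr_ge0 ?(ltW sm0) ?(ltW pi0).
  move=> a0 /(ler_wpM2l a0); lra.
rewrite /llt_const; split.
  move=> x; have [L L0 [wL hL]] := large_L x.
  rewrite (walk_probE m_gt0 L0 wL) -/sm; set h := sm * (2 * pi / L%:R) in hL *.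
  have h0 : 0 <= h by rewrite mulr_ge0 ?divr_ge0 ?(ltW sm0) ?(ltW pi0).
  move: hL; rewrite !le_min => /and3P[hh1 hh2 hh3].
  rewrite -[d](mulKf (lt0r_neq0 pir0)) -mulrDr ler_pM2l ?invr_gt0// -DE.
  apply: (@le_trans _ _ (h ^+ r * gridsum (fun k => - (pi * sm) + h * k%:R) L
     (fun u => expR (- qform S u) + C / sm * expR (- qform k%:M u)))).
    rewrite ler_wpM2l ?exprn_ge0//; apply: ler_gridsum => v gv.
    by case: (H m x v m_gt1 (on_gridP L v L0 gv)).
  rewrite gridsumD gridsumZ mulrDr mulrCA.
  have := H1 h (- (pi * sm)) L; rewrite h0 hh1 => /(_ isT) B1.
  have := H2 h (- (pi * sm)) L; rewrite h0 hh2 => /(_ isT) B2.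
  have Csm : 0 <= C / sm by rewrite divr_ge0// ltW.
  have := ler_wpM2l Csm B2; rewrite [_ * N]mulrAC.
  move: B1 smD; rewrite -/M; lra.
move=> x xrho; have [L L0 [wL hL]] := large_L x.
rewrite (walk_probE m_gt0 L0 wL) -/sm; set h := sm * (2 * pi / L%:R) in hL *.
have h0 : 0 <= h by rewrite mulr_ge0 ?divr_ge0 ?(ltW sm0) ?(ltW pi0).
move: hL; rewrite !le_min => /and3P[hh1 hh2 hh3].
rewrite -[d](mulKf (lt0r_neq0 pir0)) -mulrBr ler_pM2l ?invr_gt0// -DE.
apply: (@le_trans _ _ (h ^+ r * gridsum (fun k => - (pi * sm) + h * k%:R) L
   (fun u => expR (- qform S u) + - (C * rho + C / sm) * expR (- qform k%:M u)))); last first.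
  rewrite ler_wpM2l ?exprn_ge0//; apply: ler_gridsum => v gv.
  case: (H m x v m_gt1 (on_gridP L v L0 gv)) => _ /(_ rho (ltW rho0) xrho).
  by rewrite mulNr.
rewrite gridsumD gridsumZ.
have B1 : M - D <= h ^+ r * gridsum (fun k => - (pi * sm) + h * k%:R) L
    (fun u => expR (- qform S u)).
  apply: H3; rewrite ?h0//; first by rewrite lerN2.
  rewrite /h; have -> : sm * (2 * pi / L%:R) * L%:R = 2 * pi * sm.
    by field; rewrite pnatr_eq0 -lt0n.
  lra.
have := H2 h (- (pi * sm)) L; rewrite h0 hh2 => /(_ isT) B2.
have Csm : 0 <= C * rho + C / sm.
  by apply: addr_ge0; [exact: mulr_ge0 C0 (ltW rho0)|exact: divr_ge0 C0 (ltW sm0)].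
have B3 := ler_wpM2l Csm B2.
have E : (C * rho + C / sm) * N = C * N * rho + C * N / sm by ring.
rewrite {}E in B3.
move: B1 B3 smD rhoD {H1 H2 H3 Hm1 Hm2 H}.
move: (gridsum _ _ _) (gridsum _ _ _) (h ^+ r) => G2 G1 hr B1 B3 smD' rhoD'.
have -> : hr * (G1 + - (C * rho + C / sm) * G2) =
  hr * G1 - (C * rho + C / sm) * (hr * G2) by ring.
rewrite -/M; clearbody M sm; lra.
Qed.

End LocalLimit.

(** * Lattice coordinates of the energies *)

Section MaximalMinors.

(** The Cauchy-Binet expansion before grouping by column sets: all maps [f] occur, which is enough
    for divisibility. *)
Lemma det_mulmx_colsub (A : comNzRingType) r q (M : 'M[A]_(r, q)) (C : 'M[A]_(q, r)) :
  \det (M *m C) =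
  \sum_(f : {ffun 'I_r -> 'I_q}) (\prod_i C (f i) i) * \det (colsub f M).
Proof.
rewrite -det_tr /determinant.
under eq_bigr => s _.
  under eq_bigr do rewrite !mxE.
  rewrite bigA_distr_bigA/= mulr_sumr.
  over.
rewrite exchange_big/=; apply: eq_bigr => f _.
rewrite -/(determinant _) -det_tr /determinant mulr_sumr; apply: eq_bigr => s _.
rewrite big_split/= mulrA mulrC; congr (_ * _); congr (_ * _).
by apply: eq_bigr => i _; rewrite !mxE.
Qed.

Lemma sorting_perm r q (f : 'I_r -> 'I_q) : injective f ->
  exists s : 'S_r, forall i j : 'I_r, (i < j)%N -> (f (s i) < f (s j))%N.
Proof.
move=> fI; pose t := [tuple f i | i < r].
pose leo := fun a b : 'I_q => (a <= b)%N.
have : perm_eq (sort_tuple leo t) t by rewrite perm_sort.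
move=> /tuple_permP[s Es]; exists s => i j ij.
have leo_tr : transitive leo by move=> ? ? ?; exact: leq_trans.
have leo_total : total leo by move=> ? ?; exact: leq_total.
have nthE (k : 'I_r) : nth (f i) (sort leo t) k = f (s k).
  rewrite [sort _ _]Es -tnth_nth.
  by rewrite !tnth_mktuple.
have := sorted_leq_nth leo_tr (fun a => leqnn a) (f i) (sort_sorted leo_total t).
move=> /(_ i j); rewrite !inE size_sort size_tuple !ltn_ord => /(_ isT isT (ltnW ij)).
rewrite !nthE /leo leq_eqVlt => /predU1P[/val_inj/fI/perm_inj Eij|//].
by rewrite Eij ltnn in ij.
Qed.

(** A repeated column gives determinant 0; otherwise sorting the columns changes only the sign. *)
Lemma dvdn_gcd_maximal_minors q r (K : 'M[int]_(r, q)) (f : 'I_r -> 'I_q) :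
  (gcd_maximal_minors K %| `|\det (colsub f K)|)%N.
Proof.
have [/injectiveP fI|] := boolP (injectiveb f); last first.
  move=> /injectivePn[i [j ij fij]].
  rewrite -det_tr (determinant_alternate ij) ?dvdn0// => k.
  by rewrite !mxE fij.
have [s sP] := sorting_perm fI.
pose g := [ffun i => f (s i)].
have gP : [forall i : 'I_r, forall j : 'I_r, (i < j)%N ==> (g i < g j)%N].
  by apply/forallP => i; apply/forallP => j; apply/implyP => /sP; rewrite !ffunE.
have -> : `|\det (colsub f K)|%N = `|\det (colsub g K)|%N.
  have -> : colsub g K = col_perm s (colsub f K).
    by apply/matrixP => i j; rewrite !mxE ffunE.
  by rewrite col_permE det_mulmx det_perm abszM abszX abszN1 exp1n muln1.
rewrite /gcd_maximal_minors (bigD1 g)//=; exact: dvdn_gcdl.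
Qed.

(** The gcd divides every term in the expansion of [\det (K *m C) = 1]. *)
Lemma gcd_maximal_minors_surj q r (K : 'M[int]_(r, q)) (C : 'M[int]_(q, r)) :
  K *m C = 1%:M -> gcd_maximal_minors K = 1%N.
Proof.
move=> KC; apply/eqP; rewrite -dvdn1.
have : `|\det (K *m C)|%N = 1%N by rewrite KC det1.
rewrite det_mulmx_colsub => <-.
suff : ((gcd_maximal_minors K)%:Z %|
    \sum_(f : {ffun 'I_r -> 'I_q}) (\prod_i C (f i) i) * \det (colsub f K))%Z.
  by rewrite dvdzE.
apply: (big_ind (fun z => (_ %| z)%Z)) => [|x y|f _]; first exact: dvdz0.
  exact: rpredD.
apply: dvdz_mull; rewrite dvdzE; exact: dvdn_gcd_maximal_minors.
Qed.

Lemma gcd_maximal_minorsM q r (B : 'M[int]_r) (K : 'M[int]_(r, q)) :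
  gcd_maximal_minors (B *m K) = (`|\det B| * gcd_maximal_minors K)%N.
Proof.
rewrite /gcd_maximal_minors.
rewrite (big_morph (muln `|\det B|%N) (muln_gcdr _) (muln0 _)).
apply: eq_bigr => f _; rewrite -abszM -det_mulmx; congr (`|\det _|)%N.
by apply/matrixP => i j; rewrite !mxE; apply: eq_bigr => k _; rewrite !mxE.
Qed.

End MaximalMinors.

(** * Smith normal form and minimality of the units *)

Section SmithFactorization.
Context (R : realType) (q r : nat) (e : 'I_q.+1 -> R).
Context (eps : 'I_r -> R) (K : 'M[int]_(r, q)).
Hypothesis Kmin : minimal_energy_units e eps K.

(** Changing the units by [L], invertible over the integers, keeps them rationally independent. A
    zero row of [M] means that one new unit occurs in no energy; dropping it contradicts the
    minimality of [r]. *)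
Let drop_row (L : 'M[int]_r) (M : 'M[int]_(r, q)) (i0 : 'I_r) :
  L \in unitmx -> K = L *m M -> row i0 M = 0 -> False.
Proof.
move=> Lu KLM Mi0.
have [[eps_indep eK] rmin] := Kmin.
have r_gt0 : (0 < r)%N by exact: leq_ltn_trans (ltn_ord i0).
pose ep i : R := \sum_l eps l * (L l i)%:~R.
suff : (r <= r.-1)%N by rewrite leqNgt prednK// leqnn.
apply: (rmin _ (fun i => ep (lift i0 i)) (row' i0 M)); split; last first.
  move=> j; rewrite eK.
  have Mi0j : M i0 j = 0 by have /rowP/(_ j) := Mi0; rewrite !mxE.
  transitivity (\sum_i ep i * (M i j)%:~R).
    rewrite KLM; under eq_bigr do rewrite mxE rmorph_sum mulr_sumr.
    rewrite exchange_big/=; apply: eq_bigr => i _; rewrite /ep mulr_suml.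
    by apply: eq_bigr => l _; rewrite rmorphM mulrA.
  rewrite (bigD1_ord i0)//= Mi0j mulr0 add0r.
  by apply: eq_bigr => i _; rewrite mxE.
move=> c ec.
pose c' i : rat := if unlift i0 i is Some k then c k else 0.
have c'i0 : c' i0 = 0 by rewrite /c' unlift_none.
have c'l k : c' (lift i0 k) = c k by rewrite /c' liftK.
pose LQ : 'M[rat]_r := map_mx intr L.
pose cv : 'cV[rat]_r := \col_i c' i.
have Lc : LQ *m cv = 0.
  apply/matrixP => l j; rewrite [RHS]mxE.
  have := eps_indep (fun l => (LQ *m cv) l 0); rewrite ord1; apply.
  rewrite -[RHS]ec; transitivity (\sum_i ratr (c' i) * ep i).
    under eq_bigr do rewrite mxE rmorph_sum mulr_suml.
    rewrite exchange_big/=; apply: eq_bigr => i _; rewrite /ep mulr_sumr.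
    apply: eq_bigr => l0 _; rewrite !mxE rmorphM /= ratr_int; ring.
  rewrite (bigD1_ord i0)//= c'i0 rmorph0 mul0r add0r.
  by apply: eq_bigr => k _; rewrite c'l.
have LQu : LQ \in unitmx.
  by rewrite unitmxE det_map_mx; apply: rmorph_unit; rewrite -unitmxE.
have cv0 : cv = 0 by rewrite -[LHS](mulKmx LQu) Lc mulmx0.
by move=> k; have /colP/(_ (lift i0 k)) := cv0; rewrite !mxE c'l.
Qed.

Lemma smith_factorization : exists (B : 'M[int]_r) (K' : 'M[int]_(r, q)) (C : 'M[int]_(q, r)),
  [/\ K = B *m K', K' *m C = 1%:M & \det B != 0].
Proof.
have [L Lu [U Uu [d _ KE]]] := int_Smith_normal_form K.
set D := \matrix_(i, j) _ in KE.
(* A zero or missing diagonal entry would leave a zero row in [D *m U]. *)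
have Drow (i : 'I_r) : exists2 j : 'I_q, val i = val j & d`_i != 0.
  apply: contrapT => H.
  have KE' : K = L *m (D *m U) by rewrite mulmxA.
  apply: (@drop_row _ _ i Lu KE').
  rewrite row_mul; suff -> : row i D = 0 by rewrite mul0mx.
  apply/rowP => j; rewrite !mxE.
  case: eqP => [ij|_]; last by rewrite mulr0n.
  apply/eqP/negPn/negP => dn0; apply: H; exists j => //.
have rq : (r <= q)%N.
  case: r Drow => // r' Dr.
  by have [j] := Dr ord_max => /= -> _.
exists (L *m diag_mx (\row_i d`_i)), (pid_mx r *m U), (invmx U *m pid_mx r); split.
- rewrite KE !mulmxA; congr (_ *m U); rewrite -mulmxA; congr (L *m _).
  apply/matrixP => i j; rewrite mul_diag_mx !mxE ltn_ord andbT.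
  by rewrite mulr_natr.
- by rewrite -mulmxA mulKVmx// mul_pid_mx minnn (minn_idPr rq) -pid_mx_1.
- rewrite det_mulmx mulf_neq0//.
    by have := Lu; rewrite unitmxE; apply: contraTneq => ->; rewrite unitr0.
  rewrite det_diag; apply/prodf_neq0 => i _; rewrite mxE.
  by have [] := Drow i.
Qed.

End SmithFactorization.

(** * Energies of basis words *)

Section WordEnergies.
Context (R : realType) (q : nat) (e : 'I_q.+1 -> R).
Hypothesis e0 : e ord0 = 0.

Definition word_energy m (w : {ffun 'I_m -> 'I_q.+1}) : R := \sum_l e (w l).

Let word_of_occupation n (nn : 'I_q -> nat) : (\sum_j nn j <= n)%N ->
  exists w : {ffun 'I_n -> 'I_q.+1},
    word_energy w = \sum_j e (lift ord0 j) * (nn j)%:R.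
Proof.
move=> nnn; pose s := flatten [seq nseq (nn j) (lift ord0 j) | j <- index_enum 'I_q].
have sE : \sum_(x <- s) e x = \sum_j e (lift ord0 j) * (nn j)%:R.
  rewrite /s big_flatten/= big_map; apply: eq_bigr => j _.
  by rewrite big_nseq iter_addr addr0 mulr_natr.
have ss : (size s <= n)%N.
  rewrite size_flatten /shape -map_comp sumnE big_map.
  by under eq_bigr do rewrite /= size_nseq.
exists [ffun l : 'I_n => nth ord0 s l].
rewrite /word_energy (eq_bigr (fun l : 'I_n => e (nth ord0 s l))); last first.
  by move=> l _; rewrite ffunE.
rewrite -sE (big_nth ord0).
rewrite -(big_mkord xpredT (fun l => e (nth ord0 s l))) (big_cat_nat (n := size s))//=.
rewrite [X in _ + X]big_nat [X in _ + X]big1 ?addr0// => l /andP[sl _].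
by rewrite nth_default.
Qed.

Let occupation_of_word n (w : {ffun 'I_n -> 'I_q.+1}) :
  exists nn : {ffun 'I_q -> 'I_n.+1}, (\sum_j nn j <= n)%N /\
    word_energy w = \sum_j e (lift ord0 j) * (nn j)%:R.
Proof.
pose cnt j := #|[pred l | w l == lift ord0 j]|.
have cn j : (cnt j < n.+1)%N by rewrite ltnS -[n in leqRHS]card_ord max_card.
exists [ffun j => Ordinal (cn j)]; split.
  have -> : (\sum_j [ffun j => Ordinal (cn j)] j =
      \sum_(l | w l != ord0) 1)%N.
    rewrite [RHS](partition_big (fun l => unlift ord0 (w l)) xpredT)//=.
    rewrite (bigD1 None)//= [X in _ = (X + _)%N]big_pred0 ?add0n; last first.
      by move=> l; case: (unliftP ord0 (w l)) => [j ->|->]; rewrite ?eqxx ?andbF.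
    rewrite (reindex_omap Some id)/=; last by case.
    apply: eq_big => j; first by rewrite eqxx.
    move=> _; rewrite ffunE /= /cnt -sum1_card; apply: eq_bigl => l.
    rewrite inE; case: (unliftP ord0 (w l)) => [k ->|->].
      by rewrite (inj_eq (@lift_inj _ _)) (inj_eq Some_inj) [_ == ord0]eq_sym neq_lift.
    by rewrite (negPf (neq_lift _ _)) eqxx.
  by rewrite sum1_card -[n in leqRHS]card_ord max_card.
rewrite /word_energy (partition_big w xpredT)//= big_ord_recl.
rewrite big1 ?add0r; last by move=> l /eqP ->.
apply: eq_bigr => j _.
rewrite (eq_bigr (fun=> e (lift ord0 j))); last by move=> l /eqP ->.
by rewrite sumr_const ffunE mulr_natr.
Qed.

(** Words index both the tensor basis and the walks, so they replace occupation numbers from here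
    on. *)
Lemma spectrumP n E :
  reflect (exists w : {ffun 'I_n -> 'I_q.+1}, word_energy w = E) (E \in spectrum e n).
Proof.
rewrite /spectrum; apply: (iffP (imfsetP _ _ _ _)) => [[nn /= + ->]|[w <-]].
  by rewrite !inE/= => /word_of_occupation.
have [nn [nnn ->]] := occupation_of_word w.
by exists nn => //=; rewrite !inE.
Qed.

Lemma spectrum_gt0 n : (0 < #|` spectrum e n|)%N.
Proof.
rewrite cardfs_gt0; apply/fset0Pn; exists (word_energy [ffun _ : 'I_n => ord0]).
by apply/spectrumP; eexists.
Qed.

End WordEnergies.

Section LatticeCoordinates.
Context (R : realType) (q r : nat) (e p : 'I_q.+1 -> R).
Hypothesis e0 : e ord0 = 0.
Context (eps : 'I_r -> R) (K : 'M[int]_(r, q)).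
Hypothesis Kunits : energy_units e eps K.
Context (B : 'M[int]_r) (K' : 'M[int]_(r, q)) (C : 'M[int]_(q, r)).
Hypothesis KE : K = B *m K'.
Hypothesis K'C : K' *m C = 1%:M.
Hypothesis Bdet : \det B != 0.
Hypothesis p_gt0 : forall j, 0 < p j.
Hypothesis p_sum : \sum_j p j = 1.

Definition lattice_step (j : 'I_q.+1) : 'rV[int]_r :=
  if unlift ord0 j is Some j' then (col j' K')^T else 0.

Definition lattice_coef (i : 'I_r) (j : 'I_q.+1) : int :=
  if unlift ord0 j is Some j' then C j' i else 0.

Definition lattice_energy (x : 'rV[int]_r) : R :=
  \sum_l eps l * ((B *m x^T) l 0)%:~R.

Lemma lattice_step0 : lattice_step ord0 = 0.
Proof. by rewrite /lattice_step unlift_none. Qed.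

Lemma lattice_step_lift j i : lattice_step (lift ord0 j) 0 i = K' i j.
Proof. by rewrite /lattice_step liftK !mxE. Qed.

Lemma lattice_step_gen i l :
  \sum_j lattice_coef i j * lattice_step j 0 l = (i == l)%:R.
Proof.
rewrite big_ord_recl lattice_step0 mxE mulr0 add0r.
have := congr1 (fun M : 'M[int]_r => M l i) K'C; rewrite !mxE eq_sym => <-.
by apply: eq_bigr => j _; rewrite /lattice_coef liftK lattice_step_lift mulrC.
Qed.

Lemma lattice_energyD x y :
  lattice_energy (x + y) = lattice_energy x + lattice_energy y.
Proof.
rewrite /lattice_energy -big_split/=; apply: eq_bigr => l _.
by rewrite linearD/= mulmxDr mxE rmorphD mulrDr.
Qed.

Lemma lattice_energy0 : lattice_energy 0 = 0.
Proof.
by rewrite /lattice_energy big1// => l _; rewrite trmx0 mulmx0 mxE mulr0.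
Qed.

(** Rational independence of the units gives [B *m x^T = 0] on the kernel, and the adjugate of the
    nonsingular [B] gives [x = 0]. *)
Lemma lattice_energy_inj : injective lattice_energy.
Proof.
have ker x : lattice_energy x = 0 -> x = 0.
  move=> x0; have [ind _] := Kunits.
  have {x0} H l : (B *m x^T) l 0 = 0.
    apply/eqP; rewrite -(eqr_int rat); apply/eqP.
    apply: (ind (fun l => ((B *m x^T) l 0)%:~R)); rewrite -[RHS]x0.
    by apply: eq_bigr => i _; rewrite ratr_int mulrC.
  have {}H : B *m x^T = 0 by apply/matrixP => l j; rewrite ord1 H mxE.
  have : \adj B *m (B *m x^T) = 0 by rewrite H mulmx0.
  rewrite mulmxA mul_adj_mx mul_scalar_mx => /eqP.
  by rewrite scalemx_eq0 (negPf Bdet)/= => /eqP/(congr1 trmx); rewrite trmxK trmx0.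
move=> x y xy; apply/eqP; rewrite -subr_eq0; apply/eqP/ker.
apply: (addIr (lattice_energy y)); rewrite -lattice_energyD subrK add0r.
exact: xy.
Qed.

Lemma lattice_energy_step j : lattice_energy (lattice_step j) = e j.
Proof.
case: (unliftP ord0 j) => [j' ->|->]; last by rewrite lattice_step0 lattice_energy0 e0.
have [_ ->] := Kunits; apply: eq_bigr => l _; congr (_ * _%:~R).
rewrite KE !mxE; apply: eq_bigr => i _; by rewrite mxE lattice_step_lift.
Qed.

Lemma word_energyE m (w : {ffun 'I_m -> 'I_q.+1}) :
  word_energy e w = lattice_energy (walk lattice_step w).
Proof.
rewrite /walk (big_morph lattice_energy lattice_energyD lattice_energy0).
by apply: eq_bigr => l _; rewrite lattice_energy_step.
Qed.

Lemma card_spectrum n : #|` spectrum e n| = #|` reduced_occupations K n|.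
Proof.
have [ind eK] := Kunits.
pose f (x : 'cV[int]_r) : R := \sum_l eps l * (x l 0)%:~R.
have fI : injective f.
  move=> x y xy; apply/matrixP => l j; rewrite ord1; apply/eqP.
  rewrite -subr_eq0 -(eqr_int rat); apply/eqP.
  apply: (ind (fun l => (x l 0 - y l 0)%:~R)).
  transitivity (f x - f y); last by rewrite xy subrr.
  rewrite -sumrB; apply: eq_bigr => i _.
  by rewrite ratr_int rmorphB/= mulrBl mulrC [X in _ - X]mulrC.
have -> : spectrum e n = [fset f x | x in reduced_occupations K n]%fset.
  have fE nn : f (K *m occupation_vector nn) = @energy _ _ e n nn.
    rewrite /f /energy; under [RHS]eq_bigr do rewrite eK mulr_suml.
    rewrite exchange_big/=; apply: eq_bigr => l _.
    rewrite mxE rmorph_sum mulr_sumr; apply: eq_bigr => j _.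
    by rewrite rmorphM mulrA mxE.
  apply/fsetP => E; apply/imfsetP/imfsetP => -[x /= xin ->].
    exists (K *m occupation_vector x); last by rewrite fE.
    by apply/imfsetP; exists x.
  by case/imfsetP: xin => nn /= nnin ->; exists nn => //; rewrite fE.
by rewrite card_imfset.
Qed.

Let p0E : p ord0 = 1 - \sum_j p (lift ord0 j).
Proof. by rewrite -p_sum big_ord_recl addrK. Qed.

Let cov_sum (P a b : 'I_q -> R) x y :
  \sum_j P j * (a j - x) * (b j - y) =
  \sum_j P j * a j * b j - y * (\sum_j P j * a j) - x * (\sum_j P j * b j)
    + x * y * \sum_j P j.
Proof.
rewrite !mulr_sumr -!sumrB -big_split/=; apply: eq_bigr => j _; ring.
Qed.

(** [Sigma p 1] is the covariance matrix of the indicators of the letters other than [ord0], and one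
    step is their image under [K']. *)
Lemma walk_covE : walk_cov p lattice_step =
  map_mx intr K' *m Sigma p 1 *m (map_mx intr K')^T.
Proof.
apply/matrixP => i l; rewrite mxE [RHS]mxE.
pose P j := p (lift ord0 j).
pose a j : R := (K' i j)%:~R; pose b j : R := (K' l j)%:~R.
have meanE i' : walk_mean p lattice_step i' = \sum_j P j * (K' i' j)%:~R.
  rewrite /walk_mean big_ord_recl lattice_step0 mxE mulr0 add0r.
  by apply: eq_bigr => j _; rewrite lattice_step_lift.
rewrite big_ord_recl lattice_step0 mxE !meanE p0E -/(P _).
rewrite [X in _ + X = _](eq_bigr (fun j => P j * (a j - \sum_j P j * a j) * (b j - \sum_j P j * b j))); last first.
  by move=> j _; rewrite !lattice_step_lift.
rewrite cov_sum.
transitivity (\sum_j P j * a j * b j - (\sum_j P j * a j) * (\sum_j P j * b j)).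
  rewrite -/(P _) mxE; under [\sum_(j < q) p _]eq_bigr do rewrite -/(P _).
  ring.
under [RHS]eq_bigr => j _ do rewrite mxE [in X in _ * X]mxE [in X in _ * X]mxE.
transitivity (\sum_j \sum_k (a k * ((k == j)%:R * P k - P k * P j) * b j)); last first.
  apply: eq_bigr => j _; rewrite mulr_suml; apply: eq_bigr => k _.
  rewrite !mxE /a /b /P /=.
  by case: eqP => [->|_]; rewrite ?mulr1n ?mulr0n; ring.
transitivity (\sum_j (P j * a j * b j - (\sum_k P k * a k) * (P j * b j))).
  by rewrite sumrB mulr_sumr.
apply: eq_bigr => j _.
rewrite [RHS](eq_bigr (fun k => (k == j)%:R * (a k * P k * b j) - P k * a k * (P j * b j))); last first.
  by move=> k _; ring.
rewrite [RHS]sumrB -mulr_suml [X in _ = X - _](bigD1 j)//= eqxx mul1r.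
rewrite [X in _ = _ + X - _]big1 ?addr0.
  congr (_ - _); ring.
by move=> k /negPf ->; rewrite mul0r.
Qed.

Lemma det_reduced_Sigma m : \det (reduced_Sigma p K m) =
  (\det B)%:~R ^+ 2 * (m%:R ^+ r * \det (walk_cov p lattice_step)).
Proof.
have -> : reduced_Sigma p K m =
    map_mx intr B *m (m%:R *: walk_cov p lattice_step) *m (map_mx intr B)^T.
  have SE : Sigma p m = m%:R *: Sigma p 1.
    by apply/matrixP => i j; rewrite !mxE /=; case: (i == j); ring.
  rewrite walk_covE /reduced_Sigma KE map_mxM trmx_mul SE.
  by rewrite -?(scalemxAr, scalemxAl) !mulmxA.
by rewrite !det_mulmx det_tr det_map_mx detZ; ring.
Qed.

Lemma llt_constE :
  llt_const p lattice_step = (Num.sqrt ((2 * pi) ^+ r * \det (walk_cov p lattice_step)))^-1.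
Proof.
have D0 : 0 < \det (walk_cov p lattice_step).
  apply: posdef_det_gt0.
  exact: (walk_cov_posdef p_gt0 p_sum lattice_step0 lattice_step_gen).
have pi0 : 0 < (2 * pi) ^+ r :> R by rewrite exprn_gt0// mulr_gt0 ?pi_gt0.
rewrite /llt_const /gauss_mass detZ.
have -> : pi ^+ r / (2^-1 ^+ r * \det (walk_cov p lattice_step)) =
   (2 * pi) ^+ r / \det (walk_cov p lattice_step) :> R.
  by rewrite invfM exprVn invrK exprMn mulrA [pi ^+ r * _]mulrC.
set a := (2 * pi) ^+ r in pi0 *; set D := \det _ in D0 *.
rewrite !sqrtrM ?(ltW pi0)// sqrtrV ?(ltW D0)// invfM mulrA; congr (_ / _).
rewrite -{1}(sqr_sqrtr (ltW pi0)).
have : Num.sqrt a != 0 by rewrite gt_eqF ?sqrtr_gt0.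
by move: (Num.sqrt a) => x x0; field.
Qed.

Lemma llt_const_gt0 : 0 < llt_const p lattice_step.
Proof.
have D0 : 0 < \det (walk_cov p lattice_step).
  apply: posdef_det_gt0.
  exact: (walk_cov_posdef p_gt0 p_sum lattice_step0 lattice_step_gen).
rewrite llt_constE invr_gt0 sqrtr_gt0 mulr_gt0// exprn_gt0// mulr_gt0 ?pi_gt0//.
Qed.

(** The gcd of the minors equals [|det B|], and it cancels the square root of [(det B)^2] in the
    determinant of the reduced covariance. *)
Lemma asymptotic_fidelityE n m : (0 < m)%N ->
  asymptotic_fidelity p K n m =
  #|` spectrum e n|%:R * (llt_const p lattice_step / Num.sqrt m%:R ^+ r).
Proof.
move=> m0; have D0 : 0 < \det (walk_cov p lattice_step).
  apply: posdef_det_gt0.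
  exact: (walk_cov_posdef p_gt0 p_sum lattice_step0 lattice_step_gen).
have pi0 : 0 < (2 * pi) ^+ r :> R by rewrite exprn_gt0// mulr_gt0 ?pi_gt0.
rewrite /asymptotic_fidelity card_spectrum llt_constE.
rewrite KE gcd_maximal_minorsM (gcd_maximal_minors_surj K'C) muln1 -KE.
rewrite det_reduced_Sigma.
set a := (2 * pi) ^+ r in pi0 *; set D := \det (walk_cov _ _) in D0 *.
have mr0 : 0 < m%:R ^+ r :> R by rewrite exprn_gt0// ltr0n.
rewrite powRN powR12_sqrt; last first.
  exact: mulr_ge0 (ltW pi0) (mulr_ge0 (sqr_ge0 _) (mulr_ge0 (ltW mr0) (ltW D0))).
have -> : a * ((\det B)%:~R ^+ 2 * (m%:R ^+ r * D)) =
    (a * D) * (m%:R ^+ r * (\det B)%:~R ^+ 2) by ring.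
rewrite (sqrtrM (m%:R ^+ r * _)); last exact: mulr_ge0 (ltW pi0) (ltW D0).
rewrite (sqrtrM (_ ^+ 2)) ?(ltW mr0)// sqrtr_sqr.
have -> : Num.sqrt (m%:R ^+ r) = Num.sqrt m%:R ^+ r :> R.
  elim: (r) => [|k IH]; first by rewrite !expr0 sqrtr1.
  by rewrite !exprS sqrtrM ?ler0n// IH.
have -> : (`|\det B|%N)%:R = `|(\det B)%:~R| :> R.
  by rewrite -intr_norm pmulrn.
have dB0 : `|(\det B)%:~R| != 0 :> R by rewrite normr_eq0 intr_eq0.
have aD0 : Num.sqrt (a * D) != 0 by rewrite gt_eqF// sqrtr_gt0 mulr_gt0.
have mm0 : Num.sqrt m%:R ^+ r != 0 :> R by rewrite expf_neq0// gt_eqF// sqrtr_gt0 ltr0n.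
by field; rewrite dB0 aD0 mm0.
Qed.

End LatticeCoordinates.

(** * Clock states and filters *)

Section InnerProduct.
Context {R : realType}.
Local Notation nc := (@Normc.normc R).

Lemma conjCE (x : R[i]) : Num.conj x = x^*%C.
Proof. by []. Qed.

Lemma conjc_mul (x y : R[i]) : (x * y)^*%C = x^*%C * y^*%C.
Proof. exact: rmorphM. Qed.

Lemma conjc_add (x y : R[i]) : (x + y)^*%C = x^*%C + y^*%C.
Proof. exact: rmorphD. Qed.

Lemma conjc_sum (I : Type) (s : seq I) (P : pred I) (f : I -> R[i]) :
  (\sum_(i <- s | P i) f i)^*%C = \sum_(i <- s | P i) (f i)^*%C.
Proof. exact: rmorph_sum. Qed.

Lemma normcE2 (x : R[i]) : nc x ^+ 2 = complex.Re (x * x^*%C).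
Proof. by case: x => a b; rewrite /= sqr_sqrtr ?addr_ge0 ?sqr_ge0//; ring. Qed.

Lemma mulcJ_real (x : R[i]) : x * x^*%C = (nc x ^+ 2)%:C.
Proof.
case: x => a b; rewrite /= sqr_sqrtr ?addr_ge0 ?sqr_ge0//.
by apply/eqP; rewrite eq_complex/=; apply/andP; split; apply/eqP; ring.
Qed.

Lemma normcJ2 (x : R[i]) : nc x^*%C = nc x.
Proof. by case: x => a b; rewrite /= sqrrN. Qed.

Lemma innerE N (u v : 'cV[R[i]]_N) : inner u v = \sum_a (u a 0)^*%C * v a 0.
Proof. by rewrite /inner mxE; apply: eq_bigr => a _; rewrite !mxE. Qed.

Lemma inner_sumr N (I : Type) (s : seq I) (P : pred I) u (f : I -> 'cV[R[i]]_N) :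
  inner u (\sum_(i <- s | P i) f i) = \sum_(i <- s | P i) inner u (f i).
Proof. by rewrite /inner mulmx_sumr summxE. Qed.

Lemma innerZr N (u v : 'cV[R[i]]_N) a : inner u (a *: v) = a * inner u v.
Proof. by rewrite /inner -scalemxAr mxE. Qed.

Lemma innerC N (u v : 'cV[R[i]]_N) : inner v u = (inner u v)^*%C.
Proof.
rewrite !innerE conjc_sum; apply: eq_bigr => a _.
by rewrite conjc_mul conjcK mulrC.
Qed.

Lemma inner_suml N (I : Type) (s : seq I) (P : pred I) u (f : I -> 'cV[R[i]]_N) :
  inner (\sum_(i <- s | P i) f i) u = \sum_(i <- s | P i) inner (f i) u.
Proof.
rewrite innerC inner_sumr conjc_sum; apply: eq_bigr => i _.
by rewrite [RHS]innerC.
Qed.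

Lemma innerZl N (u v : 'cV[R[i]]_N) a : inner (a *: u) v = a^*%C * inner u v.
Proof. by rewrite innerC innerZr conjc_mul -innerC. Qed.

Lemma innerDr N (u v w : 'cV[R[i]]_N) : inner u (v + w) = inner u v + inner u w.
Proof. by rewrite /inner mulmxDr mxE. Qed.

Lemma ketbra_entry N (u : 'cV[R[i]]_N) x y :
  (ketbra u : 'M[R[i]]_N) x y = u x 0 * (u y 0)^*%C.
Proof. by rewrite /ketbra mxE big_ord1 !mxE. Qed.

Lemma ketbraE N (v w : 'cV[R[i]]_N) : ketbra v *m w = inner v w *: v.
Proof.
rewrite /ketbra -mulmxA [_ *m w]mx11_scalar mul_mx_scalar.
by [].
Qed.

Lemma inner_ketbra N (u v w : 'cV[R[i]]_N) :
  inner u (ketbra v *m w) = inner v w * inner u v.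
Proof. by rewrite ketbraE innerZr. Qed.

Lemma expect_ketbra N (v w : 'cV[R[i]]_N) : expect v (ketbra w) = nc (inner w v) ^+ 2.
Proof. by rewrite /expect inner_ketbra [inner v w]innerC normcE2. Qed.

Lemma expect_sum N (I : Type) (s : seq I) (P : pred I) (v : 'cV[R[i]]_N)
    (A : I -> 'M[R[i]]_N) :
  expect v (\sum_(i <- s | P i) A i) = \sum_(i <- s | P i) expect v (A i).
Proof.
rewrite /expect mulmx_suml inner_sumr.
by apply: (big_morph (@complex.Re R)) => //; exact: ReD.
Qed.

Lemma expectD N (v : 'cV[R[i]]_N) A B : expect v (A + B) = expect v A + expect v B.
Proof. by rewrite /expect mulmxDl innerDr ReD. Qed.

Lemma expectZ N (v : 'cV[R[i]]_N) (a : R) A : expect v (a%:C *: A) = a * expect v A.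
Proof.
rewrite /expect -scalemxAl innerZr; case: (inner _ _) => x y /=.
by rewrite mul0r subr0.
Qed.

Lemma psd_expect N (A : 'M[R[i]]_N) v : psd A -> 0 <= expect v A.
Proof. by move=> /(_ v); rewrite lecE => /andP[]. Qed.

Lemma psd_sum N (I : Type) (s : seq I) (P : pred I) (A : I -> 'M[R[i]]_N) :
  (forall i, P i -> psd (A i)) -> psd (\sum_(i <- s | P i) A i).
Proof.
by move=> Ap v; rewrite mulmx_suml inner_sumr; apply: sumr_ge0 => i Pi; exact: Ap.
Qed.

Lemma psdZ N (a : R) (A : 'M[R[i]]_N) : 0 <= a -> psd A -> psd (a%:C *: A).
Proof.
by move=> a0 Ap v; rewrite -scalemxAl innerZr mulr_ge0// ler0c.
Qed.

Lemma psd_ketbra N (v : 'cV[R[i]]_N) : psd (ketbra v).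
Proof.
move=> w; rewrite inner_ketbra [inner w v]innerC mulcJ_real ler0c.
exact: sqr_ge0.
Qed.

Let delta N (a : 'I_N) : 'cV[R[i]]_N := delta_mx a 0.

Let inner_delta N (A : 'M[R[i]]_N) a b : inner (delta a) (A *m delta b) = A a b.
Proof.
rewrite /delta -colE innerE (bigD1 a)//= big1 ?addr0 => [|i ia].
  by rewrite !mxE !eqxx conjc1 mul1r.
by rewrite !mxE (negPf ia) conjc0 mul0r.
Qed.

(** Polarization: the form is real on [delta a + z *: delta b]; [z = 1] and [z = i] determine the
    two parts. *)
Lemma psd_hermitian N (A : 'M[R[i]]_N) a b : psd A -> A b a = (A a b)^*%C.
Proof.
move=> Ap.
have real v : complex.Im (inner v (A *m v)) = 0.
  exact: ger0_Im (Ap v).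
have expand z : complex.Im (z * A a b + z^*%C * A b a) = 0.
  have := real (delta a + z *: delta b).
  rewrite mulmxDr innerDr -scalemxAr innerZr.
  have dl u w v : inner (u + w) v = inner u v + inner w v :> R[i].
    by move=> *; rewrite innerC innerDr conjc_add -!innerC.
  rewrite !dl !innerZl !inner_delta.
  have := ger0_Im (Ap (delta a)); have := ger0_Im (Ap (delta b)).
  rewrite !inner_delta.
  case: z (A a a) (A b b) (A a b) (A b a) => [z1 z2] [x1 x2] [y1 y2] [u1 u2] [w1 w2] /=.
  by move=> -> ->; rewrite !mulr0 ?addr0 ?add0r => H; rewrite -[RHS]H; ring.
have := expand 1; have := expand ('i)%C.
rewrite conjc1 !mul1r; case: (A a b) (A b a) => [u1 u2] [w1 w2] /=.
rewrite !mul0r !mul1r ?addr0 ?add0r => H1 H2.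
by congr (_ +i* _); lra.
Qed.

(** By the spectral theorem, expectations of positive operators become sums of squared moduli, to
    which scalar mean-square estimates apply. *)
Lemma psd_decomposition N (A : 'M[R[i]]_N) : psd A ->
  exists b : 'I_N -> 'cV[R[i]]_N, A = \sum_j ketbra (b j).
Proof.
move=> Ap.
have An : A \is normalmx.
  apply/normalmxP; suff -> : A ^t* = A by [].
  by apply/matrixP => a b; rewrite !mxE conjCE -psd_hermitian.
have /orthomx_spectralP := An.
set P := spectralmx A; set d := spectral_diag A => AE.
have Pu : P \is unitarymx by exact: spectral_unitarymx.
pose w j : 'cV[R[i]]_N := P ^t* *m delta j.
have PP : P *m P ^t* = 1%:M by apply/unitarymxP.
have wE j : inner (w j) (A *m w j) = d 0 j.
  rewrite /inner /w trmx_mul map_mxM -/(P ^t*) trmxCK AE invmx_unitary//.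
  rewrite !mulmxA -[_ *m P *m P ^t*]mulmxA PP mulmx1.
  rewrite -[_ *m P *m P ^t*]mulmxA PP mulmx1 -mulmxA.
  have := inner_delta (diag_mx d) j j; rewrite /inner => ->.
  by rewrite !mxE eqxx mulr1n.
have d0 j : 0 <= d 0 j by rewrite -wE; exact: Ap.
exists (fun j => (Num.sqrt (complex.Re (d 0 j)))%:C *: w j).
rewrite [LHS]AE invmx_unitary//.
apply/matrixP => a b; rewrite summxE.
rewrite mxE; apply: eq_bigr => j _.
rewrite ketbra_entry mul_mx_diag.
have wj k : w j k 0 = (P j k)^*%C.
  by rewrite /w /delta -colE !mxE.
have sw (x : R[i]) k : (x *: w j) k 0 = x * (P j k)^*%C by rewrite mxE wj.
rewrite !sw conjc_mul conjcK conjc_real.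
rewrite !mxE conjCE.
have dE : d 0 j = (Num.sqrt (complex.Re (d 0 j)))%:C * (Num.sqrt (complex.Re (d 0 j)))%:C.
  rewrite -rmorphM -expr2 sqr_sqrtr; last by have := d0 j; rewrite lecE => /andP[].
  by have := d0 j; rewrite lecE => /andP[/eqP i0 _]; case: (d 0 j) i0 => x y /= ->.
rewrite [in LHS]dE; ring.
Qed.

Lemma expect_trace N (A : 'M[R[i]]_N) v : inner v (A *m v) = \tr (A *m ketbra v).
Proof.
by rewrite /inner /ketbra mulmxA mxtrace_mulC /mxtrace big_ord1.
Qed.

(* Lagrange's identity for the positive operator
   [sum_k |v_k><v_k| - |sum_k c_k v_k><sum_k c_k v_k|], when [sum_k |c_k|^2 = 1]. *)
Lemma lagrange_ketbra N (T : Type) (s : seq T) (c : T -> R[i]) (v : T -> 'cV[R[i]]_N) :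
  \sum_(k <- s) (c k)^*%C * c k = 1 ->
  \sum_(k <- s) \sum_(l <- s) ketbra ((c l)^*%C *: v k - (c k)^*%C *: v l) =
  (\sum_(k <- s) ketbra (v k) - ketbra (\sum_(k <- s) c k *: v k)) *+ 2.
Proof.
move=> c1; apply/matrixP => a b.
have E2 (X Y : 'M[R[i]]_N) : ((X - Y) *+ 2) a b = (X a b - Y a b) *+ 2.
  by rewrite mulr2n 3!mxE -mulr2n.
have E3 k : (c k *: v k) a 0 = c k * v k a 0 by rewrite mxE.
rewrite E2 summxE summxE ketbra_entry !summxE conjc_sum.
transitivity (\sum_(k <- s) \sum_(l <- s)
   ((c l)^*%C * c l * (v k a 0 * (v k b 0)^*%C) + (c k)^*%C * c k * (v l a 0 * (v l b 0)^*%C)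
   - (c k * v k a 0 * (c l * v l b 0)^*%C + c l * v l a 0 * (c k * v k b 0)^*%C))).
  apply: eq_bigr => k _; rewrite summxE; apply: eq_bigr => l _.
  rewrite ketbra_entry !mxE; case: (c l) (c k) (v k a 0) (v k b 0) (v l a 0) (v l b 0)
    => [x1 x2] [y1 y2] [z1 z2] [u1 u2] [w1 w2] [t1 t2].
  by apply/eqP; rewrite eq_complex/=; apply/andP; split; apply/eqP; ring.
set VV := fun k => v k a 0 * (v k b 0)^*%C.
set CC := fun k => (c k)^*%C * c k.
set X := fun k => c k * v k a 0.
set Y := fun k => (c k * v k b 0)^*%C.
transitivity (\sum_(k <- s) \sum_(l <- s) (CC l * VV k + CC k * VV l - (X k * Y l + X l * Y k))).
  by [].
have bs (f g : T -> R[i]) : \sum_(k <- s) \sum_(l <- s) f k * g l =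
    (\sum_(k <- s) f k) * (\sum_(k <- s) g k).
  by rewrite big_distrlr.
have bs' (f g : T -> R[i]) : \sum_(k <- s) \sum_(l <- s) f l * g k =
    (\sum_(k <- s) f k) * (\sum_(k <- s) g k).
  by rewrite mulr_sumr; apply: eq_bigr => k _; rewrite mulr_suml.
under eq_bigr do rewrite sumrB !big_split/=.
rewrite sumrB !big_split/= (bs' CC VV) (bs CC VV) (bs X Y) (bs' X Y).
rewrite -/CC c1 !mul1r.
have -> : \sum_(k <- s) ketbra (v k) a b = \sum_(k <- s) VV k.
  by apply: eq_bigr => k _; rewrite ketbra_entry.
have -> : \sum_(k <- s) (c k *: v k) a 0 = \sum_(k <- s) X k.
  by apply: eq_bigr => k _; rewrite E3.
have -> : \sum_(k <- s) ((c k *: v k) b 0)^*%C = \sum_(k <- s) Y k.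
  by apply: eq_bigr => k _; rewrite mxE.
ring.
Qed.

End InnerProduct.

(** * Means of trigonometric sums along arithmetic progressions *)

Section AlmostPeriodicMean.
Context {R : realType}.
Local Notation nc := (@Normc.normc R).

(* A small enough step [tau] keeps every [w * tau] out of 2 pi Z, so that the
   geometric sums stay bounded. *)
Lemma mean_expi_small (S : seq R) (d : R) : 0 < d ->
  exists tau, exists2 L : nat, (0 < L)%N & forall w, w \in S -> w != 0 ->
    nc (\sum_(k < L) expi (w * (tau * k%:R))) <= d * L%:R.
Proof.
move=> d0.
pose tau : R := (1 + \sum_(w <- S) `|w|)^-1.
have s0 : 0 <= \sum_(w <- S) `|w| by exact: sumr_ge0.
have tau0 : 0 < tau by rewrite invr_gt0 ltr_wpDr.
have tauw w : w \in S -> `|w * tau| <= 1.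
  move=> wS; rewrite normrM (ger0_norm (ltW tau0)) ler_pdivrMr ?ltr_wpDr// mul1r.
  by rewrite (perm_big _ (perm_to_rem wS)) big_cons/= addrCA lerDl addr_ge0// sumr_ge0.
pose z w : R[i] := expi (w * tau).
pose B := \sum_(w <- S) 2 / nc (z w - 1).
have B0 : 0 <= B by rewrite sumr_ge0// => w _; rewrite divr_ge0// normc_ge0.
exists tau, (Num.bound (B / d)).+1 => // w wS w0.
set L := _.+1.
have BL : B <= d * L%:R.
  rewrite mulrC -ler_pdivrMr// (le_trans (ltW (archi_boundP _))) ?divr_ge0 ?(ltW d0)//.
  by rewrite ler_nat.
apply: le_trans BL.
have -> : \sum_(k < L) expi (w * (tau * k%:R)) = \sum_(k < L) z w ^+ k.
  by apply: eq_bigr => k _; rewrite mulrA mulrC expi_mulrn.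
have z1 : z w - 1 != 0.
  rewrite subr_eq0; apply/eqP => /expi_eq1 H.
  have : 3 / 32 * `|w * tau| <= `|sin (w * tau / 2)|.
    apply: abs_sin_half_ge; apply: le_trans (tauw w wS) _.
    by apply: le_trans (@pi_ge2 R); lra.
  rewrite H normr0; have : 0 < `|w * tau| by rewrite normr_gt0 mulf_neq0// gt_eqF.
  lra.
have z1' : 0 < nc (z w - 1).
  by rewrite lt0r normc_ge0 andbT; apply: contra z1 => /eqP/Normc.eq0_normc ->.
have E : nc (z w - 1) * nc (\sum_(k < L) z w ^+ k) <= 2.
  rewrite -Normc.normcM -subrX1 (le_trans (le_normcD _ _))// normcN normcX normc_expi.
  by rewrite expr1n Normc.normc1.
apply: (@le_trans _ _ (2 / nc (z w - 1))).
  by rewrite ler_pdivlMr// mulrC.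
by rewrite /B (perm_big _ (perm_to_rem wS)) big_cons/= lerDl sumr_ge0.
Qed.

(** After expanding the square, pairs of equal frequency form the main term and the others are small
    geometric sums; [y] only contributes phases. Distinct indices may share a frequency, as pairs of
    energies do in the lower bound. *)
Lemma mean_square (T : eqType) (s : seq T) (w : T -> R) (c : T -> R[i])
    (d tau y : R) (L : nat) : 0 < d ->
  (forall i j, i \in s -> j \in s -> w i - w j != 0 ->
     nc (\sum_(k < L) expi ((w i - w j) * (tau * k%:R))) <= d * L%:R) ->
  `| \sum_(k < L) nc (\sum_(i <- s) c i * expi (w i * (tau * k%:R - y))) ^+ 2
     - L%:R * \sum_(i <- s) \sum_(j <- s)
        (if w i == w j then complex.Re (c i * (c j)^*%C) else 0) |
  <= d * L%:R * (\sum_(i <- s) nc (c i)) ^+ 2.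
Proof.
move=> d0 H.
pose u i j : R[i] := \sum_(k < L) expi ((w i - w j) * (tau * k%:R - y)).
have -> : \sum_(k < L) nc (\sum_(i <- s) c i * expi (w i * (tau * k%:R - y))) ^+ 2 =
  \sum_(i <- s) \sum_(j <- s) complex.Re (c i * (c j)^*%C * u i j).
  transitivity (\sum_(k < L) \sum_(i <- s) \sum_(j <- s)
     complex.Re (c i * (c j)^*%C * expi ((w i - w j) * (tau * k%:R - y)))).
    apply: eq_bigr => k _; rewrite normcE2 conjc_sum big_distrlr/=.
    rewrite (big_morph _ (@ReD R) (erefl : complex.Re 0 = 0)); apply: eq_bigr => i _.
    rewrite (big_morph _ (@ReD R) (erefl : complex.Re 0 = 0)); apply: eq_bigr => j _.
    congr complex.Re; rewrite conjc_mul -expiN mulrACA -expiD; congr (_ * expi _); ring.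
  rewrite exchange_big/=; apply: eq_bigr => i _.
  rewrite exchange_big/=; apply: eq_bigr => j _.
  by rewrite /u mulr_sumr (big_morph _ (@ReD R) (erefl : complex.Re 0 = 0)).
rewrite mulr_sumr -sumrB (le_trans (ler_norm_sum _ _ _))//.
rewrite expr2 big_distrlr/= mulr_sumr big_seq [leRHS]big_seq; apply: ler_sum => i iS.
rewrite mulr_sumr -sumrB (le_trans (ler_norm_sum _ _ _))//.
rewrite mulr_sumr big_seq [leRHS]big_seq; apply: ler_sum => j jS.
have dL0 : 0 <= d * L%:R by rewrite mulr_ge0// ltW.
have [wij|wij] := eqVneq (w i) (w j).
  have -> : u i j = L%:R%:C.
    rewrite /u wij subrr; under eq_bigr do rewrite mul0r expi0.
    by rewrite sumr_const card_ord rmorph_nat.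
  have ReZ (x : R[i]) (a : R) : complex.Re (x * a%:C) = a * complex.Re x.
    by case: x => x1 x2 /=; rewrite mulr0 subr0 mulrC.
  by rewrite ReZ subrr normr0 !mulr_ge0 ?normc_ge0 ?(ltW d0).
rewrite mulr0 subr0 (le_trans (abs_Re_le_normc _))// !Normc.normcM normcJ2 mulrC.
rewrite ler_wpM2r ?mulr_ge0 ?normc_ge0//.
have -> : u i j = expi (- ((w i - w j) * y)) *
    \sum_(k < L) expi ((w i - w j) * (tau * k%:R)).
  rewrite mulr_sumr; apply: eq_bigr => k _; rewrite -expiD; congr expi; ring.
by rewrite Normc.normcM normc_expi mul1r H// subr_eq0.
Qed.

End AlmostPeriodicMean.

Section EigenProjector.
Context {R : realType}.

(** The diagonal 0/1 matrix [D] has its rows in the eigenspace and [1 - D] has its rows orthogonal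
    to it; this characterizes the orthogonal projector. *)
Lemma eigenproj_diag N (d : 'rV[R[i]]_N) (x : R[i]) :
  eigenproj (diag_mx d) x = diag_mx (\row_a (d 0 a == x)%:R).
Proof.
rewrite /eigenproj tr_diag_mx; set U := eigenspace _ _.
pose D : 'M[R[i]]_N := diag_mx (\row_a (d 0 a == x)%:R).
have DU : (D <= U)%MS.
  apply/eigenspaceP; rewrite /D mulmx_diag; apply/matrixP => a b.
  rewrite !mxE; case: (eqVneq (d 0 a) x) => [->|_].
    by rewrite mul1r mulrnAr mulr1.
  by rewrite mul0r !mul0rn mulr0.
have UD : U *m (1%:M - D) = 0.
  have UU : (U <= U)%MS by [].
  have /eigenspaceP := UU; rewrite mul_mx_diag => UE.
  have -> : 1%:M - D = diag_mx (\row_a (d 0 a != x)%:R).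
    apply/matrixP => a b; rewrite !mxE.
    by case: (a == b); case: (_ == x); rewrite ?mulr1n ?mulr0n ?subrr ?subr0.
  apply/matrixP => a b; rewrite mul_mx_diag !mxE.
  case: (eqVneq (d 0 b) x) => [_|dx]; first by rewrite mulr0.
  have /matrixP/(_ a b) := UE; rewrite !mxE => /eqP.
  rewrite mulrC -subr_eq0 -mulrBl mulf_eq0 subr_eq0 (negPf dx)/= => /eqP ->.
  by rewrite mul0r.
have DUo : (1%:M - D) *m proj_ortho U = 0.
  apply: proj_ortho_0; apply/orthomx1P.
  have := congr1 (fun M => M ^t*) UD; rewrite /= trmx_mul map_mxM.
  rewrite trmx0 map_mx0 => E; rewrite -[RHS]E; congr (_ *m _).
  rewrite linearB/= trmx1 tr_diag_mx map_mxB map_mx1 map_diag_mx; congr (_ - diag_mx _).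
  by apply/matrixP => a b; rewrite !mxE rmorph_nat.
have -> : proj_ortho U = D.
  have := proj_ortho_id DU.
  have -> : D = 1%:M - (1%:M - D) by rewrite opprB addrC subrK.
  by rewrite mulmxBl DUo mul1mx subr0.
by rewrite tr_diag_mx.
Qed.

End EigenProjector.

(** * Explicit coordinates of the clock states *)

Section ClockStates.
Context (R : realType) (q : nat) (e p : 'I_q.+1 -> R).
Hypothesis e0 : e ord0 = 0.
Hypothesis p_gt0 : forall j, 0 < p j.
Local Notation nc := (@Normc.normc R).

(** p_{E,n} as a sum over words; collecting words with equal occupation numbers gives the
    multinomial weights. *)
Definition spec_prob n (E : R) : R :=
  \sum_(w : {ffun 'I_n -> 'I_q.+1} | word_energy e w == E) word_prob p w.

Lemma sum_word n (V : nmodType) (F : {ffun 'I_n -> 'I_q.+1} -> V) (P : pred _) :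
  \sum_(a < tdim q n | P (word a)) F (word a) = \sum_(w | P w) F w.
Proof. by rewrite (reindex (@word q n))//; exact/onW_bij/enum_val_bij. Qed.

Lemma word_inj n : injective (@word q n).
Proof. exact: enum_val_inj. Qed.

Local Opaque tdim word.

Lemma word_prob_gt0 n (w : {ffun 'I_n -> 'I_q.+1}) : 0 < word_prob p w.
Proof. exact: prodr_gt0. Qed.

Lemma total_hamE n : total_ham e n = diag_mx (\row_a (word_energy e (word a))%:C).
Proof.
apply/matrixP => a b; rewrite summxE !mxE.
under eq_bigr do rewrite mxE.
case: (eqVneq a b) => [<-|ab].
  rewrite mulr1n /word_energy rmorph_sum; apply: eq_bigr => k _.
  rewrite (bigD1 k)//= eqxx !mxE eqxx mulr1n big1 ?mulr1// => l /negPf ->.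
  by rewrite mxE eqxx.
rewrite mulr0n big1// => k _.
have [l wl] : exists l, word a l != word b l.
  apply/existsP; rewrite -negb_forall; apply: contra ab => /forallP H.
  by apply/eqP/word_inj/ffunP => l; apply/eqP.
rewrite (bigD1 l)//=; case: ifP => _; rewrite !mxE (negPf wl) ?mulr0n mul0r//.
Qed.

Lemma tket_psi0 n a : tket n (psi0 p) a 0 = (Num.sqrt (word_prob p (word a)))%:C.
Proof.
rewrite mxE /word_prob.
transitivity (\prod_(l < n) (Num.sqrt (p (word a l)))%:C).
  by apply: eq_bigr => l _; rewrite mxE.
rewrite -rmorph_prod; congr (_%:C).
have H (s : seq 'I_n) : Num.sqrt (\prod_(l <- s) p (word a l)) =
    \prod_(l <- s) Num.sqrt (p (word a l)).
  elim: s => [|l s IH]; first by rewrite !big_nil sqrtr1.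
  by rewrite !big_cons sqrtrM ?IH// ltW.
by rewrite H.
Qed.

Lemma spec_prob_ge0 n E : 0 <= spec_prob n E.
Proof. by apply: sumr_ge0 => w _; rewrite ltW// word_prob_gt0. Qed.

Lemma spec_prob_gt0 n E : (E \in spectrum e n) = (0 < spec_prob n E).
Proof.
apply/(spectrumP e0)/idP => [[w wE]|].
  rewrite /spec_prob (bigD1 w)/=; last exact/eqP.
  rewrite ltr_pwDl ?word_prob_gt0// sumr_ge0// => v _.
  by rewrite ltW// word_prob_gt0.
move=> H; apply: contrapT => nw; move: H; rewrite /spec_prob big_pred0 ?ltxx// => w.
by apply/negP => /eqP wE; apply: nw; exists w.
Qed.

Definition energy_ket n (E : R) : 'cV[R[i]]_(tdim q n) :=
  \col_a (if word_energy e (word a) == E then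
     Num.sqrt (word_prob p (word a)) / Num.sqrt (spec_prob n E) else 0)%:C.

Lemma eketE n E : eket e p n E = energy_ket n E.
Proof.
rewrite /eket total_hamE eigenproj_diag.
set v := diag_mx _ *m _.
have vE b : v b 0 = (if word_energy e (word b) == E then
     Num.sqrt (word_prob p (word b)) else 0)%:C.
  rewrite /v mul_diag_mx mxE tket_psi0 !mxE (inj_eq (@complexI R)).
  by case: ifP => _; rewrite ?mul1r ?mul0r.
rewrite /normalize; have -> : complex.Re (inner v v) = spec_prob n E.
  rewrite innerE (big_morph _ (@ReD R) (erefl : complex.Re 0 = 0)) /spec_prob.
  rewrite -(sum_word (fun w => word_prob p w) (fun w => word_energy e w == E)).
  rewrite [RHS]big_mkcond/=; apply: eq_bigr => b _.
  rewrite vE conjc_real -rmorphM/=; case: ifP => _; last by rewrite mulr0.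
  by rewrite -expr2 sqr_sqrtr// ltW// word_prob_gt0.
apply/matrixP => a b; rewrite ord1 mxE vE -rmorphM [RHS]mxE; congr (_%:C).
by case: ifP => _; rewrite ?mulr0// mulrC.
Qed.

Lemma inner_energy_ket n E F : E \in spectrum e n ->
  inner (energy_ket n E) (energy_ket n F) = (E == F)%:R.
Proof.
rewrite spec_prob_gt0 => E0.
pose f (F : R) (b : 'I_(tdim q n)) : R := if word_energy e (word b) == F then
     Num.sqrt (word_prob p (word b)) / Num.sqrt (spec_prob n F) else 0.
have -> : inner (energy_ket n E) (energy_ket n F) = (\sum_b f E b * f F b)%:C.
  rewrite innerE [RHS]rmorph_sum; apply: eq_bigr => b _.
  by rewrite !mxE conjc_real [RHS]rmorphM.
rewrite /f; case: (eqVneq E F) => [<-|EF].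
  rewrite -[RHS]/((1 : R)%:C); congr (_%:C).
  have s0 : Num.sqrt (spec_prob n E) != 0 by rewrite gt_eqF// sqrtr_gt0.
  transitivity (\sum_(a < tdim q n | word_energy e (word a) == E)
     word_prob p (word a) / spec_prob n E).
    rewrite [RHS]big_mkcond/=; apply: eq_bigr => b _.
    case: ifP => _; last by rewrite mulr0.
    rewrite -[in RHS](sqr_sqrtr (ltW (word_prob_gt0 _))).
    by rewrite -[spec_prob _ _ in RHS](sqr_sqrtr (ltW E0)); field.
  rewrite -mulr_suml (sum_word (fun w => word_prob p w) (fun w => word_energy e w == E)).
  by rewrite mulfV// gt_eqF.
rewrite big1 ?rmorph0// => b _.
case: eqP => [->|_]; last by rewrite mul0r.
by rewrite (negPf EF) mulr0.
Qed.

(** Clock, filtered, estimate and Fourier states all have this form, so every overlap comes from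
    [inner_cstate]. *)
Definition cstate n (amp : R -> R) (t : R) : 'cV[R[i]]_(tdim q n) :=
  \sum_(E <- spectrum e n) (expi (- (E * t)) * (amp E)%:C) *: energy_ket n E.

Lemma estimateE m phat s :
  estimate e p m phat s = cstate m (fun E => Num.sqrt (phat E)) s.
Proof. by rewrite /estimate /cstate; apply: eq_bigr => E _; rewrite eketE. Qed.

Lemma inner_ket_cstate n amp t E : E \in spectrum e n ->
  inner (energy_ket n E) (cstate n amp t) = expi (- (E * t)) * (amp E)%:C.
Proof.
move=> ES; rewrite /cstate inner_sumr (bigD1_seq E)//= ?fset_uniq//.
rewrite innerZr inner_energy_ket// eqxx mulr1 big1 ?addr0// => F FE.
by rewrite innerZr inner_energy_ket// eq_sym (negPf FE) mulr0.
Qed.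

Lemma inner_cstate n a b s t : inner (cstate n a s) (cstate n b t) =
  \sum_(E <- spectrum e n) (a E * b E)%:C * expi (E * (s - t)).
Proof.
rewrite {1}/cstate inner_suml big_seq [RHS]big_seq; apply: eq_bigr => E ES.
rewrite innerZl inner_ket_cstate// conjc_mul conjc_real -expiN opprK.
rewrite mulrACA -expiD -rmorphM mulrC; congr (_ * expi _); ring.
Qed.

Lemma Psi_entry n t a : Psi e p n t a 0 =
  expi (- (word_energy e (word a) * t)) * (Num.sqrt (word_prob p (word a)))%:C.
Proof.
rewrite -tket_psi0 !mxE /psi /evol.
under eq_bigr do rewrite mul_diag_mx mxE [in X in X * _]mxE.
rewrite big_split/= -expi_sum; congr (expi _ * _).
by rewrite /word_energy mulr_suml -sumrN; apply: eq_bigr => l _; rewrite mulrC.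
Qed.

Lemma PsiE n t : Psi e p n t = cstate n (fun E => Num.sqrt (spec_prob n E)) t.
Proof.
apply/matrixP => a b; rewrite ord1 Psi_entry /cstate summxE.
have WS : word_energy e (word a) \in spectrum e n.
  by apply/(spectrumP e0); exists (word a).
rewrite (bigD1_seq _ WS)/= ?fset_uniq// big1 ?addr0 => [|E EW].
  rewrite !mxE eqxx -mulrA -rmorphM; congr (_ * _%:C).
  rewrite mulrC divfK// gt_eqF// sqrtr_gt0 -spec_prob_gt0//.
by rewrite !mxE eq_sym (negPf EW) rmorph0 mulr0.
Qed.

Lemma filter_cstate n f amp t : filter_op e p n f *m cstate n amp t =
  cstate n (fun E => f E * amp E) t.
Proof.
rewrite /filter_op mulmx_suml {2}/cstate big_seq [RHS]big_seq; apply: eq_bigr => E ES.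
rewrite eketE -scalemxAl ketbraE inner_ket_cstate// scalerA; congr (_ *: _).
by rewrite rmorphM mulrCA.
Qed.

Lemma psuccE n f t :
  psucc e p n f t = \sum_(E <- spectrum e n) f E * spec_prob n E.
Proof.
rewrite /psucc /expect PsiE filter_cstate inner_cstate.
rewrite (big_morph _ (@ReD R) (erefl : complex.Re 0 = 0)); apply: eq_bigr => E _.
rewrite subrr mulr0 expi0 mulr1 /= mulrCA -expr2 sqr_sqrtr//.
exact: spec_prob_ge0.
Qed.

Definition filter_amp n f (E : R) : R :=
  (Num.sqrt (psucc e p n f 0))^-1 * (Num.sqrt (f E) * Num.sqrt (spec_prob n E)).

Lemma filteredE n f t : filtered e p n f t = cstate n (filter_amp n f) t.
Proof.
rewrite /filtered /sqrt_filter_op PsiE filter_cstate /cstate scaler_sumr.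
apply: eq_bigr => E _; rewrite scalerA; congr (_ *: _).
by rewrite /filter_amp !psuccE [in RHS]rmorphM mulrCA.
Qed.

Lemma filter_amp_sqr n f : is_filter e p n f ->
  \sum_(E <- spectrum e n) filter_amp n f E ^+ 2 = 1.
Proof.
move=> [f01 /(_ 0) p0]; rewrite big_seq.
under eq_bigr => E ES.
  have [f0 _] := andP (f01 E ES).
  rewrite /filter_amp !exprMn exprVn !sqr_sqrtr ?spec_prob_ge0 ?(ltW p0)//.
  over.
by rewrite -big_seq -mulr_sumr -(psuccE n f 0) mulVf// gt_eqF.
Qed.

End ClockStates.

(** * Upper bounds *)

Section CompletePositivity.
Context {R : realType}.

Lemma inner_mxcol k N (u v : 'I_k -> 'cV[R[i]]_N) :
  inner (\mxcol_i u i) (\mxcol_i v i) = \sum_i inner (u i) (v i).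
Proof.
rewrite /inner tr_mxcol.
have -> : map_mx Num.conj (\mxrow_i (u i)^T) = \mxrow_i ((u i)^t*).
  by apply/matrixP => a b; rewrite !mxE.
by rewrite mul_mxrow_mxcol summxE.
Qed.

Lemma inner_mxblock k N (X : 'I_k -> 'I_k -> 'M[R[i]]_N) (u : 'I_k -> 'cV[R[i]]_N) :
  inner (\mxcol_i u i) (\mxblock_(i, j) X i j *m \mxcol_i u i) =
  \sum_i \sum_j inner (u i) (X i j *m u j).
Proof.
rewrite mul_mxblock_mxrow inner_mxcol; apply: eq_bigr => i _.
by rewrite inner_sumr.
Qed.

Lemma psd_mxblockP k N (X : 'I_k -> 'I_k -> 'M[R[i]]_N) :
  psd (\mxblock_(i, j) X i j) <->
  forall u : 'I_k -> 'cV[R[i]]_N, 0 <= \sum_i \sum_j inner (u i) (X i j *m u j).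
Proof.
split=> [H u|H v]; first by rewrite -inner_mxblock.
by rewrite -(submxcolK v) inner_mxblock.
Qed.

Lemma completely_positive_psd N N' (D : 'M[R[i]]_N -> 'M[R[i]]_N') X :
  completely_positive D -> psd X -> psd (D X).
Proof.
move=> Dcp Xp; have H : psd (\mxblock_(i < 1, j < 1) X).
  by apply/(psd_mxblockP (fun _ _ => X)) => u; rewrite !big_ord1; exact: Xp.
have /(psd_mxblockP (fun _ _ => D X)) {}H := Dcp 1%N (fun _ _ => X) H.
by move=> v; have := H (fun=> v); rewrite !big_ord1.
Qed.

End CompletePositivity.

Section Upper.
Context (R : realType) (q : nat) (e p : 'I_q.+1 -> R).
Hypothesis e0 : e ord0 = 0.
Hypothesis p_gt0 : forall j, 0 < p j.
Local Notation nc := (@Normc.normc R).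
Context (n m : nat) (B : R).
Hypothesis B_ub : forall E, E \in spectrum e m -> spec_prob e p m E <= B.

Let N := #|` spectrum e n|.

Let B_ge0 : 0 <= B.
Proof.
have S : word_energy e [ffun _ : 'I_m => ord0] \in spectrum e m.
  by apply/(spectrumP e0); eexists.
by rewrite (le_trans _ (B_ub S))// spec_prob_ge0.
Qed.

Lemma exists_le_mean (L : nat) (v : nat -> R) x : (0 < L)%N ->
  \sum_(k < L) v k <= L%:R * x -> exists2 k, (k < L)%N & v k <= x.
Proof.
move=> L0 H; apply: contrapT => nv; move: H; apply/negP; rewrite -ltNge.
have {}nv (k : 'I_L) : x < v k.
  by rewrite ltNge; apply/negP => vx; apply: nv; exists k.
rewrite mulr_natl -[L in x *+ L]card_ord -sumr_const.
case: L L0 nv => // L _ nv; rewrite !big_ord_recl ltr_leD//.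
by apply: ler_sum => i _; rewrite ltW.
Qed.

Lemma bessel k (v : 'cV[R[i]]_(tdim q k)) :
  \sum_(E <- spectrum e k) nc (inner (energy_ket e p k E) v) ^+ 2 <=
  complex.Re (inner v v).
Proof.
pose a E := inner (energy_ket e p k E) v.
pose u := \sum_(E <- spectrum e k) a E *: energy_ket e p k E.
have uE E : E \in spectrum e k -> inner (energy_ket e p k E) u = a E.
  move=> ES; rewrite /u inner_sumr (bigD1_seq E)//= ?fset_uniq//.
  rewrite innerZr inner_energy_ket// eqxx mulr1 big1 ?addr0// => F FE.
  by rewrite innerZr inner_energy_ket// eq_sym (negPf FE) mulr0.
have uu : inner u u = (\sum_(E <- spectrum e k) nc (a E) ^+ 2)%:C.
  rewrite {1}/u inner_suml rmorph_sum big_seq [RHS]big_seq; apply: eq_bigr => E ES.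
  by rewrite innerZl uE// mulrC mulcJ_real.
have uv : inner u v = (\sum_(E <- spectrum e k) nc (a E) ^+ 2)%:C.
  rewrite {1}/u inner_suml rmorph_sum; apply: eq_bigr => E _.
  by rewrite innerZl -/(a E) mulrC mulcJ_real.
have vu : inner v u = (\sum_(E <- spectrum e k) nc (a E) ^+ 2)%:C.
  by rewrite innerC uv conjc_real.
have : 0 <= inner (v - u) (1%:M *m (v - u)).
  rewrite mul1mx innerE sumr_ge0// => b _; rewrite mulrC; exact: mulcJ_ge0.
have Nr x y z : inner z (x - y) = inner z x - inner z y :> R[i].
  by rewrite -scaleN1r innerDr innerZr mulN1r.
have conjcB_ (x y : R[i]) : (x - y)^*%C = x^*%C - y^*%C by exact: rmorphB.
have Nl x y z : inner (x - y) z = inner x z - inner y z :> R[i].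
  by rewrite innerC Nr conjcB_ -!innerC.
rewrite mul1mx Nl !Nr uu uv vu subrr subr0 lecE => /andP[_].
by rewrite ReD /= -/(a _) subr_ge0.
Qed.

(** The time average of the output state is, up to a small error, diagonal in the energy kets with
    entries at most [B]; Bessel's inequality then bounds it by [B] times the trace, and some time
    does no worse than the average. *)
Lemma mean_expect_Psi (Q : 'M[R[i]]_(tdim q m)) d : psd Q -> 0 < d ->
  exists t, expect (Psi e p m t) Q <= B * complex.Re (\tr Q) + d.
Proof.
move=> /psd_decomposition[b ->] d0.
pose c j E : R[i] := (Num.sqrt (spec_prob e p m E))%:C * inner (b j) (energy_ket e p m E).
pose M := \sum_j (\sum_(E <- spectrum e m) nc (c j E)) ^+ 2.
have M0 : 0 <= M by apply: sumr_ge0 => j _; exact: sqr_ge0.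
(* [M] collects the squared coefficient sums by which [mean_square] multiplies its error. *)
have d'0 : 0 < d / (M + 1) by rewrite divr_gt0//; lra.
have [tau [L L0 H]] := mean_expi_small
  [seq - E - - F | E <- spectrum e m, F <- spectrum e m] d'0.
suff [k _ Hk] : exists2 k : nat, (k < L)%N & expect (Psi e p m (tau * k%:R)) (\sum_j ketbra (b j)) <=
    B * complex.Re (\tr (\sum_j ketbra (b j))) + d by eexists; exact: Hk.
apply: exists_le_mean L0 _.
have bP j k : inner (b j) (Psi e p m (tau * k%:R)) =
    \sum_(E <- spectrum e m) c j E * expi (- E * (tau * k%:R - 0)).
  rewrite PsiE// /cstate inner_sumr; apply: eq_bigr => E _.
  by rewrite innerZr subr0 mulNr -mulrA mulrC.
under eq_bigr => k _.
  rewrite expect_sum; under eq_bigr do rewrite expect_ketbra bP.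
  over.
rewrite exchange_big/=.
apply: (@le_trans _ _ (\sum_j (L%:R * (B * complex.Re (inner (b j) (b j))) +
   d / (M + 1) * L%:R * (\sum_(E <- spectrum e m) nc (c j E)) ^+ 2))).
  apply: ler_sum => j _.
  have HS E F : E \in spectrum e m -> F \in spectrum e m -> - E - - F != 0 ->
      nc (\sum_(k < L) expi ((- E - - F) * (tau * k%:R))) <= d / (M + 1) * L%:R.
    by move=> ES FS; apply: H; apply/allpairsP; exists (E, F).
  have := le_trans (ler_norm _) (mean_square (c j) 0 d'0 HS).
  rewrite lerBlDl => /le_trans; apply.
  rewrite lerD2r ler_wpM2l//.
  apply: (@le_trans _ _ (\sum_(E <- spectrum e m) B * nc (inner (energy_ket e p m E) (b j)) ^+ 2)).
    rewrite big_seq [leRHS]big_seq; apply: ler_sum => E ES.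
    rewrite (bigD1_seq E)//= ?fset_uniq// eqxx big1 ?addr0; last first.
      by move=> F FE; rewrite eqr_opp eq_sym (negPf FE).
    rewrite mulcJ_real /= /c Normc.normcM normc_real exprMn real_normK ?num_real//.
    rewrite sqr_sqrtr ?spec_prob_ge0// [inner (b j) _]innerC normcJ2.
    by rewrite ler_wpM2r ?sqr_ge0// B_ub.
  by rewrite -mulr_sumr ler_wpM2l// bessel.
rewrite big_split/= -!mulr_sumr -/M mulrDr.
have -> : complex.Re (\tr (\sum_j ketbra (b j))) =
    \sum_j complex.Re (inner (b j) (b j)).
  have -> : \tr (\sum_j ketbra (b j)) = \sum_j \tr (ketbra (b j)) by exact: raddf_sum.
  rewrite (big_morph _ (@ReD R) (erefl : complex.Re 0 = 0)).
  apply: eq_bigr => j _; congr complex.Re.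
  by rewrite /ketbra mxtrace_mulC /mxtrace big_ord1.
have -> : d / (M + 1) * L%:R * M = L%:R * (d * M / (M + 1)) by ring.
rewrite lerD2l ler_wpM2l// ler_pdivrMr; last by lra.
by rewrite ler_wpM2l ?(ltW d0)//; lra.
Qed.

Let ket E := energy_ket e p n E.

Lemma filtered_unit_sum f t : is_filter e p n f ->
  let c E := expi (- (E * t)) * (filter_amp e p n f E)%:C in
  filtered e p n f t = \sum_(E <- spectrum e n) c E *: ket E /\
  \sum_(E <- spectrum e n) (c E)^*%C * c E = 1.
Proof.
move=> Ff c; split; first by rewrite filteredE.
have := filter_amp_sqr e0 p_gt0 Ff => /(congr1 (real_complex R)).
rewrite rmorph_sum rmorph1 => <-; apply: eq_bigr => E _.
rewrite mulrC mulcJ_real /c Normc.normcM normc_expi mul1r normc_real.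
by rewrite real_normK ?num_real.
Qed.

(** By [lagrange_ketbra] and positivity, the image of the filtered state is dominated by [Q], the
    image of the projector onto the energy kets. [Q] is independent of [t] and has trace N because
    the channel preserves traces. *)
Lemma cloning_fidelity_le : (cloning_fidelity e p n m <= (N%:R * B)%:E)%E.
Proof.
apply: ge_ereal_sup => _ [f Ff <-]; apply: ge_ereal_sup => _ [D [Dcp Dtp ->]].
apply/lee_addgt0Pr => d d0.
pose Q := \sum_(E <- spectrum e n) D (ketbra (ket E)).
have Qp : psd Q.
  by apply: psd_sum => E _; apply: completely_positive_psd => //; exact: psd_ketbra.
have trQ : complex.Re (\tr Q) = N%:R.
  have -> : \tr Q = \sum_(E <- spectrum e n) \tr (D (ketbra (ket E))) by exact: raddf_sum.
  rewrite big_seq.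
  under eq_bigr => E ES.
    rewrite [\tr _]Dtp -[ketbra _]mul1mx -expect_trace mul1mx inner_energy_ket// eqxx.
    over.
  rewrite -big_seq big_const_seq count_predT iter_addr addr0 /N.
  have Ren k : complex.Re (k%:R : R[i]) = k%:R by rewrite -(rmorph_nat (real_complex R)).
  exact: Ren.
have [t Ht] := mean_expect_Psi Qp d0.
apply: (@le_trans _ _ (expect (Psi e p m t) (D (ketbra (filtered e p n f t))))%:E).
  by apply: ereal_inf_lbound; exists t.
rewrite -EFinD lee_fin; apply: (@le_trans _ _ (expect (Psi e p m t) Q)); last first.
  by rewrite (le_trans Ht)// trQ mulrC.
have [-> c1] := filtered_unit_sum t Ff.
have := lagrange_ketbra ket c1; set K := ketbra (\sum_(E <- _) _) => LK.
have Kp : 0 <= expect (Psi e p m t) (D ((\sum_(E <- spectrum e n) ketbra (ket E) - K) *+ 2)).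
  apply: psd_expect; apply: completely_positive_psd => //; rewrite -LK.
  by apply: psd_sum => E _; apply: psd_sum => F _; exact: psd_ketbra.
move: Kp; rewrite mulr2n linearD expectD linearB/= linear_sum -/Q -scaleN1r expectD.
have -> : -1 = (-1 : R)%:C :> R[i] by rewrite rmorphN rmorph1.
rewrite expectZ; lra.
Qed.

End Upper.

(** * The upper bound for metrology *)

Section MetrologyOverlap.
Context (R : realType) (q : nat) (e p : 'I_q.+1 -> R).
Hypothesis e0 : e ord0 = 0.
Hypothesis p_gt0 : forall j, 0 < p j.
Local Notation nc := (@Normc.normc R).

Definition overlap m (phat : R -> R) (t s : R) : R :=
  complex.Re (`|inner (estimate e p m phat s) (Psi e p m t)| ^+ 2).

Lemma overlapE m phat t s : overlap m phat t s =
  nc (\sum_(E <- spectrum e m)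
    (Num.sqrt (phat E) * Num.sqrt (spec_prob e p m E))%:C * expi (E * (s - t))) ^+ 2.
Proof.
rewrite /overlap estimateE// PsiE// inner_cstate//.
set z := \sum_(E <- _) _; rewrite normc_def -rmorphXn /=.
by case: z => x y.
Qed.

Lemma overlap_ge0 m phat t s : 0 <= overlap m phat t s.
Proof. by rewrite overlapE sqr_ge0. Qed.

Lemma measurable_overlap m phat t :
  measurable_fun setT (fun s : measurableTypeR R => overlap m phat t s).
Proof.
pose a E := Num.sqrt (phat E) * Num.sqrt (spec_prob e p m E).
have -> : (fun s : measurableTypeR R => overlap m phat t s) = (fun s : measurableTypeR R =>
    (\sum_(E <- spectrum e m) a E * cos (E * (s - t))) ^+ 2 +
    (\sum_(E <- spectrum e m) a E * sin (E * (s - t))) ^+ 2).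
  apply/funext => s; rewrite overlapE.
  have -> : \sum_(E <- spectrum e m) (a E)%:C * expi (E * (s - t)) =
    (\sum_(E <- spectrum e m) a E * cos (E * (s - t))) +i*
    (\sum_(E <- spectrum e m) a E * sin (E * (s - t))).
    elim/big_rec3 : _ => [//|E x y z _ ->].
    by rewrite /expi; apply/eqP; rewrite eq_complex/= !mul0r subr0 addr0 !eqxx.
  by rewrite /= sqr_sqrtr// addr_ge0 ?sqr_ge0.
have mlin E : measurable_fun setT (fun s : measurableTypeR R => E * (s - t)).
  apply: measurable_funM => //; apply: measurable_funB => //.
apply: measurable_funD; apply: measurable_funX; apply: measurable_sum => E;
  apply: measurable_funM => //.
- by apply: measurableT_comp (mlin E); apply: continuous_measurable_fun; exact: continuous_cos.
- by apply: measurableT_comp (mlin E); apply: continuous_measurable_fun; exact: continuous_sin.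
Qed.

Context (n m : nat) (B : R).
Hypothesis B_ub : forall E, E \in spectrum e m -> spec_prob e p m E <= B.

Let N := #|` spectrum e n|.

(** One progression of times serves all outcomes [s]; this uniformity allows integrating the bound
    over the outcomes. *)
Lemma mean_overlap phat d : is_spectral_distribution e m phat -> 0 < d ->
  exists tau, exists2 L : nat, (0 < L)%N & forall s,
    \sum_(k < L) overlap m phat (tau * k%:R) s <= L%:R * (B + d).
Proof.
move=> [phat0 phat1] d0.
pose a E := Num.sqrt (phat E) * Num.sqrt (spec_prob e p m E).
pose M := (\sum_(E <- spectrum e m) nc (a E)%:C) ^+ 2.
have M0 : 0 <= M by exact: sqr_ge0.
have d'0 : 0 < d / (M + 1) by rewrite divr_gt0//; lra.
have [tau [L L0 H]] := mean_expi_small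
  [seq - E - - F | E <- spectrum e m, F <- spectrum e m] d'0.
exists tau, L => // s.
have HS E F : E \in spectrum e m -> F \in spectrum e m -> - E - - F != 0 ->
    nc (\sum_(k < L) expi ((- E - - F) * (tau * k%:R))) <= d / (M + 1) * L%:R.
  by move=> ES FS; apply: H; apply/allpairsP; exists (E, F).
have := le_trans (ler_norm _) (mean_square (fun E => (a E)%:C) s d'0 HS).
rewrite lerBlDl.
have -> : \sum_(k < L) nc (\sum_(E <- spectrum e m)
     (a E)%:C * expi (- E * (tau * k%:R - s))) ^+ 2 =
   \sum_(k < L) overlap m phat (tau * k%:R) s.
  apply: eq_bigr => k _; rewrite overlapE; congr (nc _ ^+ 2).
  by apply: eq_bigr => E _; congr (_ * expi _); ring.
move=> /le_trans; apply; rewrite -/M mulrDr lerD//; last first.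
  have -> : d / (M + 1) * L%:R * M = L%:R * (d * M / (M + 1)) by ring.
  rewrite ler_wpM2l// ler_pdivrMr; last by lra.
  by rewrite ler_wpM2l ?(ltW d0)//; lra.
rewrite ler_wpM2l//.
apply: (@le_trans _ _ (\sum_(E <- spectrum e m) B * phat E)); last first.
  by rewrite -mulr_sumr phat1 mulr1.
rewrite big_seq [leRHS]big_seq; apply: ler_sum => E ES.
rewrite (bigD1_seq E)//= ?fset_uniq// eqxx big1 ?addr0; last first.
  by move=> F FE; rewrite eqr_opp eq_sym (negPf FE).
rewrite mul0r subr0 /a -expr2 exprMn !sqr_sqrtr ?spec_prob_ge0 ?phat0//.
by rewrite mulrC ler_wpM2r ?phat0// B_ub.
Qed.

Local Open Scope ereal_scope.

(** The domination used for cloning, now for outcome laws: the dominating measure has total mass N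
    and does not depend on [t]. *)
Lemma povm_law_filtered_le f t (M : povm R (tdim q n)) (A : set (measurableTypeR R)) :
  is_filter e p n f ->
  povm_law M (filtered e p n f t) A <=
  msum (fun k => povm_law M (energy_ket e p n (nth 0%R (spectrum e n) k))) N A.
Proof.
move=> Ff; have [-> c1] := filtered_unit_sum e0 p_gt0 t Ff.
have := lagrange_ketbra (energy_ket e p n) c1.
set v := (\sum_(E <- _) (_ *: energy_ket e p n _))%R => LK.
rewrite /msum /povm_law sumEFin lee_fin.
have -> : (\sum_(k < N) expect (energy_ket e p n (nth 0 (spectrum e n) k)) (M A) =
   \sum_(E <- spectrum e n) expect (energy_ket e p n E) (M A))%R.
  by rewrite (big_nth 0%R) big_mkord.
have [b bE] := psd_decomposition (povm_psd M A).
have eE (u : 'cV[R[i]]_(tdim q n)) :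
    expect u (M A) = complex.Re (\tr (M A *m ketbra u)).
  by rewrite /expect expect_trace.
have trD (X Y : 'M[R[i]]_(tdim q n)) : complex.Re (\tr (M A *m (X + Y))) =
   (complex.Re (\tr (M A *m X)) + complex.Re (\tr (M A *m Y)))%R.
  by rewrite mulmxDr mxtraceD ReD.
have trS (X : R -> 'M[R[i]]_(tdim q n)) : (complex.Re (\tr (M A *m \sum_(E <- spectrum e n) X E)) =
   \sum_(E <- spectrum e n) complex.Re (\tr (M A *m X E)))%R.
  apply: (big_morph (fun X => complex.Re (\tr (M A *m X))) trD).
  by rewrite mulmx0 mxtrace0.
have trN (X : 'M[R[i]]_(tdim q n)) : complex.Re (\tr (M A *m (- X))) =
   (- complex.Re (\tr (M A *m X)))%R.
  by apply/eqP; rewrite eq_sym -subr_eq0 -opprD oppr_eq0 -trD subrr mulmx0 mxtrace0.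
have : (0 <= complex.Re (\tr (M A *m ((\sum_(E <- spectrum e n) ketbra (energy_ket e p n E) - ketbra v) *+ 2))))%R.
  rewrite -LK trS sumr_ge0// => E _; rewrite trS sumr_ge0// => F _.
  by rewrite -eE psd_expect//; exact: povm_psd.
rewrite mulr2n !trD trN trS -eE.
under eq_bigr do rewrite -eE.
by set X := (\sum_(E <- _) _)%R; set Y := expect v _; lra.
Qed.

(** Against the fixed measure [nu] the sum over times passes under the integral, where
    [mean_overlap] bounds it pointwise. *)
Lemma metrology_fidelity_le : metrology_fidelity e p n m <= (N%:R * B)%:E.
Proof.
apply: ge_ereal_sup => _ [f Ff <-]; apply: ge_ereal_sup => _ [M [phat [phatD ->]]].
apply/lee_addgt0Pr => d d0.
pose nu := msum (fun k => povm_law M (energy_ket e p n (nth 0%R (spectrum e n) k))) N.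
have nuT : nu setT = N%:R%:E.
  rewrite /nu /msum /povm_law sumEFin; congr (_%:E).
  rewrite -[N in RHS]card_ord -sumr_const; apply: eq_bigr => k _.
  by rewrite povm_setT /expect mul1mx inner_energy_ket ?eqxx// mem_nth.
have d'0 : (0 < d / (N%:R + 1))%R by rewrite divr_gt0// ltr_wpDl.
have [tau [L L0 HL]] := mean_overlap phatD d'0.
pose v k := \int[nu]_(s in setT) (overlap m phat (tau * k%:R) s)%:E.
have v0 k : 0 <= v k by apply: integral_ge0 => s _; rewrite lee_fin overlap_ge0.
have vsum : \sum_(k < L) v k <= (L%:R * (B + d / (N%:R + 1)) * N%:R)%:E.
  rewrite -ge0_integral_sum//; first last.
  - by move=> k s _; rewrite lee_fin overlap_ge0.
  - by move=> k; apply/measurable_EFinP; exact: measurable_overlap.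
  apply: (@le_trans _ _ (\int[nu]_(s in setT) (cst (L%:R * (B + d / (N%:R + 1)))%:E s))).
    apply: ge0_le_integral => //.
    - by move=> s _; apply: sume_ge0 => k _; rewrite lee_fin overlap_ge0.
    - apply: emeasurable_sum => k; apply/measurable_EFinP; exact: measurable_overlap.
    - by move=> s _; rewrite /= sumEFin lee_fin HL.
  rewrite integral_cst// [X in _ * X](_ : _ = N%:R%:E)//.
have vfin k : (k < L)%N -> v k \is a fin_num.
  move=> kL; rewrite ge0_fin_numE// (le_lt_trans _ (ltry (L%:R * (B + d / (N%:R + 1)) * N%:R)%R))//.
  by apply: le_trans vsum; rewrite (bigD1 (Ordinal kL))//= leeDl// sume_ge0.
have [k kL Hk] : exists2 k, (k < L)%N & (fine (v k) <= N%:R * (B + d / (N%:R + 1)))%R.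
  apply: exists_le_mean L0 _; rewrite -lee_fin -sumEFin.
  apply: le_trans (_ : _ <= \sum_(k < L) v k) _.
    by rewrite le_eqVlt; apply/orP; left; apply/eqP; apply: eq_bigr => k _; rewrite fineK ?vfin.
  apply: (le_trans vsum); rewrite lee_fin; lra.
have {}Hk : v k <= (N%:R * (B + d / (N%:R + 1)))%:E.
  by rewrite -[v k]fineK ?vfin// lee_fin.
apply: (@le_trans _ _ (v k)).
  apply: (@le_trans _ _ (\int[povm_law M (filtered e p n f (tau * k%:R)%R)]_(s in setT)
      (overlap m phat (tau * k%:R) s)%:E)).
    by apply: ereal_inf_lbound; exists (tau * k%:R)%R.
  apply: ge0_le_measure_integral => //.
  - by move=> A _; exact: povm_law_filtered_le.
  - by move=> s; rewrite lee_fin overlap_ge0.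
  - by apply/measurable_EFinP; exact: measurable_overlap.
apply: (le_trans Hk); rewrite -EFinD lee_fin mulrDr lerD2l.
rewrite mulrCA ger_pMr// ler_pdivrMr ?mul1r ?ltr_wpDl//; lra.
Qed.

End MetrologyOverlap.

(** * Measure-and-prepare strategies *)

Section FinitePovm.
Context (R : realType) (N K : nat) (s : nat -> R) (M : nat -> 'M[R[i]]_N).
Hypothesis M_psd : forall k, psd (M k).
Hypothesis M_sum : \sum_(k < K) M k = 1%:M.

Definition finite_povm_op (A : set (measurableTypeR R)) : 'M[R[i]]_N :=
  \sum_(k < K) (\1_A (s k))%:C *: M k.

Let op_psd A : psd (finite_povm_op A).
Proof. by apply: psd_sum => k _; apply: psdZ. Qed.

Let op_set0 : finite_povm_op set0 = 0.
Proof. by apply: big1 => k _; rewrite indic0 scale0r. Qed.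

Let op_setT : finite_povm_op setT = 1%:M.
Proof. by rewrite -M_sum; apply: eq_bigr => k _; rewrite indicT scale1r. Qed.

Let weight v k : {nonneg R} := NngNum (psd_expect v (M_psd k)).

Let law v k : {measure set (measurableTypeR R) -> \bar R} :=
  mscale (weight v k) (@dirac _ (measurableTypeR R) (s k) R).

Let expect_op v : (fun A => (expect v (finite_povm_op A))%:E) = msum (law v) K.
Proof.
apply/funext => A; rewrite /msum /law /mscale /finite_povm_op expect_sum -sumEFin.
by apply: eq_bigr => k _; rewrite expectZ EFinM muleC.
Qed.

Let op_sigma_additive v :
  semi_sigma_additive (fun A => (expect v (finite_povm_op A))%:E).
Proof. by rewrite expect_op; exact: measure_semi_sigma_additive. Qed.

Definition finite_povm : povm R N := Povm op_psd op_set0 op_setT op_sigma_additive.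

Lemma integral_finite_povm v (G : R -> R) : (forall x, 0 <= G x) ->
  measurable_fun setT (G : measurableTypeR R -> R) ->
  (\int[povm_law finite_povm v]_(x in setT) (G x)%:E =
   (\sum_(k < K) expect v (M k) * G (s k))%:E)%E.
Proof.
move=> G0 mG; have mG' : measurable_fun setT (fun x : measurableTypeR R => (G x)%:E).
  exact/measurable_EFinP.
rewrite (eq_measure_integral (msum (law v) K)); last first.
  move=> A _ _.
  exact: (congr1 (fun h => h A) (expect_op v)).
rewrite ge0_integral_measure_sum//; last by move=> x _; rewrite lee_fin.
rewrite -sumEFin; apply: eq_bigr => k _.
rewrite ge0_integral_mscale//; last by move=> x _; rewrite lee_fin.
by rewrite integral_dirac// diracT mul1e -EFinM.
Qed.

End FinitePovm.

Section MeasureAndPrepare.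
Context (R : realType) (N N' K : nat) (M : nat -> 'M[R[i]]_N) (v : nat -> 'cV[R[i]]_N').
Hypothesis M_psd : forall k, psd (M k).
Hypothesis M_sum : \sum_(k < K) M k = 1%:M.
Hypothesis v_unit : forall k, inner (v k) (v k) = 1.

Definition measure_prepare (X : 'M[R[i]]_N) : 'M[R[i]]_N' :=
  \sum_(k < K) \tr (M k *m X) *: ketbra (v k).

Let measure_prepare_linear : linear (measure_prepare).
Proof.
move=> a X Y; rewrite /measure_prepare scaler_sumr -big_split/=.
apply: eq_bigr => k _.
by rewrite mulmxDr mxtraceD -scalemxAr mxtraceZ scalerDl scalerA.
Qed.

HB.instance Definition _ := GRing.isLinear.Build R[i] 'M[R[i]]_N 'M[R[i]]_N' _
  (measure_prepare) measure_prepare_linear.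

Definition measure_prepare_map : {linear 'M[R[i]]_N -> 'M[R[i]]_N'} := measure_prepare.

Lemma measure_prepare_tp : trace_preserving measure_prepare_map.
Proof.
move=> X; rewrite /measure_prepare_map/= /measure_prepare.
have -> : \tr (\sum_(k < K) \tr (M k *m X) *: ketbra (v k)) =
    \sum_(k < K) \tr (\tr (M k *m X) *: ketbra (v k)) by exact: raddf_sum.
have -> : \tr X = \sum_(k < K) \tr (M k *m X).
  by rewrite -[X in LHS]mul1mx -M_sum mulmx_suml; exact: raddf_sum.
apply: eq_bigr => k _; rewrite mxtraceZ -[ketbra _]mul1mx -expect_trace.
by rewrite mul1mx v_unit mulr1.
Qed.

(** Splitting each effect into rank-one pieces turns the block form of the output into block forms
    of the input at the vectors [z i *: b a]. *)
Lemma measure_prepare_cp : completely_positive measure_prepare_map.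
Proof.
move=> k X /psd_mxblockP Xp; apply/(psd_mxblockP (fun i j => measure_prepare_map (X i j))) => u.
rewrite /measure_prepare_map/= /measure_prepare.
have -> : \sum_i \sum_j inner (u i) ((\sum_(l < K) \tr (M l *m X i j) *: ketbra (v l)) *m u j)
  = \sum_(l < K) \sum_i \sum_j \tr (M l *m X i j) * inner (u i) (ketbra (v l) *m u j).
  rewrite [RHS]exchange_big/=; apply: eq_bigr => i _.
  rewrite [RHS]exchange_big/=; apply: eq_bigr => j _.
  by rewrite mulmx_suml inner_sumr; apply: eq_bigr => l _; rewrite -scalemxAl innerZr.
apply: sumr_ge0 => l _.
have [b ->] := psd_decomposition (M_psd l).
pose z j := inner (v l) (u j).
have -> : \sum_i \sum_j \tr ((\sum_a ketbra (b a)) *m X i j) * inner (u i) (ketbra (v l) *m u j)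
  = \sum_a \sum_i \sum_j inner (z i *: b a) (X i j *m (z j *: b a)).
  rewrite [RHS]exchange_big/=; apply: eq_bigr => i _.
  rewrite [RHS]exchange_big/=; apply: eq_bigr => j _.
  rewrite mulmx_suml.
  have -> : \tr (\sum_a ketbra (b a) *m X i j) = \sum_a \tr (ketbra (b a) *m X i j).
    exact: raddf_sum.
  rewrite mulr_suml; apply: eq_bigr => a _.
  rewrite mxtrace_mulC -expect_trace inner_ketbra innerZl -scalemxAr innerZr.
  by rewrite -/(z j) [inner (u i) _]innerC -/(z i); ring.
by apply: sumr_ge0 => a _; exact: Xp.
Qed.

Lemma expect_measure_prepare u w :
  expect u (measure_prepare_map (ketbra w)) =
  \sum_(k < K) expect w (M k) * Normc.normc (inner (v k) u) ^+ 2.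
Proof.
rewrite /measure_prepare_map/= /measure_prepare expect_sum; apply: eq_bigr => k _.
rewrite -expect_trace -expect_ketbra -expectZ; congr (expect _ (_ *: _)).
have := M_psd k w; rewrite lecE => /andP[/eqP i0 _].
by rewrite /expect; case: (inner _ _) i0 => x y /= ->.
Qed.

End MeasureAndPrepare.

Lemma povm_weight_bound (R : realType) (a l N x y : R) :
  0 <= a -> 0 <= l -> y <= N * x -> l * x + a * l * y <= l * ((1 + N * a) * x).
Proof. by move=> a0 l0 /(ler_wpM2l (mulr_ge0 a0 l0)); lra. Qed.

(** Dividing by [1 + N * a], the price of a genuine POVM, and losing [a * s] in the mean square cost
    at most [d] together. *)
Lemma strategy_value_bound (R : realType) (a d N s v : R) :
  0 <= a -> 0 <= d -> 0 <= N -> a * (s + N * v + 1) = d ->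
  (v - d) * (1 + N * a) <= v - a * s.
Proof.
move=> a0 d0 N0 H; have := mulr_ge0 (mulr_ge0 N0 a0) d0; nra.
Qed.

(** * A strategy for flat input amplitudes *)

Section Lower.
Context (R : realType) (q : nat) (e p : 'I_q.+1 -> R).
Hypothesis e0 : e ord0 = 0.
Hypothesis p_gt0 : forall j, 0 < p j.
Local Notation nc := (@Normc.normc R).
Context (n m : nat) (phat : R -> R).
Hypothesis phatD : is_spectral_distribution e m phat.

Let N := #|` spectrum e n|.
Let ket E := energy_ket e p n E.

Let N_gt0 : (0 < N)%N.
Proof. exact: spectrum_gt0. Qed.

Let pmin : R := (\sum_(E <- spectrum e n) (spec_prob e p n E)^-1)^-1.

Let pmin_gt0 : 0 < pmin.
Proof.
rewrite invr_gt0; move: N_gt0; rewrite cardfs_gt0 => /fset0Pn[E ES].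
rewrite (bigD1_seq E)//= ?fset_uniq// ltr_pwDl//.
  by rewrite invr_gt0 -spec_prob_gt0.
by rewrite sumr_ge0// => F _; rewrite invr_ge0 spec_prob_ge0.
Qed.

Let pmin_le E : E \in spectrum e n -> pmin <= spec_prob e p n E.
Proof.
move=> ES; have E0 : 0 < spec_prob e p n E by rewrite -spec_prob_gt0.
rewrite -[leRHS]invrK lef_pV2 ?posrE ?invr_gt0//; last first.
  by move: pmin_gt0; rewrite invr_gt0.
rewrite (bigD1_seq E)//= ?fset_uniq// lerDl sumr_ge0// => F _.
by rewrite invr_ge0 spec_prob_ge0.
Qed.

(** Weights inversely proportional to the probabilities make the filtered amplitudes equal; [pmin]
    keeps them at most 1. *)
Let flt E := pmin / spec_prob e p n E.

Let psucc_flt t : psucc e p n flt t = N%:R * pmin.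
Proof.
rewrite psuccE// big_seq.
under eq_bigr => E ES.
  rewrite /flt divfK; last by rewrite gt_eqF// -spec_prob_gt0.
  over.
by rewrite -big_seq big_const_seq count_predT iter_addr addr0 mulr_natl.
Qed.

Let flt_filter : is_filter e p n flt.
Proof.
split=> [E ES|t]; last by rewrite psucc_flt mulr_gt0// ltr0n.
have E0 : 0 < spec_prob e p n E by rewrite -spec_prob_gt0.
by rewrite /flt divr_ge0 ?(ltW pmin_gt0) ?(ltW E0)//= ler_pdivrMr// mul1r pmin_le.
Qed.

Let amp : R := (Num.sqrt N%:R)^-1.

Let filtered_flt t : filtered e p n flt t = cstate e p n (fun=> amp) t.
Proof.
rewrite filteredE// /cstate big_seq [RHS]big_seq; apply: eq_bigr => E ES.
congr ((_ * _%:C) *: _); rewrite /filter_amp psucc_flt.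
have E0 : 0 < spec_prob e p n E by rewrite -spec_prob_gt0.
rewrite -sqrtrM; last by rewrite /flt divr_ge0 ?(ltW pmin_gt0) ?(ltW E0).
rewrite /flt divfK ?gt_eqF// sqrtrM ?ler0n// invfM mulrAC -mulrA mulfV ?mulr1//.
by rewrite gt_eqF// sqrtr_gt0.
Qed.

Let b F := Num.sqrt (phat F) * Num.sqrt (spec_prob e p m F).

(** Input energy and output energy: the product of the two amplitudes oscillates with frequency
    [E + F]. *)
Let pairs := [seq (E, F) | E <- spectrum e n, F <- spectrum e m].

(* The fidelity reached, up to an arbitrarily small error, by the filter [flt],
   which makes all input energies equally likely. *)
Definition overlap_mass : R := N%:R^-1 *
  \sum_(x <- pairs) \sum_(y <- pairs)
    (if x.1 + x.2 == y.1 + y.2 then b x.2 * b y.2 else 0).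

Let V := overlap_mass.

Let b_ge0 F : 0 <= b F. Proof. by rewrite mulr_ge0 ?sqrtr_ge0. Qed.

Let V_ge0 : 0 <= V.
Proof.
rewrite mulr_ge0 ?invr_ge0// sumr_ge0// => x _; rewrite sumr_ge0// => y _.
by case: ifP => // _; rewrite mulr_ge0.
Qed.

(** The Fourier states are nearly a tight frame of the span of the energy kets. With the weight
    [kap / L] their sum stays below the identity, so the remainder is positive, and the mean square
    of the joint amplitude gives the score uniformly in [t]. *)
Let weighted_strategy d : 0 < d -> exists K (s : nat -> R) (M : nat -> 'M[R[i]]_(tdim q n)),
  [/\ forall k, psd (M k), \sum_(k < K) M k = 1%:M &
   forall t, V - d <= \sum_(k < K) expect (filtered e p n flt t) (M k) * overlap e p m phat t (s k)].
Proof.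
move=> d0.
pose S := (\sum_(x <- pairs) nc (amp * b x.2)%:C) ^+ 2.
have S0 : 0 <= S by exact: sqr_ge0.
have [d' d'0 d'D] : exists2 d', 0 < d' & d' * (S + N%:R * V + 1) = d.
  have D0 : 0 < S + N%:R * V + 1 by rewrite ltr_wpDl// addr_ge0// mulr_ge0.
  by exists (d / (S + N%:R * V + 1)); rewrite ?divr_gt0// divfK// gt_eqF.
(* The first frequencies serve the positivity of the remainder, the second ones the score. *)
have [tau [L L0 H]] := mean_expi_small
  ([seq E - F | E <- spectrum e n, F <- spectrum e n] ++
   [seq (x.1 + x.2) - (y.1 + y.2) | x <- pairs, y <- pairs]) d'0.
pose kap : R := (1 + N%:R * d')^-1.
have kap1 : 0 < 1 + N%:R * d' by rewrite ltr_wpDr// mulr_ge0// ltW.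
have kap0 : 0 < kap by rewrite invr_gt0.
have LR0 : 0 < L%:R :> R by rewrite ltr0n.
pose eta k := cstate e p n (fun=> 1) (tau * k%:R).
pose wt : R := kap / L%:R.
have wt0 : 0 < wt by rewrite divr_gt0.
pose rest : 'M[R[i]]_(tdim q n) := 1%:M - \sum_(k < L) wt%:C *: ketbra (eta k).
have eta_inner k v : inner (eta k) v =
    \sum_(E <- spectrum e n) inner (ket E) v * expi (E * (tau * k%:R - 0)).
  rewrite /eta /cstate inner_suml; apply: eq_bigr => E _.
  by rewrite innerZl mulr1 -expiN opprK subr0 mulrC.
have rest_psd : psd rest.
  move=> v; rewrite /rest mulmxBl mul1mx -scaleN1r innerDr innerZr mulN1r.
  rewrite mulmx_suml inner_sumr.
  have -> : \sum_(k < L) inner v (wt%:C *: ketbra (eta k) *m v) =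
      (wt * \sum_(k < L) nc (inner (eta k) v) ^+ 2)%:C.
    rewrite mulr_sumr rmorph_sum; apply: eq_bigr => k _.
    by rewrite -scalemxAl innerZr inner_ketbra [inner v _]innerC mulcJ_real -rmorphM.
  have -> : inner v v = (complex.Re (inner v v))%:C.
    rewrite innerE (big_morph _ (@ReD R) (erefl : complex.Re 0 = 0)) rmorph_sum.
    by apply: eq_bigr => a _; rewrite mulrC mulcJ_real.
  rewrite -rmorphB ler0c subr_ge0.
  have HS E F : E \in spectrum e n -> F \in spectrum e n -> E - F != 0 ->
      nc (\sum_(k < L) expi ((E - F) * (tau * k%:R))) <= d' * L%:R.
    move=> ES FS; apply: H; rewrite mem_cat; apply/orP; left.
    by apply/allpairsP; exists (E, F).
  have := le_trans (ler_norm _) (mean_square (fun E => inner (ket E) v) 0 d'0 HS).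
  under eq_bigr do rewrite -eta_inner.
  rewrite lerBlDl => MS.
  rewrite /wt mulrAC ler_pdivrMr// mulrC -ler_pdivlMr// invrK.
  apply: (le_trans MS); set X := \sum_(E <- spectrum e n) nc (inner (ket E) v) ^+ 2.
  have XB : X <= complex.Re (inner v v) by exact: bessel.
  have X0 : 0 <= X by apply: sumr_ge0 => E _; exact: sqr_ge0.
  have -> : \sum_(i <- spectrum e n) \sum_(j <- spectrum e n)
     (if i == j then complex.Re (inner (ket i) v * (inner (ket j) v)^*%C) else 0) = X.
    rewrite /X big_seq [RHS]big_seq; apply: eq_bigr => E ES.
    rewrite (bigD1_seq E)//= ?fset_uniq// eqxx big1 ?addr0; last first.
      by move=> F FE; rewrite eq_sym (negPf FE).
    by rewrite normcE2.
  have X2 : (\sum_(E <- spectrum e n) nc (inner (ket E) v)) ^+ 2 <= N%:R * X.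
    rewrite /X !(big_nth (0 : R)) !big_mkord.
    have := sqr_sum_le (fun k : 'I_N => nc (inner (ket (nth 0 (spectrum e n) k)) v)).
    by rewrite card_ord.
  apply: (@le_trans _ _ (L%:R * ((1 + N%:R * d') * X))).
    by apply: (povm_weight_bound (ltW d'0) (ltW LR0) X2).
  by rewrite [leRHS]mulrAC [leRHS]mulrC ler_pM2l// [leRHS]mulrC ler_pM2l.
have [M [Mp ML Msum]] : exists M : nat -> 'M[R[i]]_(tdim q n), [/\ forall k, psd (M k),
    forall k, (k < L)%N -> M k = wt%:C *: ketbra (eta k) & \sum_(k < L.+1) M k = 1%:M].
  have psd_term k : psd (wt%:C *: ketbra (eta k)).
    by apply: psdZ (ltW wt0) _; exact: psd_ketbra.
  have rest_sum : \sum_(k < L) wt%:C *: ketbra (eta k) + rest = 1%:M by rewrite addrC subrK.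
  clearbody rest.
  exists (fun k => if (k < L)%N then wt%:C *: ketbra (eta k) else rest); split.
  - by move=> k; case: ifP.
  - by move=> k ->.
  - rewrite big_ord_recr/= ltnn -rest_sum; congr (_ + _).
    by apply: eq_bigr => k _; rewrite ltn_ord.
(* Outcome [L] is the remainder; whatever its estimate, it adds a nonnegative score, which is
   dropped. *)
exists L.+1, (fun k => tau * k%:R), M; split=> //.
move=> t; rewrite big_ord_recr/=.
apply: (@le_trans _ _ (\sum_(k < L) wt *
   nc (\sum_(x <- pairs) (amp * b x.2)%:C * expi ((x.1 + x.2) * (tau * k%:R - t))) ^+ 2)).
  have HS x y : x \in pairs -> y \in pairs -> (x.1 + x.2) - (y.1 + y.2) != 0 ->
      nc (\sum_(k < L) expi (((x.1 + x.2) - (y.1 + y.2)) * (tau * k%:R))) <= d' * L%:R.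
    move=> xS yS; apply: H; rewrite mem_cat; apply/orP; right.
    by apply/allpairsP; exists (x, y).
  have := mean_square (fun x => (amp * b x.2)%:C) t d'0 HS.
  rewrite -mulr_sumr distrC -/S => /(le_trans (ler_norm _)).
  have -> : \sum_(i <- pairs) \sum_(j <- pairs)
     (if i.1 + i.2 == j.1 + j.2 then
       complex.Re ((amp * b i.2)%:C * ((amp * b j.2)%:C)^*%C) else 0) = V.
    rewrite /V /overlap_mass mulr_sumr; apply: eq_bigr => x _.
    rewrite mulr_sumr; apply: eq_bigr => y _; case: ifP => _; last by rewrite mulr0.
    rewrite conjc_real -rmorphM /= mulrACA; congr (_ * _).
    by rewrite /amp -invfM -expr2 sqr_sqrtr.
  rewrite lerBlDr -lerBlDl => MS.
  apply: (@le_trans _ _ (wt * (L%:R * V - d' * L%:R * S))); last by rewrite ler_wpM2l// ltW.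
  have -> : wt * (L%:R * V - d' * L%:R * S) = (V - d' * S) / (1 + N%:R * d').
    by rewrite /wt /kap; field; rewrite !gt_eqF.
  rewrite ler_pdivlMr//.
  apply: strategy_value_bound; rewrite ?ler0n ?(ltW d'0) ?(ltW d0)//.
have filt_ge0 k : psd (M k) -> 0 <= expect (filtered e p n flt t) (M k) by exact: psd_expect.
rewrite ler_wpDr//.
  by rewrite mulr_ge0 ?overlap_ge0// filt_ge0.
apply: ler_sum => k _; rewrite ML// expectZ expect_ketbra -mulrA ler_wpM2l ?(ltW wt0)//.
rewrite overlapE// -exprMn -Normc.normcM filtered_flt /eta inner_cstate//.
rewrite le_eqVlt; apply/orP; left; apply/eqP; congr (nc _ ^+ 2).
rewrite /pairs big_allpairs_dep big_distrlr/=; apply: eq_bigr => E _; apply: eq_bigr => F _.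
by rewrite mulrDl expiD mul1r rmorphM mulrACA.
Qed.

Lemma overlap_mass_le_metrology : (overlap_mass%:E <= metrology_fidelity e p n m)%E.
Proof.
apply/lee_subgt0Pr => d d0.
have [K [s [M [Mp Msum HM]]]] := weighted_strategy d0.
have flt_at := ereal_sup_ubound (ex_intro2 _ _ flt flt_filter erefl :
  [set metrology_fidelity_at e p n m f | f in is_filter e p n]%classic
    (metrology_fidelity_at e p n m flt)).
apply: le_trans flt_at.
apply: (@le_trans _ _ (metrology_score e p m flt (finite_povm s Mp Msum) phat)).
  apply: le_ereal_inf_tmp => _ [t _ <-].
  rewrite (@integral_finite_povm _ _ _ s _ Mp Msum (filtered e p n flt t) (overlap e p m phat t)); last 2 first.
  - exact: overlap_ge0.
  - exact: measurable_overlap.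
  by rewrite -EFinB lee_fin.
by apply: ereal_sup_ubound; exists (finite_povm s Mp Msum), phat.
Qed.

Lemma overlap_mass_le_cloning : (overlap_mass%:E <= cloning_fidelity e p n m)%E.
Proof.
apply/lee_subgt0Pr => d d0.
have [K [s [M [Mp Msum HM]]]] := weighted_strategy d0.
have flt_at := ereal_sup_ubound (ex_intro2 _ _ flt flt_filter erefl :
  [set cloning_fidelity_at e p n m f | f in is_filter e p n]%classic
    (cloning_fidelity_at e p n m flt)).
apply: le_trans flt_at.
pose v k := estimate e p m phat (s k).
have v_unit k : inner (v k) (v k) = 1.
  rewrite /v estimateE// inner_cstate// -[RHS]/(1%:C) -phatD.2 rmorph_sum /= big_seq [RHS]big_seq.
  apply: eq_bigr => E ES; rewrite subrr mulr0 expi0 mulr1 -expr2 sqr_sqrtr//.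
  exact: phatD.1.
pose D := measure_prepare_map K M v.
apply: (@le_trans _ _ (cloning_score e p flt D)).
  apply: le_ereal_inf_tmp => _ [t _ <-].
  rewrite expect_measure_prepare// -EFinB lee_fin; apply: (le_trans (HM t)).
  rewrite le_eqVlt; apply/orP; left; apply/eqP; apply: eq_bigr => k _; congr (_ * _).
  rewrite overlapE// /v estimateE// PsiE// inner_cstate//.
apply: ereal_sup_ubound; exists D; split=> //.
  exact: measure_prepare_cp.
exact: measure_prepare_tp.
Qed.

End Lower.

(** * Asymptotics *)

Lemma ler_sum_inj (R : numDomainType) (I : finType) (T : eqType) (f : I -> T)
    (s : seq T) (G : T -> R) :
  uniq s -> injective f -> (forall i, f i \in s) -> (forall x, 0 <= G x) ->
  \sum_i G (f i) <= \sum_(x <- s) G x.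
Proof.
move=> us fI fs G0.
rewrite (bigID (fun x => x \in codom f))/= ler_wpDr ?sumr_ge0//.
rewrite -[leRHS]big_filter -(big_map f xpredT G) le_eqVlt; apply/orP; left; apply/eqP.
apply: perm_big; apply: uniq_perm; rewrite ?filter_uniq ?map_inj_uniq ?index_enum_uniq//.
move=> x; rewrite mem_filter; apply/mapP/andP => [[i _ ->]|[/codomP[i ->] _]].
  by rewrite codom_f.
by exists i; rewrite ?mem_index_enum.
Qed.

Section Window.
Context (R : realType) (q r : nat) (e p : 'I_q.+1 -> R).
Hypothesis e0 : e ord0 = 0.
Context (eps : 'I_r -> R) (K : 'M[int]_(r, q)).
Hypothesis Kunits : energy_units e eps K.
Context (B : 'M[int]_r) (K' : 'M[int]_(r, q)).
Hypothesis KE : K = B *m K'.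
Hypothesis Bdet : \det B != 0.
Hypothesis p_gt0 : forall j, 0 < p j.
Local Notation step := (lattice_step K').
Local Notation lat := (lattice_energy eps B).

Let latI : injective lat := lattice_energy_inj Kunits Bdet.

Lemma spec_prob_lattice m x : spec_prob e p m (lat x) = walk_prob p step m x.
Proof.
apply: eq_bigl => w.
by rewrite (word_energyE e0 Kunits KE) (inj_eq latI).
Qed.

Lemma spec_prob_le_walk m b : (forall x, walk_prob p step m x <= b) ->
  forall E, E \in spectrum e m -> spec_prob e p m E <= b.
Proof.
move=> H E /(spectrumP e0)[w <-].
by rewrite (word_energyE e0 Kunits KE) spec_prob_lattice.
Qed.

Context (n m l d : nat) (x0 : 'I_r -> int) (b : R).
Hypothesis l_gt0 : (0 < l)%N.
Hypothesis dl : (d.*2 <= l)%N.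
Hypothesis b_gt0 : 0 < b.

Let window (x : 'rV[int]_r) := forall i, x0 i <= x 0 i < x0 i + l%:Z.

Hypothesis walk_prob_ge : forall x, window x -> b <= walk_prob p step m x.
Hypothesis walk_diff : forall (w w' : {ffun 'I_n -> 'I_q.+1}) i,
  `|(walk step w - walk step w') 0 i| <= d%:Z.

Let pt (k : {ffun 'I_r -> 'I_l}) : 'rV[int]_r := \row_i (x0 i + (k i)%:Z).

Let pt_window k : window (pt k).
Proof. by move=> i; rewrite mxE lerDl/= ltrD2l ltz_nat ltn_ord. Qed.

Let windowP x : window x -> exists k, x = pt k.
Proof.
move=> xW; have kl i : (`|(x 0 i - x0 i)%R| < l)%N.
  by have := xW i; lia.
exists [ffun i => Ordinal (kl i)]; apply/rowP => i; rewrite mxE ffunE /=.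
have := xW i; lia.
Qed.

(** The uniform law on the energies of the window, as a function of the energy; [lat] being
    injective, no energy is hit twice. *)
Let uniform E : R := \sum_k (lat (pt k) == E)%:R / l%:R ^+ r.

Let lr_gt0 : 0 < l%:R ^+ r :> R.
Proof. by rewrite exprn_gt0// ltr0n. Qed.

Let uniform_ge0 E : 0 <= uniform E.
Proof. by apply: sumr_ge0 => k _; rewrite divr_ge0 ?ler0n ?(ltW lr_gt0). Qed.

Let window_spectrum x : window x -> lat x \in spectrum e m.
Proof.
move=> xW; rewrite (spec_prob_gt0 e0 p_gt0) spec_prob_lattice.
exact: lt_le_trans b_gt0 (walk_prob_ge xW).
Qed.

Let uniformD : is_spectral_distribution e m uniform.
Proof.
split=> //; rewrite /uniform exchange_big/=.
transitivity (\sum_(k : {ffun 'I_r -> 'I_l}) (l%:R ^+ r)^-1 : R).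
  apply: eq_bigr => k _.
  rewrite (bigD1_seq (lat (pt k))) ?fset_uniq ?window_spectrum//= eqxx mul1r.
  by rewrite big1 ?addr0// => E /negPf; rewrite eq_sym => ->; rewrite mul0r.
rewrite sumr_const card_ffun !card_ord -[LHS]mulr_natr natrX mulVf// gt_eqF//.
Qed.

Let amp F := Num.sqrt (uniform F) * Num.sqrt (spec_prob e p m F).

Let amp_ge x : window x -> Num.sqrt (b / l%:R ^+ r) <= amp (lat x).
Proof.
move=> xW; have [k xk] := windowP xW.
rewrite /amp [leRHS]mulrC -sqrtrM ?spec_prob_ge0// ler_sqrt; last first.
  by rewrite mulr_ge0 ?spec_prob_ge0.
rewrite ler_pM ?(ltW b_gt0) ?invr_ge0 ?(ltW lr_gt0)//.
  by rewrite spec_prob_lattice walk_prob_ge.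
by rewrite /uniform (bigD1 k)//= xk eqxx mul1r lerDl sumr_ge0//.
Qed.

(** A coincidence requires moving a window point by the difference [dx] of two walks. Points at
    distance [d] from the boundary stay in the window; there are [(l - 2 d)^r] of them, each
    contributing at least [b / l^r]. *)
Let pair_mass E E' : E \in spectrum e n -> E' \in spectrum e n ->
  (l - d.*2)%:R ^+ r * (b / l%:R ^+ r) <=
  \sum_(F <- spectrum e m) \sum_(F' <- spectrum e m)
    (if E + F == E' + F' then amp F * amp F' else 0).
Proof.
move=> /(spectrumP e0)[w <-] /(spectrumP e0)[w' <-].
rewrite !(word_energyE e0 Kunits KE).
set dx := walk step w - walk step w'.
pose y (k : {ffun 'I_r -> 'I_(l - d.*2)}) : 'rV[int]_r := \row_i (x0 i + d%:Z + (k i)%:Z).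
have yW k : window (y k).
  by move=> i; rewrite mxE; have := ltn_ord (k i); lia.
have yW' k : window (y k + dx).
  move=> i; have := walk_diff w w' i; rewrite -/dx !mxE.
  by have := ltn_ord (k i); lia.
pose f k := (lat (y k), lat (y k + dx)).
have fI : injective f.
  move=> k k' [/latI kk _]; apply/ffunP => i; apply/val_inj.
  have := congr1 (fun v : 'rV[int]_r => v 0 i) kk; by rewrite !mxE => /addrI[].
pose G (x : R * R) := if lat (walk step w) + x.1 == lat (walk step w') + x.2
  then amp x.1 * amp x.2 else 0.
have amp0 F : 0 <= amp F by rewrite mulr_ge0 ?sqrtr_ge0.
have G0 x : 0 <= G x by rewrite /G; case: ifP => // _; rewrite mulr_ge0.
have fs k : f k \in [seq (F, F') | F <- spectrum e m, F' <- spectrum e m].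
  by apply/allpairsP; exists (f k); split=> //; exact: window_spectrum.
have us : uniq [seq (F, F') | F <- spectrum e m, F' <- spectrum e m].
  apply: allpairs_uniq => //; rewrite ?fset_uniq//.
  by move=> [x1 x2] [y1 y2] _ _ [-> ->].
have := ler_sum_inj us fI fs G0; rewrite big_allpairs_dep/=; apply: le_trans.
have -> : (l - d.*2)%:R ^+ r * (b / l%:R ^+ r) =
    \sum_(k : {ffun 'I_r -> 'I_(l - d.*2)}) b / l%:R ^+ r.
  by rewrite sumr_const card_ffun !card_ord -[RHS]mulr_natl natrX.
apply: ler_sum => k _; rewrite /G /f /= -!lattice_energyD.
rewrite (_ : walk step w' + _ = walk step w + y k); last first.
  by rewrite /dx addrCA [X in y k + X]addrC subrK addrC.
rewrite eqxx -[leLHS]sqr_sqrtr; last by rewrite divr_ge0 ?(ltW b_gt0) ?(ltW lr_gt0).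
by rewrite expr2 ler_pM ?sqrtr_ge0 ?amp_ge.
Qed.

Let N : R := #|` spectrum e n|%:R.

(** [pair_mass] applies to all N^2 pairs of input energies, and the normalization of the amplitudes
    takes one factor N back. *)
Lemma window_overlap_mass : exists2 phat, is_spectral_distribution e m phat &
  N * ((l - d.*2)%:R ^+ r * (b / l%:R ^+ r)) <= overlap_mass e p n m phat.
Proof.
exists uniform => //.
rewrite /overlap_mass -/N big_allpairs_dep/=.
under eq_bigr do under eq_bigr do rewrite big_allpairs_dep/=.
under eq_bigr do rewrite exchange_big/=.
set c := _ * (b / _).
have N0 : 0 < N by rewrite ltr0n spectrum_gt0.
rewrite ler_pdivlMl//.
have sumN (x : R) : \sum_(E <- spectrum e n) x = N * x.
  by rewrite big_const_seq count_predT iter_addr addr0 mulr_natl.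
rewrite -!sumN big_seq [leRHS]big_seq; apply: ler_sum => E ES.
rewrite big_seq [leRHS]big_seq; apply: ler_sum => E' E'S.
exact: pair_mass.
Qed.

End Window.

Lemma bernoulli_ineq (R : realDomainType) (u : R) r : 0 <= u <= 1 ->
  1 - r%:R * u <= (1 - u) ^+ r.
Proof.
move=> /andP[u0 u1]; elim: r => [|r IH]; first by rewrite mul0r subr0 expr0.
have u1' : 0 <= 1 - u by rewrite subr_ge0.
rewrite exprS; apply: le_trans (ler_wpM2l u1' IH).
by rewrite -natr1; have := mulr_ge0 (ler0n R r) (mulr_ge0 u0 u0); lra.
Qed.

(** The factor [r + 1] in place of [r] yields [k <= l] even when [r = 0]. *)
Lemma shrunk_cube_ratio (R : realFieldType) (r l k : nat) (eta : R) : (0 < l)%N -> eta <= 1 ->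
  k%:R * r.+1%:R <= eta * l%:R ->
  (k <= l)%N /\ 1 - eta <= (l - k)%:R ^+ r / l%:R ^+ r.
Proof.
move=> l0 eta1 H; have lR : 0 < l%:R :> R by rewrite ltr0n.
have kl : (k <= l)%N.
  rewrite -(ler_nat R) (le_trans (_ : _ <= k%:R * r.+1%:R))//.
    by rewrite ler_peMr// ler1n.
  by rewrite (le_trans H)// ler_piMl// ltW.
split=> //; pose u : R := k%:R / l%:R.
have u0 : 0 <= u by rewrite divr_ge0.
have u1 : u <= 1 by rewrite ler_pdivrMr// mul1r ler_nat.
have -> : (l - k)%:R ^+ r / l%:R ^+ r = (1 - u) ^+ r.
  by rewrite -expr_div_n natrB// mulrBl divff// gt_eqF.
apply: le_trans (bernoulli_ineq r _); rewrite ?u0//.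
have : u * r.+1%:R <= eta by rewrite /u mulrAC ler_pdivrMr.
by rewrite -natr1; lra.
Qed.

(** * Choice of the window and final estimates *)

Section Bounds.
Context (R : realType) (q r : nat) (e p : 'I_q.+1 -> R).
Hypothesis e0 : e ord0 = 0.
Context (eps : 'I_r -> R) (K : 'M[int]_(r, q)).
Hypothesis Kunits : energy_units e eps K.
Context (B : 'M[int]_r) (K' : 'M[int]_(r, q)) (C : 'M[int]_(q, r)).
Hypothesis KE : K = B *m K'.
Hypothesis K'C : K' *m C = 1%:M.
Hypothesis Bdet : \det B != 0.
Hypothesis p_gt0 : forall j, 0 < p j.
Hypothesis p_sum : \sum_j p j = 1.
Local Notation step := (lattice_step K').
Local Notation gam := (llt_const p step).

Let kap : nat := (\sum_j \sum_i `|(step j 0 i)%R|)%N.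

Lemma walk_le n (w : {ffun 'I_n -> 'I_q.+1}) i : `|walk step w 0 i| <= (kap * n)%:Z.
Proof.
rewrite /walk summxE (le_trans (ler_norm_sum _ _ _))//.
rewrite (le_trans (ler_sum _ (_ : forall l, true -> _ <= kap%:Z)))//.
  move=> l _; rewrite -abszE lez_nat /kap (bigD1 (w l))//= (bigD1 i)//=.
  by rewrite -addnA leq_addr.
by rewrite sumr_const card_ord -mulr_natr PoszM natz.
Qed.

Lemma fidelity_sandwich (d : R) : 0 < d -> d < 1 -> exists2 t : R, 0 < t &
  exists m0, forall n m, (m0 <= m)%N -> (0 < m)%N -> n%:R <= t * Num.sqrt m%:R ->
  let A := asymptotic_fidelity p K n m in
  (((1 - d) * A)%:E <= cloning_fidelity e p n m <= ((1 + d) * A)%:E)%E /\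
  (((1 - d) * A)%:E <= metrology_fidelity e p n m <= ((1 + d) * A)%:E)%E.
Proof.
move=> d0 d1.
have g0 : 0 < gam := llt_const_gt0 K'C p_gt0 p_sum.
(* The local limit theorem and the boundary of the window each lose a factor [1 - h], and
   [(1 - h)^2 >= 1 - d]. *)
pose h := d / 2; have h0 : 0 < h by rewrite divr_gt0.
have h1 : h < 1 by rewrite /h; lra.
have [rho rho0 [m1 LLT]] := local_limit p_gt0 p_sum (lattice_step0 K')
  (lattice_step_gen K'C) (mulr_gt0 h0 g0).
(* This ensures [rho * sqrt m >= 2], so rounding the side of the window down at most halves it. *)
have [m2 Hm2] := sqrtr_nat_large (2 / rho).
(* Two walks differ by at most [2 * kap * n], cut off on both sides of the window: a factor 4.
   Another 2 comes from [l >= rho * sqrt m / 2]. *)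
pose D : R := 8 * (kap.+1%:R * r.+1%:R).
have D0 : 0 < D by rewrite !mulr_gt0.
exists (h * rho / D); first by rewrite divr_gt0// mulr_gt0.
exists (maxn m1 m2) => n m; rewrite geq_max => /andP[/LLT[Hup Hlo] /Hm2 m_big] m0 nt A.
set sm := Num.sqrt m%:R in Hup Hlo m_big nt.
have sm0 : 0 < sm by rewrite sqrtr_gt0 ltr0n.
have smr0 : 0 < sm ^+ r by rewrite exprn_gt0.
have AE : A = #|` spectrum e n|%:R * (gam / sm ^+ r).
  exact: (asymptotic_fidelityE Kunits KE K'C Bdet p_gt0 p_sum).
have ub E : E \in spectrum e m -> spec_prob e p m E <= (gam + h * gam) / sm ^+ r.
  apply: (spec_prob_le_walk e0 Kunits KE Bdet) => x.
  by rewrite ler_pdivlMr.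
have N0 : 0 <= #|` spectrum e n|%:R :> R by [].
have A0 : 0 <= A by rewrite AE mulr_ge0// ltW// divr_gt0.
have upA : #|` spectrum e n|%:R * ((gam + h * gam) / sm ^+ r) <= (1 + d) * A.
  have -> : #|` spectrum e n|%:R * ((gam + h * gam) / sm ^+ r) = (1 + h) * A by rewrite AE; ring.
  by rewrite ler_wpM2r// lerD2l /h; lra.
pose l := Num.truncn (rho * sm).
have /andP[l_le l_gt] : l%:R <= rho * sm < l.+1%:R.
  by apply: truncn_itv; rewrite ltW// mulr_gt0.
have two_le : 2 <= rho * sm by rewrite -ler_pdivrMl// mulrC.
have l_half : rho * sm / 2 <= l%:R by move: l_gt; rewrite -natr1; lra.
have l0 : (0 < l)%N by rewrite -(ltr0n R); lra.
(* A window starting at the rounded mean and extending upwards stays within [rho * sqrt m] of the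
   mean. *)
pose x0 i := Num.floor (m%:R * walk_mean p step i).
pose b := (gam - h * gam) / sm ^+ r.
have b0 : 0 < b by rewrite divr_gt0// subr_gt0 gtr_pMl.
have lo (x : 'rV[int]_r) : (forall i, x0 i <= x 0 i < x0 i + l%:Z) -> b <= walk_prob p step m x.
  move=> xW; rewrite /b ler_pdivrMr//; apply: Hlo => i.
  have /andP[f1 f2] := floor_itv (m%:R * walk_mean p step i).
  have /andP[] := xW i; rewrite -(ler_int R) -lez1D -(ler_int R) => g1 g2.
  rewrite !rmorphD/= -pmulrn -/(x0 i) in f1 f2 g1 g2 *.
  rewrite ler_norml; apply/andP; split; lra.
have diff (w w' : {ffun 'I_n -> 'I_q.+1}) i :
    `|(walk step w - walk step w') 0 i| <= ((kap * n).*2)%N%:Z.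
  by rewrite !mxE (le_trans (ler_normB _ _))// -addnn PoszD lerD// walk_le.
have [kl ratio] : ((kap * n).*2.*2 <= l)%N /\
    1 - h <= (l - (kap * n).*2.*2)%:R ^+ r / l%:R ^+ r.
  apply: shrunk_cube_ratio => //; first exact: ltW.
  apply: (@le_trans _ _ (h * (rho * sm / 2))); last by rewrite ler_wpM2l// ltW.
  apply: (@le_trans _ _ (D / 2 * n%:R)).
    have : 0 <= r.+1%:R * n%:R :> R by rewrite mulr_ge0.
    by rewrite /D -!mul2n !natrM -[kap.+1%:R]natr1; lra.
  apply: le_trans (ler_wpM2l (ltW (divr_gt0 D0 (ltr0n _ 2))) nt) _.
  by rewrite le_eqVlt; apply/orP; left; apply/eqP; field; rewrite gt_eqF.
have [phat phatD mass] := window_overlap_mass e0 Kunits KE Bdet p_gt0 l0 kl b0 lo diff.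
have loA : (1 - d) * A <= overlap_mass e p n m phat.
  apply: le_trans mass.
  have -> : #|` spectrum e n|%:R * ((l - (kap * n).*2.*2)%:R ^+ r * (b / l%:R ^+ r)) =
      (1 - h) * ((l - (kap * n).*2.*2)%:R ^+ r / l%:R ^+ r) * A by rewrite AE /b; ring.
  rewrite ler_wpM2r//; apply: (@le_trans _ _ ((1 - h) * (1 - h))).
    have dE : d = h * 2 by rewrite /h divfK.
    have -> : (1 - h) * (1 - h) = 1 - d + h ^+ 2 by rewrite dE; ring.
    by rewrite lerDl sqr_ge0.
  by rewrite ler_wpM2l// subr_ge0 ltW.
split; apply/andP; split.
- by apply: le_trans (overlap_mass_le_cloning e0 p_gt0 n phatD); rewrite lee_fin.
- by apply: (le_trans (cloning_fidelity_le e0 p_gt0 n ub)); rewrite lee_fin.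
- by apply: le_trans (overlap_mass_le_metrology e0 p_gt0 n phatD); rewrite lee_fin.
- by apply: (le_trans (metrology_fidelity_le e0 p_gt0 n ub)); rewrite lee_fin.
Qed.

End Bounds.

Lemma sandwich_cvg (R : realType) (F : nat -> \bar R) (A : nat -> R) :
  (forall k, 0 < A k) ->
  (forall d, 0 < d -> d < 1 ->
    \forall k \near \oo, (((1 - d) * A k)%:E <= F k <= ((1 + d) * A k)%:E)%E) ->
  (F k * ((A k)^-1)%:E)%E @[k --> \oo] --> 1%:E.
Proof.
move=> A0 H; apply/fine_cvgP; split.
  have := H 2^-1 ltac:(lra) ltac:(lra); apply: filterS => k /andP[lo hi].
  rewrite fin_numM// fin_numE; apply/andP; split.
    by apply/eqP => FE; move: lo; rewrite FE.
  by apply/eqP => FE; move: hi; rewrite FE.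
apply/cvgrPdist_le => d0 d00.
pose d := Num.min d0 2^-1.
have d_gt0 : 0 < d by rewrite lt_min d00; lra.
have d_lt1 : d < 1 by rewrite gt_min; apply/orP; right; lra.
have := H d d_gt0 d_lt1; apply: filterS => k /andP[lo hi].
have FE : F k = (fine (F k))%:E.
  rewrite fineK// fin_numE; apply/andP; split.
    by apply/eqP => FE; move: lo; rewrite FE.
  by apply/eqP => FE; move: hi; rewrite FE.
move: lo hi; rewrite /= FE !lee_fin => lo hi.
have dd : d <= d0 by rewrite ge_min lexx.
have Ak := A0 k.
have lo' : 1 - d <= fine (F k) / A k by rewrite ler_pdivlMr.
have hi' : fine (F k) / A k <= 1 + d by rewrite ler_pdivrMr.
rewrite -EFinM [fine _]/(fine (F k) / A k) distrC ler_distl.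
by rewrite (le_trans _ lo') ?lerD2l ?lerN2// (le_trans hi')// lerD2l.
Qed.

Theorem mainTheorem2 (R : realType) (q : nat) (hq : (1 <= q)%N)
    (e p : 'I_q.+1 -> R)
    (he_inj : injective e) (he0 : e ord0 = 0)
    (hp_pos : forall j, 0 < p j) (hp_sum : \sum_(j < q.+1) p j = 1)
    (r : nat) (eps : 'I_r -> R) (K : 'M[int]_(r, q))
    (hK : minimal_energy_units e eps K)
    (n m : nat -> nat)
    (hn : forall k, (1 <= n k)%N) (hm : forall k, (1 <= m k)%N)
    (hm_infty : m k @[k --> \oo] --> \oo)
    (hnm : ((n k)%:R / Num.sqrt (m k)%:R : R) @[k --> \oo] --> (0 : R)) :
  ((cloning_fidelity e p (n k) (m k)
      * ((asymptotic_fidelity p K (n k) (m k))^-1)%:E)%E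
     @[k --> \oo] --> 1%:E) /\
  ((metrology_fidelity e p (n k) (m k)
      * ((asymptotic_fidelity p K (n k) (m k))^-1)%:E)%E
     @[k --> \oo] --> 1%:E).
Proof.
have [B [K' [C [KE K'C Bdet]]]] := smith_factorization hK.
have Kunits := hK.1.
have asym_gt0 k : 0 < asymptotic_fidelity p K (n k) (m k).
  rewrite (asymptotic_fidelityE Kunits KE K'C Bdet hp_pos hp_sum)//.
  rewrite mulr_gt0 ?divr_gt0 ?(llt_const_gt0 K'C hp_pos hp_sum)//; last first.
    by rewrite exprn_gt0// sqrtr_gt0 ltr0n.
  by rewrite ltr0n spectrum_gt0.
have sandwich (d : R) : 0 < d -> d < 1 -> \forall k \near \oo,
    (let A := asymptotic_fidelity p K (n k) (m k) in
    (((1 - d) * A)%:E <= cloning_fidelity e p (n k) (m k) <= ((1 + d) * A)%:E)%E /\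
    (((1 - d) * A)%:E <= metrology_fidelity e p (n k) (m k) <= ((1 + d) * A)%:E)%E).
  move=> d0 d1.
  have [t t0 [m0 H]] := fidelity_sandwich he0 Kunits KE K'C Bdet hp_pos hp_sum d0 d1.
  have nt : \forall k \near \oo, (n k)%:R / Num.sqrt (m k)%:R <= t.
    have /cvgrPdist_le/(_ t t0) := hnm; apply: filterS => k; rewrite sub0r normrN.
    exact: le_trans (ler_norm _).
  have m0m : \forall k \near \oo, (m0 <= m k)%N.
    exact: (hm_infty _ (nbhs_infty_ge m0)).
  near=> k; apply: H => //.
    by near: k.
  rewrite -ler_pdivrMr; first by near: k.
  by rewrite sqrtr_gt0 ltr0n.
by split; apply: sandwich_cvg => // d d0 d1; apply: filterS (sandwich d d0 d1) => k [].
Unshelve. all: by end_near.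
Qed.
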